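(* Let $\mathbf{K}$ be an algebraically closed field of characteristic zero, let $h\ge 1$, and let $r_0,\dots,r_h$ be positive integers. Set $d_1=r_0$, $d_{k+1}=\gcd(r_0,\dots,r_k)$ and $e_k=d_k/d_{k+1}$ for $1\le k\le h$. Assume that $d_{h+1}=1$, that $r_{k+1}d_{k+1}>r_kd_k$ for all $1\le k\le h-1$, and that $r_0,\dots,r_h$ form a minimal system of generators of the semigroup $\Gamma=\langle r_0,\dots,r_h\rangle$. (1) Let $f\in\tilde{\mathbf{R}}$ have degree $r_0$ in $y$ and $\Gamma(f)=\Gamma$, and put $g_k=\mathrm{App}_{d_k}(f)$ for $1\le k\le h+1$ (so $g_1=y$ and $g_{h+1}=f$). Then $(g_1,\dots,g_h,g_{h+1}=f)$ is a $\Gamma$-admissible sequence; that is, $f$ and its approximate roots $g_1,\dots,g_h$ belong to the set of polynomials given by the recursive construction described in the context. (2) Conversely, if $(g_1,\dots,g_h,g_{h+1}=f)$ is a $\Gamma$-admissible sequence, then $f$ is irreducible.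
   Context: $\mathbf{R}=\mathbf{K}[[x]][y]$, and $\tilde{\mathbf{R}}$ is the set of irreducible monic polynomials of $\mathbf{R}$ of the form $y^n+a_2(x)y^{n-2}+\dots+a_n(x)$ (no term in $y^{n-1}$). For irreducible monic $f\in\mathbf{R}$ and $g\in\mathbf{R}$ not divisible by $f$, $\mathrm{int}(f,g)$ is the $x$-order of the $y$-resultant of $f$ and $g$, and $\Gamma(f)=\{\mathrm{int}(f,g): g\in \mathbf{R}\setminus (f)\}$. $\langle r_0,\dots,r_h\rangle$ denotes the set of all combinations of $r_0,\dots,r_h$ with nonnegative integer coefficients. Approximate roots: if $f\in\mathbf{R}$ is monic of degree $n$ in $y$ and $d\mid n$, then $\mathrm{App}_d(f)$ is the unique monic polynomial $g\in\mathbf{R}$ of degree $n/d$ in $y$ such that $\deg_y(f-g^d)<n-n/d$. $\Gamma$-admissible sequences (relative to the ordered sequence $(r_0,\dots,r_h)$) are the sequences $(g_1,\dots,g_{h+1})$ of polynomials of $\mathbf{R}$ defined recursively as follows. First, $g_1=y$. Suppose $g_1,\dots,g_k$ are given, $1\le k\le h$. Let $B^k$ be the set of $\theta=(\theta_0,\dots,\theta_{k-1})\in\mathbb{N}^k$ with $0\le\theta_j<e_j$ for $1\le j\le k-1$ ($\theta_0\ge 0$ arbitrary), and for $\theta\in B^k$ put $M_\theta=x^{\theta_0}g_1^{\theta_1}\cdots g_{k-1}^{\theta_{k-1}}$. For $i\in\mathbb{N}$ let $E(k,i,1)$ be the set of $M_\theta$, $\theta\in B^k$, with $i\,\frac{r_k}{d_{k+1}}=\sum_{j=0}^{k-1}\theta_j\frac{r_j}{d_{k+1}}$,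 and let $E(k,i,2)$ be the set of $M_\theta$, $\theta\in B^k$, with $i\,\frac{r_k}{d_{k+1}}<\sum_{j=0}^{k-1}\theta_j\frac{r_j}{d_{k+1}}$. The set $E(k,e_k,1)$ consists of exactly one element, denoted $M_{\theta^k}$. Then $g_{k+1}$ is required to be of the form $$g_{k+1}=g_k^{e_k}+\alpha_2\,g_k^{e_k-2}+\dots+\alpha_{e_k},$$ where $\alpha_{e_k}=a\,M_{\theta^k}+\sum_{M_\theta\in E(k,e_k,2)}a_\theta M_\theta$ with $a\in\mathbf{K}\setminus\{0\}$ and $a_\theta\in\mathbf{K}$, and, for $2\le i\le e_k-1$, $\alpha_i=\sum_{M_\theta\in E(k,i,2)}a^i_\theta M_\theta$ with $a^i_\theta\in\mathbf{K}$. The sums may be infinite; they are interpreted as elements of $\mathbf{K}[[x]][y]$. *)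

(* Defs.v *)
From HB Require Import structures.
From mathcomp Require Import all_boot all_order all_algebra.
From mathcomp Require Import boolp classical_sets functions cardinality fsbigop.

Set Implicit Arguments.
Unset Strict Implicit.
Unset Printing Implicit Defensive.

Import GRing.Theory.
Local Open Scope ring_scope.
Local Open Scope classical_set_scope.

(* The ring K[[x]]: a series is its sequence of coefficients.                 *)
Record fps (K : fieldType) : Type := Fps { fps_coef :> nat -> K }.

HB.instance Definition _ (K : fieldType) := gen_eqMixin (fps K).
HB.instance Definition _ (K : fieldType) := gen_choiceMixin (fps K).

Section FpsRing.
Variable K : fieldType.
Implicit Types a b c : fps K.

Lemma fpsP a b : (forall n, a n = b n) -> a = b.
Proof. by case: a b => [u] [v] /= uv; congr Fps; apply/funext. Qed.

Definition fpsC (k : K) : fps K := Fps (fun n => if n is 0 then k else 0).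
Definition fpsX : fps K := Fps (fun n => (n == 1%N)%:R).
Definition fps_opp a : fps K := Fps (fun n => - a n).
Definition fps_add a b : fps K := Fps (fun n => a n + b n).
Definition fps_mul a b : fps K :=
  Fps (fun n => \sum_(i < n.+1) a i * b (n - i)%N).

Fact fps_addA : associative fps_add.
Proof. by move=> a b c; apply: fpsP => n; apply: addrA. Qed.
Fact fps_addC : commutative fps_add.
Proof. by move=> a b; apply: fpsP => n; apply: addrC. Qed.
Fact fps_add0 : left_id (fpsC 0) fps_add.
Proof. by move=> a; apply: fpsP => -[|n]; apply: add0r. Qed.
Fact fps_addN : left_inverse (fpsC 0) fps_opp fps_add.
Proof. by move=> a; apply: fpsP => -[|n]; apply: addNr. Qed.

HB.instance Definition _ :=
  GRing.isZmodule.Build (fps K) fps_addA fps_addC fps_add0 fps_addN.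

Let trunc N a : {poly K} := \poly_(i < N) a i.

Let coef_mul_trunc N a b n : (n < N)%N ->
  (trunc N a * trunc N b)`_n = fps_mul a b n.
Proof.
move=> nN; rewrite coefM; apply: eq_bigr => i _; rewrite !coef_poly.
by rewrite (leq_ltn_trans (leq_subr _ _) nN) (leq_ltn_trans _ nN) // -ltnS.
Qed.

Fact fps_mulC : commutative fps_mul.
Proof.
by move=> a b; apply: fpsP => n; rewrite -!(@coef_mul_trunc n.+1) // mulrC.
Qed.

Let coef_mul3 N a b c n : (n < N)%N ->
  fps_mul (fps_mul a b) c n = (trunc N a * trunc N b * trunc N c)`_n.
Proof.
move=> nN; rewrite coefM; apply: eq_bigr => i _.
rewrite coef_mul_trunc ?(leq_ltn_trans _ nN) -1?ltnS // coef_poly.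
by rewrite (leq_ltn_trans (leq_subr _ _) nN).
Qed.

Fact fps_mulA : associative fps_mul.
Proof.
move=> a b c; apply: fpsP => n; rewrite (@coef_mul3 n.+1) //.
by rewrite fps_mulC (@coef_mul3 n.+1) // mulrC mulrA.
Qed.

Fact fps_mul1 : left_id (fpsC 1) fps_mul.
Proof.
move=> a; apply: fpsP => n /=; rewrite big_ord_recl /= mul1r subn0.
by rewrite big1 ?addr0 // => i _; rewrite mul0r.
Qed.

Fact fps_mulDl : left_distributive fps_mul +%R.
Proof.
move=> a b c; apply: fpsP => n /=; rewrite -big_split.
by apply: eq_bigr => i _; rewrite mulrDl.
Qed.

Fact fps_1neq0 : fpsC 1 != 0.
Proof.
apply/eqP => /(congr1 (fun a : fps K => a 0%N)) /= /eqP.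
by rewrite oner_eq0.
Qed.

HB.instance Definition _ :=
  GRing.Zmodule_isComNzRing.Build (fps K)
    fps_mulA fps_mulC fps_mul1 fps_mulDl fps_1neq0.

Lemma fps_coef0 n : (0 : fps K) n = 0. Proof. by case: n. Qed.
Lemma fps_coef1 n : (1 : fps K) n = (n == 0%N)%:R. Proof. by case: n. Qed.
Lemma fps_coefD a b n : (a + b) n = a n + b n. Proof. by []. Qed.
Lemma fps_coefN a n : (- a) n = - a n. Proof. by []. Qed.
Lemma fps_coefM a b n : (a * b) n = \sum_(i < n.+1) a i * b (n - i)%N.
Proof. by []. Qed.

Definition fps_unit : {pred fps K} := fun a => a 0%N != 0.

(* The coefficients of degree < n of the inverse of a.                        *)
Fixpoint inv_coefs a n : seq K :=
  if n is m.+1 then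
    let s := inv_coefs a m in
    rcons s ((a 0%N)^-1 *
      (if m is 0 then 1 else - \sum_(i < m) a i.+1 * s`_(m - i.+1)))
  else [::].

Definition fps_inv a : fps K :=
  if fps_unit a then Fps (fun n => (inv_coefs a n.+1)`_n) else a.

Let size_inv_coefs a n : size (inv_coefs a n) = n.
Proof. by elim: n => //= n IH; rewrite size_rcons IH. Qed.

Let nth_inv_coefs a n i : (i < n)%N ->
  (inv_coefs a n)`_i = (inv_coefs a i.+1)`_i.
Proof.
elim: n => // n IH; rewrite ltnS leq_eqVlt => /predU1P[-> //|lin].
by rewrite [inv_coefs a n.+1]/= nth_rcons size_inv_coefs lin IH.
Qed.

Fact fps_mulV : {in fps_unit, left_inverse 1 fps_inv *%R}.
Proof.
move=> a ua; rewrite mulrC; have a0 : a 0%N != 0 by [].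
have -> : fps_inv a = Fps (fun n => (inv_coefs a n.+1)`_n).
  by rewrite /fps_inv [fps_unit a]ua.
apply: fpsP => n; rewrite fps_coefM fps_coef1 big_ord_recl subn0.
rewrite [fps_coef _ n]/= nth_rcons size_inv_coefs ltnn eqxx mulVKf //.
case: n => [|n]; first by rewrite big_ord0 addr0.
apply/eqP; rewrite addrC subr_eq0; apply/eqP/eq_bigr => i _.
by rewrite [RHS]/= -[LHS]/(a i.+1 * (inv_coefs a _)`_(n.+1 - i.+1))
           [in RHS](@nth_inv_coefs a n.+1) // subSS ltnS leq_subr.
Qed.

Fact fps_unitPl a b : b * a = 1 -> fps_unit a.
Proof.
move=> /(congr1 (fun c : fps K => c 0%N)).
rewrite fps_coefM big_ord1 fps_coef1 => ba; apply/eqP => a0.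
by move/eqP: ba; rewrite a0 mulr0 eq_sym oner_eq0.
Qed.

Fact fps_inv_out : {in [predC fps_unit], fps_inv =1 id}.
Proof. by move=> a /negbTE ua; rewrite /fps_inv [fps_unit a]ua. Qed.

HB.instance Definition _ :=
  GRing.ComNzRing_hasMulInverse.Build (fps K) fps_mulV fps_unitPl fps_inv_out.

Let fps_lead a : a != 0 ->
  exists n, a n != 0 /\ forall m, (m < n)%N -> a m = 0.
Proof.
move=> a0; have exn : exists n, a n != 0.
  apply: contrapT => /forallNP H; move/eqP: a0; apply; apply: fpsP => n.
  by rewrite fps_coef0; apply/eqP/negPn/negP/H.
case: (ex_minnP exn) => n an minn; exists n; split=> // m mn.
by apply/eqP/negPn/negP => /minn; rewrite leqNgt mn.
Qed.

Fact fps_integral a b : a * b = 0 -> (a == 0) || (b == 0).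
Proof.
move=> ab; apply/norP => -[/fps_lead[m [am ma]] /fps_lead[n [bn nb]]].
have := congr1 (fun c : fps K => c (m + n)%N) ab.
have lt_m : (m < (m + n).+1)%N by rewrite ltnS leq_addr.
rewrite fps_coefM fps_coef0 (bigD1 (Ordinal lt_m)) //= addKn.
rewrite big1 ?addr0 => [|i]; first by apply/eqP; rewrite mulf_neq0.
rewrite -val_eqE /= neq_ltn => /orP[im|mi]; first by rewrite ma ?mul0r.
by rewrite nb ?mulr0 // ltn_subLR ?ltn_add2r // -ltnS.
Qed.

HB.instance Definition _ :=
  GRing.ComUnitRing_isIntegral.Build (fps K) fps_integral.

End FpsRing.

Arguments fpsX {K}.

(* The x-order of a nonzero series; the value at 0 is a dummy.                *)
Definition xord (K : fieldType) (s : fps K) : nat :=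
  match pselect (exists n, s n != 0) with
  | left s_neq0 => ex_minn s_neq0
  | right _ => 0%N
  end.

(* MathComp's irreducible_poly refers to pseudo-division, i.e. to K((x))[y];  *)
(* this is irreducibility in the ring itself.                                 *)
Definition irreducible (A : idomainType) (p : A) : Prop :=
  [/\ p != 0, p \isn't a GRing.unit &
      forall a b : A, p = a * b -> a \is a GRing.unit \/ b \is a GRing.unit].

Section PowerSeriesPolynomials.
Variable K : fieldType.
(* K[[x]][y], with y = 'X and x = fpsX%:P.                                    *)
Local Notation R := {poly fps K}.

Definition Rtilde : set R :=
  [set f | [/\ f \is monic, irreducible f & f`_(size f).-2 = 0]].

Definition intersection (f g : R) : nat := xord (resultant f g).

Definition Gamma_of (f : R) : set nat :=
  [set intersection f g | g in [set g : R | ~ exists q, g = q * f]].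

(* As size is degree plus one, and 0 has degree -oo, deg p < m is size p <= m *)
Definition is_App (d : nat) (f g : R) : Prop :=
  [/\ g \is monic, size g = ((size f).-1 %/ d).+1 &
      (size (f - g ^+ d)%R <= (size f).-1 - (size f).-1 %/ d)%N].

(* "The" polynomial satisfying is_App (0 if there is none).                   *)
Definition App (d : nat) (f : R) : R := xget 0 (is_App d f).

(* s is the sum of the F t, t in A, in the coefficientwise sense: each        *)
(* monomial x^n y^j occurs in finitely many terms only.                       *)
Definition is_sum (T : choiceType) (A : set T) (F : T -> R) (s : R) : Prop :=
  forall j n : nat,
    finite_set (A `&` [set t | (F t)`_j n != 0]) /\
    s`_j n = \sum_(t \in A) (F t)`_j n.

End PowerSeriesPolynomials.

Section Sequences.
Local Open Scope nat_scope.
(* Only the values r 0, ..., r h of r are relevant.                           *)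
Variables (h : nat) (r : nat -> nat).

(* d k = gcd (r 0, ..., r k.-1), so d 1 = r 0.                                *)
Definition d (k : nat) : nat := \big[gcdn/0]_(j < k) r j.
Definition e (k : nat) : nat := d k %/ d k.+1.

Definition semigroup_gen (S : {set 'I_h.+1}) : set nat :=
  [set m | exists c : 'I_h.+1 -> nat, m = \sum_(i in S) c i * r i].

Definition Gamma : set nat := semigroup_gen ([set: 'I_h.+1]%SET).

Definition minimal_generators : Prop :=
  forall S : {set 'I_h.+1},
    S \proper [set: 'I_h.+1]%SET -> semigroup_gen S <> Gamma.

Definition B (k : nat) : set {ffun 'I_k -> nat} :=
  [set t : {ffun 'I_k -> nat} | forall j : 'I_k, 0 < j -> t j < e j].

(* The sets of monomials E(k,i,1) and E(k,i,2) are given by their exponents;  *)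
(* the divisions are exact.                                                   *)
Definition E1 (k i : nat) : set {ffun 'I_k -> nat} :=
  [set t : {ffun 'I_k -> nat} | B t /\
     i * (r k %/ d k.+1) = \sum_(j < k) t j * (r j %/ d k.+1)].

Definition E2 (k i : nat) : set {ffun 'I_k -> nat} :=
  [set t : {ffun 'I_k -> nat} | B t /\
     i * (r k %/ d k.+1) < \sum_(j < k) t j * (r j %/ d k.+1)].

End Sequences.

Arguments B r k : clear implicits.
Arguments E1 r k i : clear implicits.
Arguments E2 r k i : clear implicits.

Section Admissible.
Variables (K : fieldType) (h : nat) (r : nat -> nat).
Local Notation R := {poly fps K}.
Implicit Type g : nat -> R.

Definition Mon g (k : nat) (t : {ffun 'I_k -> nat}) : R :=
  \prod_(j < k) (if j == 0%N :> nat then fpsX%:P else g j) ^+ t j.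

Definition Mon_series g (k : nat) (A : set {ffun 'I_k -> nat}) (s : R) : Prop :=
  exists a : {ffun 'I_k -> nat} -> K,
    is_sum A (fun t => fpsC (a t) *: Mon g t) s.

(* Of the sequence g, only the values g 1, ..., g h.+1 are relevant.          *)
Definition admissible g : Prop :=
  g 1%N = 'X /\
  forall k : nat, (1 <= k <= h)%N ->
    exists alpha : nat -> R,
      [/\ g k.+1 = g k ^+ e r k +
            \sum_(2 <= i < (e r k).+1) alpha i * g k ^+ (e r k - i),
          exists2 t, E1 r k (e r k) t &
            exists2 a : K, a != 0 &
              exists2 s : R, Mon_series g (E2 r k (e r k)) s &
                alpha (e r k) = fpsC a *: Mon g t + s
        & forall i : nat, (2 <= i <= (e r k).-1)%N ->
            Mon_series g (E2 r k i) (alpha i)].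

End Admissible.

(* Main.v *)
Require Import Defs.
From HB Require Import structures.
From mathcomp Require Import all_boot all_order all_algebra.
From mathcomp Require Import zify ring.
From mathcomp Require cyclic cyclotomic separable.
From mathcomp Require Import boolp classical_sets functions cardinality fsbigop.

Set Implicit Arguments.
Unset Strict Implicit.
Unset Printing Implicit Defensive.

Import GRing.Theory.
Local Open Scope ring_scope.

(** Everything rests on one fact about a monic irreducible p: the map
    v = int(p, _) is a valuation of K[[x]][y] / (p), with residue field K.  It
    comes from a Puiseux parametrization.  There are a ramification index q and
    a series eta(t) with p(t^q, eta) = 0 ([puiseux_root], proved by Hensel
    lifting after rescaling along the Newton polygon).  The product of the
    factors y - eta' over the distinct conjugates eta' of eta under t -> w t,
    w^q = 1, has its coefficients in K[[t^q]], hence is p.  The resultant of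
    p and g is therefore, up to a unit, the product of the g(t^q, eta'), all of
    the same t-order, and int(p, g) is proportional to the t-order of
    g(t^q, eta) ([irreducible_branch]).  So v is multiplicative and satisfies
    the ultrametric inequality, and two elements of the same value differ by an
    element of larger value after multiplying one of them by a constant
    ([value_is_residue]).

    An admissible sequence ends with an irreducible polynomial.  Let p be an
    irreducible factor of g_{h+1}.  The values v(g_j) are proportional to the
    r_j.  Otherwise look at the first index l where v(g_l) / r_l differs from
    the common ratio v(x) / r_0.  If v(g_l) is too large, v(g_{l+1}) equals the
    value of the monomial a M_theta; if it is too small, v(g_{l+1}) equals
    e_l v(g_l).  In both cases the ratio at l+1 is smaller than all the previous
    ones, because e_l r_l < r_{l+1}, and from then on v(g_{k+1}) = e_k v(g_k)
    keeps it decreasing ([value_step], [value_propagates]).  Thus v(g_{h+1}) is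
    finite, although p divides g_{h+1}.  Proportionality ([branch_values]) gives
    r_0 | r_j v(x) for all j, so r_0 divides v(x) = deg p since the r_j are
    coprime; as deg g_{h+1} = r_0, the factor p is g_{h+1} itself.

    Conversely, let f be irreducible of degree r_0 with semigroup Gamma, and
    v = int(f, _).  Put N_k = e_1 ... e_{k-1}.  If G_1, ..., G_{k-1} are monic of
    degrees N_j with v(G_j) = r_j, the monomials in x, G_1, ..., G_{k-1} with
    exponents bounded by the e_j have distinct values and, for a fixed power of
    x, the distinct degrees 0, ..., N_k - 1.  So the value of a polynomial of
    degree less than N_k is the least value of a term of its expansion
    ([expansion_value]); in particular it is a multiple of d_k.  Since r_k is a
    value and not a multiple of d_k, no monic polynomial of degree N_k has value
    above r_k ([monic_value_le]), and one of smaller value, if above the conductor,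
    can be improved by subtracting a monomial; this yields G_k with v(G_k) = r_k
    ([family_exists]).  If F is monic of degree N_{k+1} with v(F) > e_k r_k, the
    terms of F - G_k^{e_k} have values at least e_k r_k.  Hence the Tschirnhausen
    corrections that turn G_k into the approximate root of F have values above
    r_k and keep v(G_k) = r_k ([approximate_root_value]).  Starting from
    v(f) = oo and going down, every approximate root g_k has value r_k, and the
    same bound on the terms of g_{k+1} - g_k^{e_k}, where the value e_k r_k is
    taken only once, is the admissibility condition
    ([expansion_admissible]). *)

(** * Orders, twists and ramification of power series *)

Section Order.
Variable K : fieldType.
Implicit Types a b c : fps K.

Lemma xordP a : a != 0 -> a (xord a) != 0 /\ forall i, (i < xord a)%N -> a i = 0.
Proof.
move=> a0; rewrite /xord; case: pselect => [H|H].
  case: ex_minnP => m am minm; split=> // i im.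
  by apply/eqP/negPn/negP => /minm; rewrite leqNgt im.
case/eqP: a0; apply: fpsP => n; rewrite fps_coef0.
by apply/eqP/negPn/negP => an; apply: H; exists n.
Qed.

Lemma xord_eq a n : a n != 0 -> (forall i, (i < n)%N -> a i = 0) -> xord a = n.
Proof.
move=> an Hn; have a0 : a != 0.
  by apply/eqP => a0; rewrite a0 fps_coef0 eqxx in an.
have [H1 H2] := xordP a0.
case: (ltngtP (xord a) n) => // [/Hn E|/H2 E]; first by rewrite E eqxx in H1.
by rewrite E eqxx in an.
Qed.

Lemma xordM a b : a != 0 -> b != 0 -> xord (a * b) = (xord a + xord b)%N.
Proof.
move=> /xordP[am ma] /xordP[bn nb].
set m := xord a in am ma *; set n := xord b in bn nb *.
apply: xord_eq.
  rewrite fps_coefM (bigD1 (inord m : 'I_(m + n).+1)) //=.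
  rewrite inordK ?ltnS ?leq_addr // addKn big1 ?addr0 ?mulf_neq0 // => i.
  rewrite -val_eqE /= inordK ?ltnS ?leq_addr // neq_ltn => /orP[im|mi].
    by rewrite ma ?mul0r.
  by rewrite nb ?mulr0 // ltn_subLR ?ltn_add2r // -ltnS.
move=> k kmn; rewrite fps_coefM big1 // => i _.
case: (ltnP i m) => im; first by rewrite ma ?mul0r.
by rewrite nb ?mulr0 //; have := ltn_ord i; lia.
Qed.

Lemma fps_coefX n : (fpsX : fps K) n = (n == 1%N)%:R. Proof. by []. Qed.

Lemma coef_fpsXnM N a n :
  (fpsX ^+ N * a) n = if (n < N)%N then 0 else a (n - N)%N.
Proof.
elim: N n => [|N IH] n; first by rewrite expr0 mul1r subn0.
rewrite exprS -mulrA fps_coefM; case: n => [|n].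
  by rewrite big_ord1 fps_coefX mul0r.
rewrite big_ord_recl fps_coefX mul0r add0r big_ord_recl fps_coefX mul1r.
rewrite big1 ?addr0 => [|i _]; last by rewrite fps_coefX mul0r.
by rewrite IH ltnS /bump /= subn1 subSS.
Qed.

Lemma fpsXn_dvd N a : (forall i, (i < N)%N -> a i = 0) ->
  exists b, a = fpsX ^+ N * b.
Proof.
move=> aN; exists (Fps (fun n => a (n + N)%N)); apply: fpsP => n.
rewrite coef_fpsXnM; case: ltnP => [/aN //|Nn] /=; by rewrite subnK.
Qed.

Lemma fpsX_neq0 : fpsX != 0 :> fps K.
Proof.
apply/eqP => /(congr1 (fun a : fps K => a 1%N)) /=.
by apply/eqP; rewrite oner_eq0.
Qed.

Lemma xordXn N : xord (fpsX ^+ N : fps K) = N.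
Proof.
rewrite -[fpsX ^+ N]mulr1; apply: xord_eq => [|i iN].
  by rewrite coef_fpsXnM ltnn subnn fps_coef1 oner_neq0.
by rewrite coef_fpsXnM iN.
Qed.

Lemma xord_decomp a : a != 0 ->
  exists2 b : fps K, b 0%N != 0 & a = fpsX ^+ xord a * b.
Proof.
move=> a0; have [H1 H2] := xordP a0; have [b ab] := fpsXn_dvd H2.
exists b => //; have := coef_fpsXnM (xord a) b (xord a).
by rewrite -ab ltnn subnn => <-.
Qed.

Lemma xord_unit a : a \is a GRing.unit -> xord a = 0%N.
Proof. by move=> ua; apply: xord_eq. Qed.

Lemma fpsCE (c : K) n : fpsC c n = if n == 0%N then c else 0 :> K.
Proof. by case: n. Qed.

Lemma coef_fpsCM (c : K) a n : (fpsC c * a) n = c * a n.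
Proof.
rewrite fps_coefM big_ord_recl subn0 big1 ?addr0 // => i _.
by rewrite mul0r.
Qed.

Lemma coef_fps_sum (I : Type) (s : seq I) (P : pred I) (F : I -> fps K) n :
  (\sum_(i <- s | P i) F i) n = \sum_(i <- s | P i) F i n.
Proof. by apply: (big_morph (fun a : fps K => a n)) => //; apply: fps_coef0. Qed.

Fact fpsC_is_zmod : zmod_morphism (@fpsC K).
Proof. by move=> a b; apply: fpsP => -[|n] /=; rewrite ?subrr ?fps_coefD ?fps_coefN //= subr0. Qed.
Fact fpsC_is_monoid : monoid_morphism (@fpsC K).
Proof.
split=> // a b; apply: fpsP => n; rewrite coef_fpsCM !fpsCE.
by case: eqP => // _; rewrite mulr0.
Qed.
HB.instance Definition _ := GRing.isZmodMorphism.Build K (fps K) (@fpsC K) fpsC_is_zmod.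
HB.instance Definition _ := GRing.isMonoidMorphism.Build K (fps K) (@fpsC K) fpsC_is_monoid.

(** The substitution t -> w t. *)
Definition twist (w : K) a : fps K := Fps (fun n => w ^+ n * a n).
Fact twist_is_zmod w : zmod_morphism (twist w).
Proof. by move=> a b; apply: fpsP => n /=; rewrite mulrBr. Qed.
Fact twist_is_monoid w : monoid_morphism (twist w).
Proof.
split=> [|a b]; apply: fpsP => n.
  by case: n => [|n]; rewrite /= ?mul1r ?mulr0.
rewrite fps_coefM /= big_distrr /=; apply: eq_bigr => i _.
rewrite mulrACA -exprD subnKC //; by rewrite -ltnS.
Qed.
HB.instance Definition _ w := GRing.isZmodMorphism.Build (fps K) (fps K) (twist w) (twist_is_zmod w).
HB.instance Definition _ w := GRing.isMonoidMorphism.Build (fps K) (fps K) (twist w) (twist_is_monoid w).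

Definition trunc N a : {poly K} := \poly_(i < N) a i.

Lemma coef_mul_trunc N a b n : (n < N)%N ->
  (trunc N a * trunc N b)`_n = (a * b) n.
Proof.
move=> nN; rewrite coefM fps_coefM; apply: eq_bigr => i _; rewrite !coef_poly.
by rewrite (leq_ltn_trans (leq_subr _ _) nN) (leq_ltn_trans _ nN) // -ltnS.
Qed.

(** The substitution x = t^(q+1); the shift makes it a ring morphism for every q. *)
Definition ramify (q : nat) a : fps K :=
  Fps (fun n => if (q.+1 %| n)%N then a (n %/ q.+1)%N else 0).

Lemma ramifyE q a n :
  ramify q a n = if (q.+1 %| n)%N then a (n %/ q.+1)%N else 0.
Proof. by []. Qed.

Fact ramify_is_zmod q : zmod_morphism (ramify q).
Proof.
by move=> a b; apply: fpsP => n /=; case: ifP => // _; rewrite subr0.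
Qed.
(** Up to degree n, series are polynomials and the substitution is composition
    with a power of the variable. *)
Fact ramify_is_monoid q : monoid_morphism (ramify q).
Proof.
split=> [|a b]; apply: fpsP => n.
  rewrite [LHS]/= !fps_coef1; case: (posnP n) => [->|n0]; first by rewrite dvdn0 div0n.
  by case: ifP => // /dvdnP[[|m] nm]; rewrite nm in n0 *; rewrite ?mulnK.
have tr (c : fps K) m : (m < n.+1)%N -> (trunc n.+1 c \Po 'X^(q.+1))`_m = ramify q c m.
  move=> mn; rewrite coef_comp_poly_Xn //= coef_poly.
  by case: ifP => // _; rewrite (leq_ltn_trans (leq_div _ _)).
transitivity (((trunc n.+1 a \Po 'X^(q.+1)) * (trunc n.+1 b \Po 'X^(q.+1)))`_n).
  rewrite -comp_polyM coef_comp_poly_Xn // ramifyE; case: ifP => // _.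
  by rewrite coef_mul_trunc // ltnS leq_div.
rewrite coefM fps_coefM; apply: eq_bigr => i _.
by rewrite !tr // ltnS leq_subr.
Qed.
HB.instance Definition _ q := GRing.isZmodMorphism.Build (fps K) (fps K) (ramify q) (ramify_is_zmod q).
HB.instance Definition _ q := GRing.isMonoidMorphism.Build (fps K) (fps K) (ramify q) (ramify_is_monoid q).

Lemma ramify_inj q : injective (ramify q).
Proof.
move=> a b ab; apply: fpsP => n.
have := congr1 (fun c : fps K => c (n * q.+1)%N) ab.
by rewrite /= dvdn_mull // mulnK.
Qed.

Lemma ramify_eq0 q a : (ramify q a == 0) = (a == 0).
Proof. by rewrite -[RHS](inj_eq (@ramify_inj q)) rmorph0. Qed.

Lemma ramify_fpsX q : ramify q fpsX = fpsX ^+ q.+1.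
Proof.
apply: fpsP => n; rewrite -[fpsX ^+ _]mulr1 coef_fpsXnM fps_coef1 /=.
case: ifP => [/dvdnP[m ->]|nn].
  rewrite mulnK //; case: m => [|[|m]] //=.
    by rewrite mul1n ltnn subnn.
  by rewrite ltnNge (leq_pmull _ (isT : 0 < m.+2)%N) subn_eq0 leqNgt ltn_Pmull.
case: ltnP => // qn; case: eqP => // /eqP; rewrite subn_eq0 => nq.
have : n = q.+1 by lia.
by move=> E; rewrite E dvdnn in nn.
Qed.

Lemma ramify_fpsC q (c : K) : ramify q (fpsC c) = fpsC c.
Proof.
apply: fpsP => n; rewrite ramifyE !fpsCE.
case: (posnP n) => [->|n0]; first by rewrite dvdn0 div0n.
case: ifP => [/dvdnP[m nm]|//]; by rewrite nm mulnK //; case: m nm n0 => // ->.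
Qed.

Lemma ramify_ramify q q' a : ramify q (ramify q' a) = ramify (q.+1 * q'.+1).-1 a.
Proof.
apply: fpsP => n; rewrite !ramifyE prednK ?muln_gt0 //.
case: ifP => [/dvdnP[m ->]|nn]; rewrite ?mulnK //.
  by rewrite [(m * _)%N]mulnC dvdn_pmul2l // divnMl.
case: ifP => // /dvdnP[m nm]; move: nn; rewrite nm.
by rewrite [(q.+1 * _)%N]mulnC mulnA dvdn_mull.
Qed.

Lemma xord_ramify q a : a != 0 -> xord (ramify q a) = (q.+1 * xord a)%N.
Proof.
move=> a0; have [H1 H2] := xordP a0; apply: xord_eq => /=.
  by rewrite dvdn_mulr // mulKn.
by move=> i; case: ifP => // /dvdnP[m ->]; rewrite mulnK // mulnC ltn_mul2l => /andP[_ /H2].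
Qed.

(** Invariance under t -> w t kills every coefficient whose degree is not a
    multiple of the order of w. *)
Lemma twist_fixed q w a : q.+1.-primitive_root w -> twist w a = a ->
  exists b, a = ramify q b.
Proof.
move=> pw aw; exists (Fps (fun n => a (n * q.+1)%N)); apply: fpsP => n /=.
case: ifP => [nn|nn]; first by rewrite divnK.
have := congr1 (fun c : fps K => c n) aw => /= /eqP.
rewrite -subr_eq0 -{2}[a n]mul1r -mulrBl mulf_eq0 subr_eq0.
by rewrite -(prim_order_dvd pw) nn => /eqP.
Qed.

Lemma twist_ramify q w a : w ^+ q.+1 = 1 -> twist w (ramify q a) = ramify q a.
Proof.
move=> w1; apply: fpsP => n /=; case: ifP => [/dvdnP[m ->]|]; last by rewrite mulr0.
by rewrite mulnC exprM w1 expr1n mul1r.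
Qed.

Lemma twist_inj w : w != 0 -> injective (twist w).
Proof.
move=> w0 a b ab; apply: fpsP => n.
have /= := congr1 (fun c : fps K => c n) ab.
by apply: mulfI; rewrite expf_neq0.
Qed.

Lemma twistM w w' a : twist w (twist w' a) = twist (w * w') a.
Proof. by apply: fpsP => n /=; rewrite exprMn mulrA. Qed.

Lemma xord_twist w a : w != 0 -> a != 0 -> xord (twist w a) = xord a.
Proof.
move=> w0 a0; have [H1 H2] := xordP a0; apply: xord_eq => /= [|i /H2 ->].
  by rewrite mulf_neq0 ?expf_neq0.
by rewrite mulr0.
Qed.

End Order.

(** * Hensel lifting *)

(** Recursion in which each value depends on the list of all previous ones. *)
Lemma course_of_values (T : Type) (Phi : seq T -> T) :
  exists f : nat -> T, forall n, f n = Phi (mkseq f n).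
Proof.
pose F n := iter n (fun s => rcons s (Phi s)) [::].
exists (fun n => Phi (F n)) => n; congr Phi.
elim: n => // n IH; rewrite /mkseq -addn1 iotaD map_cat -/(mkseq _ n) -IH.
by rewrite addn1 /= cats1.
Qed.

Section Hensel.
Variable K : fieldType.
Implicit Types P Q : {poly fps K}.

(** Reads P as a power series in x over K[y]. *)
Definition xcoef m P : {poly K} := \poly_(j < size P) P`_j m.

Lemma coef_xcoef m P j : (xcoef m P)`_j = P`_j m.
Proof. by rewrite coef_poly; case: ltnP => // /(nth_default 0)->; rewrite fps_coef0. Qed.

Lemma xcoefM m P Q :
  xcoef m (P * Q) = \sum_(l < m.+1) xcoef l P * xcoef (m - l) Q.
Proof.
apply/polyP => j; rewrite coef_xcoef coefM coef_fps_sum coef_sum.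
under eq_bigr do rewrite fps_coefM.
rewrite exchange_big /=; apply: eq_bigr => l _; rewrite coefM.
by apply: eq_bigr => i _; rewrite !coef_xcoef.
Qed.

(** Bezout with degree control: solves one step of the lifting. *)
Lemma coprime_split (a b r : {poly K}) : coprimep a b -> a != 0 -> b != 0 ->
  (size r <= (size a).-1 + (size b).-1)%N ->
  exists uv : {poly K} * {poly K}, [/\ (size uv.1 < size a)%N,
    (size uv.2 < size b)%N & r = a * uv.2 + uv.1 * b].
Proof.
move=> /Bezout_eq1_coprimepP[[c d] /= cd] a0 b0 sr.
pose u := (r * d) %% a.
have ua : (size u < size a)%N by rewrite ltn_modp.
have dvd : a %| r - u * b.
  have -> : r - u * b = a * (r * c + (r * d) %/ a * b).
    have -> : u = r * d - (r * d) %/ a * a.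
      by apply/eqP; rewrite eq_sym subr_eq addrC -divp_eq.
    set q := _ %/ a; rewrite -{1}(mulr1 r) -cd; ring.
  by rewrite dvdp_mulr.
exists (u, (r - u * b) %/ a) => /=; split=> //; last first.
  by rewrite [a * _]mulrC divpK // subrK.
rewrite ltnNge; apply/negP => H.
have := divpK dvd; set v := _ %/ a in H * => E.
have v0 : v != 0.
  by apply: contraTneq H => ->; rewrite size_poly0 -ltnNge size_poly_gt0.
have := size_polyD r (- (u * b)); rewrite size_polyN -E size_mul //.
have := size_polyMleq u b.
have ar (A B U V S M : nat) : (0 < A)%N -> (0 < B)%N -> (0 < V)%N -> (U < A)%N ->
  (B <= V)%N -> (S <= A.-1 + B.-1)%N -> (M <= (U + B).-1)%N ->
  ~~ ((V + A).-1 <= maxn S M)%N by lia.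
move=> H1 H2; move: H2; apply/negP; apply: ar H1; rewrite ?size_poly_gt0 //.
Qed.

(** The coefficients in x of the two factors are found one after the other: those
    of x^m solve a Bezout equation whose right-hand side involves the previous ones. *)
Lemma hensel P (a b : {poly K}) : P \is monic -> a \is monic -> b \is monic ->
  coprimep a b -> xcoef 0 P = a * b ->
  exists A B : {poly fps K}, [/\ A \is monic, B \is monic,
    size A = size a, size B = size b & P = A * B].
Proof.
move=> mP ma mb cab P0; have a0 := monic_neq0 ma; have b0 := monic_neq0 mb.
have sP : size P = ((size a).-1 + (size b).-1).+1.
  have : size (xcoef 0 P) = size P.
    rewrite size_poly_eq //; move/monicP: mP; rewrite lead_coefE => ->.
    exact: oner_neq0.
  have sa : (0 < size a)%N by rewrite size_poly_gt0.
  have sb : (0 < size b)%N by rewrite size_poly_gt0.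
  by rewrite P0 size_mul // => <-; case: (size a) (size b) sa sb => [//|k] [//|l]; rewrite addnS.
(* The sum runs over the products A_l B_(m-l) with 0 < l < m. *)
pose rhs m (s : seq ({poly K} * {poly K})) := xcoef m P -
  \sum_(0 <= l < m.-1) (nth (0, 0) s l.+1).1 * (nth (0, 0) s (m - l.+1)).2.
pose ok r (uv : {poly K} * {poly K}) := [/\ (size uv.1 < size a)%N,
    (size uv.2 < size b)%N & r = a * uv.2 + uv.1 * b].
pose Phi s := if s is [::] then (a, b) else xget (0, 0) (ok (rhs (size s) s)).
have [f fE] := course_of_values Phi.
have f0 : f 0%N = (a, b) by rewrite fE.
have nf m l : (l < m)%N -> nth (0, 0) (mkseq f m) l = f l by move=> lm; rewrite nth_mkseq.
have main m : (0 < m)%N -> ok (rhs m (mkseq f m)) (f m).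
  elim/ltn_ind: m => m IH m0; rewrite fE.
  have -> : Phi (mkseq f m) = xget (0, 0) (ok (rhs m (mkseq f m))).
    by rewrite -{2}(size_mkseq f m); case: m m0 {IH}.
  apply: xgetPex; apply: coprime_split => //.
  rewrite /rhs (leq_trans (size_polyD _ _)) // geq_max size_polyN; apply/andP; split.
    apply/leq_sizeP => j jb; rewrite coef_xcoef.
    move: jb; rewrite leq_eqVlt => /predU1P[<-|jb].
      have -> : P`_((size a).-1 + (size b).-1) = 1.
        by move/monicP: mP; rewrite lead_coefE sP.
      by rewrite fps_coef1 gtn_eqF.
    by rewrite nth_default ?fps_coef0 ?sP.
  rewrite big_nat_cond; apply: (big_ind (fun p : {poly K} => size p <= _)%N).
  - by rewrite size_poly0.
  - by move=> p q sp sq; rewrite (leq_trans (size_polyD _ _)) // geq_max sp.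
  move=> l; rewrite andbT => /andP[_ lm].
  rewrite !nf; [|lia|lia].
  have [||u1 _ _] := IH l.+1; [lia|by []|].
  have [||_ u2 _] := IH (m - l.+1)%N; [lia|lia|].
  have ar (A B U V : nat) : (U < A -> V < B -> (U + V).-1 <= A.-1 + B.-1)%N by lia.
  exact: leq_trans (size_polyMleq _ _) (ar _ _ _ _ u1 u2).
have s1 m : (size (f m).1 <= size a)%N.
  by case: m => [|m]; [rewrite f0|have [//|] := main m.+1 => /ltnW].
have s2 m : (size (f m).2 <= size b)%N.
  by case: m => [|m]; [rewrite f0|have [//|_] := main m.+1 => /ltnW].
pose A := \poly_(j < size a) Fps (fun m => (f m).1`_j).
pose B := \poly_(j < size b) Fps (fun m => (f m).2`_j).
have xA m : xcoef m A = (f m).1.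
  apply/polyP => j; rewrite coef_xcoef coef_poly; case: ltnP => // H.
  by rewrite fps_coef0 nth_default // (leq_trans (s1 m)).
have xB m : xcoef m B = (f m).2.
  apply/polyP => j; rewrite coef_xcoef coef_poly; case: ltnP => // H.
  by rewrite fps_coef0 nth_default // (leq_trans (s2 m)).
(* Only the coefficient of x^0 of A reaches the degree of a: A is monic. *)
have lA : Fps (fun m => (f m).1`_(size a).-1) = 1.
  apply: fpsP => m; rewrite fps_coef1 /=; case: m => [|m].
    by rewrite f0 -lead_coefE (monicP ma).
  by have [//|H _ _] := main m.+1; rewrite nth_default // -ltnS prednK // size_poly_gt0.
have lB : Fps (fun m => (f m).2`_(size b).-1) = 1.
  apply: fpsP => m; rewrite fps_coef1 /=; case: m => [|m].
    by rewrite f0 -lead_coefE (monicP mb).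
  by have [//|_ H _] := main m.+1; rewrite nth_default // -ltnS prednK // size_poly_gt0.
have sA : size A = size a by rewrite size_poly_eq // lA oner_neq0.
have sB : size B = size b by rewrite size_poly_eq // lB oner_neq0.
have sa : (0 < size a)%N by rewrite size_poly_gt0.
have sb : (0 < size b)%N by rewrite size_poly_gt0.
exists A, B; split=> //.
- by apply/monicP; rewrite lead_coefE sA coef_poly ltn_predL sa.
- by apply/monicP; rewrite lead_coefE sB coef_poly ltn_predL sb.
apply/polyP => j; apply: fpsP => m; rewrite -!coef_xcoef xcoefM.
suff -> : xcoef m P = \sum_(l < m.+1) xcoef l A * xcoef (m - l) B by [].
case: (posnP m) => [->|m0]; first by rewrite big_ord1 P0 xA xB f0.
have [_ _] := main m m0; rewrite /rhs => /eqP; rewrite subr_eq => /eqP ->.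
transitivity (\sum_(l < m.+1) (f l).1 * (f (m - l)%N).2); last first.
  by apply: eq_bigr => l _; rewrite xA xB.
case: m m0 => // m _; rewrite big_mkord [m.+1.-1]/=.
rewrite (eq_bigr (fun l : 'I_m => (f l.+1).1 * (f (m.+1 - l.+1)%N).2)); last first.
  by move=> l _; have := ltn_ord l => lm; rewrite !nf //; lia.
rewrite big_ord_recl big_ord_recr /= subn0 /bump /= add1n subnn f0 /=.
by rewrite -addrA; congr (_ + _); rewrite addrC.
Qed.

End Hensel.

(** * Puiseux roots *)

Lemma coef_XsubC_exp (R : comNzRingType) (c : R) n :
  (('X - c%:P) ^+ n.+1)`_n = - (c *+ n.+1).
Proof.
elim: n => [|n IH]; first by rewrite expr1 coefB coefX coefC sub0r.
rewrite exprSr mulrBr coefB coefMX coefMC IH /=.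
have -> : (('X - c%:P) ^+ n.+1)`_n.+1 = 1.
  have := monic_exp n.+1 (monicXsubC c).
  by move=> /monicP; rewrite lead_coefE size_exp_XsubC.
by rewrite mul1r -opprD -mulrSr.
Qed.

Section Puiseux.
Variable K : closedFieldType.
Hypothesis charK : [pchar K] =i pred0.

Lemma natK_neq0 n : (n.+1%:R : K) != 0.
Proof. by have /pcharf0P -> := charK. Qed.

Lemma root_ex (p : {poly K}) : (1 < size p)%N -> exists c, root p c.
Proof.
move=> sp; apply/closed_rootP; by rewrite neq_ltn sp orbT.
Qed.

(** The vanishing of the second coefficient excludes (X - c)^n with c != 0, so a
    root of p that is not the only one splits off with its multiplicity. *)
Lemma split_reduction (p : {poly K}) n : p \is monic -> size p = n.+2 ->
  p`_n = 0 -> p != 'X^(n.+1) ->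
  exists a b, [/\ a \is monic, b \is monic, (1 < size a)%N, (1 < size b)%N
    & coprimep a b /\ p = a * b].
Proof.
move=> mp sp pn pX; have [c rc] : exists c, root p c by apply: root_ex; rewrite sp.
have [k [u]] := multiplicity_XsubC p c.
rewrite (monic_neq0 mp) /= => uc pE.
have mc := monic_exp k (monicXsubC c).
have mu : u \is monic by rewrite -(monicMr _ mc) -pE.
have k0 : (0 < k)%N.
  by rewrite lt0n; apply: contraNneq uc => k0; rewrite pE k0 expr0 mulr1 in rc.
exists (('X - c%:P) ^+ k), u; split=> //.
- by rewrite size_exp_XsubC ltnS.
- rewrite ltnNge; apply/negP => su.
  have u1 : u = 1.
    have := size1_polyC su => uC; move: mu; rewrite uC monicE lead_coefC => /eqP->.
    by [].
  have kn : k = n.+1 by move: sp; rewrite pE u1 mul1r size_exp_XsubC => -[].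
  move: pn; rewrite pE u1 mul1r kn coef_XsubC_exp => /eqP.
  rewrite oppr_eq0 -mulr_natr mulf_eq0 (negPf (natK_neq0 n)) orbF => /eqP c0.
  by move/eqP: pX; apply; rewrite pE u1 mul1r kn c0 subr0.
- split; last by rewrite mulrC.
  by rewrite coprimep_expl // coprimep_sym coprimep_XsubC.
Qed.

Lemma tschirnhaus (p : {poly fps K}) n : p \is monic -> size p = n.+2 ->
  exists c : fps K, let p1 := p \Po ('X + c%:P) in
    [/\ p1 \is monic, size p1 = n.+2 & p1`_n = 0].
Proof.
move=> mp sp; pose c := fpsC (n.+1%:R^-1) * p`_n.
have nc : c *+ n.+1 = p`_n.
  rewrite -mulr_natl mulrA; have -> : (n.+1%:R : fps K) = fpsC n.+1%:R.
    by rewrite rmorph_nat.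
  by rewrite -rmorphM /= mulfV ?natK_neq0 // rmorph1 mul1r.
exists (- c); move=> p1; rewrite /p1 {p1}.
have sX : size ('X + (- c)%:P) = 2%N by rewrite size_XaddC.
have mX : 'X + (- c)%:P \is monic by rewrite polyCN monicXsubC.
have sp1 : size (p \Po ('X + (- c)%:P)) = n.+2.
  by have := size_comp_poly2 p sX; rewrite sp.
split=> //.
  by rewrite monicE lead_coef_comp ?sX // (monicP mX) expr1n mulr1 (monicP mp).
have pE : p = 'X^(n.+1) + p`_n *: 'X^n + \poly_(i < n) p`_i.
  apply/polyP => i; rewrite !coefD coefZ !coefXn coef_poly.
  case: (ltngtP i n) => H.
  - by rewrite ltn_eqF ?ltnS ?(ltnW H) // mulr0 !add0r.
  - case: eqP => [->|/eqP ne]; last first.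
      by rewrite mulr0 !addr0 nth_default // sp; lia.
    by rewrite mulr0 !addr0; move/monicP: mp; rewrite lead_coefE sp.
  by rewrite H ltn_eqF // mulr1 add0r addr0.
rewrite {1}pE !comp_polyD comp_polyZ !comp_Xn_poly !coefD coefZ polyCN.
rewrite coef_XsubC_exp nc.
have -> : (('X - c%:P) ^+ n)`_n = 1.
  have := monic_exp n (monicXsubC c).
  by move=> /monicP; rewrite lead_coefE size_exp_XsubC.
rewrite mulr1 addNr add0r nth_default //.
have := size_comp_poly2 (\poly_(i < n) p`_i) sX; rewrite polyCN => ->.
exact: size_poly.
Qed.

(** The slope of the edge of the Newton polygon that starts at X^n. *)
Lemma min_slope (p : {poly fps K}) n : p \is monic -> size p = n.+1 -> p != 'X^n ->
  exists j0, [/\ (j0 < n)%N, p`_j0 != 0 & forall j, (j < n)%N -> p`_j != 0 ->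
    (xord (p`_j0)%R * (n - j) <= xord (p`_j)%R * (n - j0))%N].
Proof.
move=> mp sp pX.
have [i0 pi0] : exists i : 'I_n, p`_i != 0.
  apply: contrapT => H; move/eqP: pX; apply; apply/polyP => i; rewrite coefXn.
  case: (ltngtP i n) => Hi; last 2 first.
  - by rewrite nth_default // sp.
  - by rewrite Hi; move/monicP: mp; rewrite lead_coefE sp.
  by apply/eqP/negPn/negP => pi; apply: H; exists (Ordinal Hi).
(* n!/(n - i) clears the denominator of the slope xord / (n - i). *)
pose m (i : 'I_n) := (xord (p`_i)%R * (n`! %/ (n - i)))%N.
case: (@arg_minnP _ i0 (fun i => p`_i != 0) m pi0) => j0 pj0 minj; exists j0; split=> // j jn pj.
have := minj (Ordinal jn) pj; rewrite /m /=.
have fd (i : nat) : (i < n)%N -> (n`! = n`! %/ (n - i) * (n - i))%N.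
  by move=> i_n; rewrite divnK // dvdn_fact // subn_gt0 i_n leq_subr.
have F1 := fd _ (ltn_ord j0); have F2 := fd _ jn.
have f0 := fact_gt0 n; move=> H.
rewrite -(leq_pmul2l f0).
have ar (a b x y u v f : nat) : (a * x <= b * y)%N -> f = (x * u)%N -> f = (y * v)%N ->
    (f * (a * v) <= f * (b * u))%N.
  move=> h fx fy; have E1 : (f * (a * v) = a * x * (u * v))%N by rewrite fx; lia.
  have E2 : (f * (b * u) = b * y * (u * v))%N by rewrite fy; lia.
  by rewrite E1 E2 leq_mul2r h orbT.
exact: ar H F1 F2.
Qed.

(** By induction on the degree: after a Tschirnhausen shift and the rescaling
    x = t^q, y = t^s z given by the Newton polygon, the reduction modulo t is not a
    pure power, hence factors into coprime polynomials, and so does p by Hensel. *)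
Lemma puiseux_root (p : {poly fps K}) : p \is monic -> (1 < size p)%N ->
  exists q eta, root (map_poly (ramify q) p) eta.
Proof.
have [N] := ubnP (size p); elim: N p => // N IH p sN mp sp.
case sE: (size p) sp => [|[|n]] // _.
have [c [mp1 sp1 p1n]] := tschirnhaus mp sE.
set p1 := p \Po _ in mp1 sp1 p1n.
suff [q [eta re]] : exists q eta, root (map_poly (ramify q) p1) eta.
  exists q, (eta + ramify q c); move: re; rewrite /p1 map_comp_poly /= rmorphD /=.
  by rewrite map_polyX map_polyC /= /root horner_comp hornerD hornerX hornerC.
case: (eqVneq p1 'X^(n.+1)) => [->|p1X].
  exists 0%N, 0; by rewrite map_polyXn /root hornerXn expr0n.
have [j0 [j0n pj0 minj]] := min_slope mp1 sp1 p1X.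
(* The slope is s / q.+1: substitute x = t^(q+1), y = t^s z. *)
pose q := (n.+1 - j0).-1; have qE : q.+1 = (n.+1 - j0)%N by rewrite /q; lia.
pose s := xord (p1`_j0)%R.
have exb (j : 'I_n.+2) : exists b, ramify q p1`_j = fpsX ^+ (s * (n.+1 - j)) * b.
  case: (eqVneq p1`_j 0) => [->|pj]; first by exists 0; rewrite rmorph0 mulr0.
  have [|b bE] := @fpsXn_dvd _ (s * (n.+1 - j)) (ramify q p1`_j); last by exists b.
  have jn : (s * (n.+1 - j) <= xord (ramify q (p1`_j)%R))%N.
    rewrite xord_ramify // [leqRHS]mulnC qE.
    case: (ltnP j n.+1) => jn; first exact: minj.
    by have /eqP-> : (n.+1 - j == 0)%N by [];  rewrite muln0.
  have rp : ramify q p1`_j != 0 by rewrite ramify_eq0.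
  by move=> i ij; have [_ ->] := xordP rp; last exact: leq_trans jn.
have [b bE] := choice exb.
pose B (j : nat) := b (inord j).
have BE j : (j < n.+2)%N -> ramify q p1`_j = fpsX ^+ (s * (n.+1 - j)) * B j.
  by move=> jn; have := bE (inord j); rewrite inordK.
have Xs k : fpsX ^+ k != 0 :> fps K by rewrite expf_neq0 ?fpsX_neq0.
have Bn : B n.+1 = 1.
  have := BE n.+1 (leqnn _); rewrite subnn muln0 mul1r => <-.
  by move/monicP: mp1; rewrite lead_coefE sp1 => ->; rewrite rmorph1.
have Bn1 : B n = 0.
  have := BE n (leqW (leqnn _)); rewrite p1n rmorph0 => /esym/eqP.
  by rewrite mulf_eq0 (negPf (Xs _)) => /eqP.
have Bj0 : B j0 0%N != 0.
  have := BE j0 (leqW j0n); have [d d0 dE] := xord_decomp pj0.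
  rewrite dE rmorphM rmorphXn /= ramify_fpsX -exprM -qE mulnC => /(mulfI (Xs _)) <-.
  by rewrite ramifyE dvdn0 div0n.
(* p1 after the substitution, divided by t^(s (n+1)). *)
pose pt := \poly_(j < n.+2) B j.
have spt : size pt = n.+2 by rewrite size_poly_eq // Bn oner_neq0.
have mpt : pt \is monic by apply/monicP; rewrite lead_coefE spt coef_poly ltnSn.
have [||||a [a' [ma ma' sa sa' [cop E]]]] := @split_reduction (xcoef 0 pt) n.
- apply/monicP; rewrite lead_coefE size_poly_eq ?coef_xcoef ?spt ?coef_poly ?ltnSn ?Bn //.
  exact: oner_neq0.
- by rewrite size_poly_eq spt // coef_poly ltnSn Bn oner_neq0.
- by rewrite coef_xcoef coef_poly ltnS leqnSn Bn1.
- apply: contraNneq Bj0 => /(congr1 (fun p : {poly K} => p`_j0)).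
  by rewrite coef_xcoef coef_poly (leqW j0n) coefXn ltn_eqF // => ->.
have [A [A' [mA mA' sA sA' ptE]]] := hensel mpt ma ma' cop E.
have sAN : (size A < N)%N.
  move: spt; rewrite ptE size_monicM ?monic_neq0 // sA sA'.
  have ar (x y : nat) : (1 < x -> 1 < y -> n.+2 < N.+1 -> (x + y).-1 = n.+2 -> x < N)%N by lia.
  by apply: ar => //; rewrite -sE.
have [|q' [eta re]] := IH A sAN mA; first by rewrite sA.
exists ((q'.+1 * q.+1).-1), (ramify q' (fpsX ^+ s) * eta).
have re2 : root (map_poly (ramify q') pt) eta by rewrite ptE rmorphM /= rootM re.
have -> : map_poly (ramify (q'.+1 * q.+1).-1) p1 = map_poly (ramify q') (map_poly (ramify q) p1).
  by apply/polyP => i; rewrite !coef_map /= ramify_ramify.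
rewrite /root (@horner_coef_wide _ n.+2); last first.
  by rewrite (leq_trans (size_poly _ _)) // (leq_trans (size_poly _ _)) // sp1.
move: re2; rewrite /root (@horner_coef_wide _ n.+2); last first.
  by rewrite (leq_trans (size_poly _ _)) // spt.
move=> /eqP; set S := \sum_(i < _) _ => H; apply/eqP.
transitivity (ramify q' ((fpsX : fps K) ^+ (s * n.+1)) * S); last by rewrite H mulr0.
rewrite mulr_sumr; apply: eq_bigr => i _; rewrite !coef_map /= coef_poly ltn_ord BE //.
rewrite rmorphM exprMn -rmorphXn /= !mulrA; congr (_ * _).
rewrite [LHS]mulrAC -rmorphM /= -exprM -exprD; congr (ramify _ (_ ^+ _) * _).
by rewrite -mulnDr subnK // -ltnS.
Qed.

End Puiseux.

(** * The resultant with a split polynomial *)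

Section SplitResultant.
Variable A : idomainType.
Implicit Types (s : seq A) (p g : {poly A}).

(** The Newton basis attached to a sequence of roots: multiplication by g is
    triangular in it modulo the product of all the factors. *)
Definition newton s (i : nat) : {poly A} := \prod_(a <- take i s) ('X - a%:P).

Lemma size_newton s i : (i <= size s)%N -> size (newton s i) = i.+1.
Proof. by move=> h; rewrite size_prod_XsubC size_takel. Qed.

Lemma monic_newton s i : newton s i \is monic.
Proof. exact: monic_prod_XsubC. Qed.

Lemma newtonS s i : (i < size s)%N -> newton s i.+1 = newton s i * ('X - (s`_i)%:P).
Proof.
by move=> h; rewrite /newton (take_nth 0 h) -cats1 big_cat big_seq1.
Qed.

Lemma monic_family_expansion (N : nat -> {poly A}) D g :
  (forall i, (i < D)%N -> N i \is monic /\ size (N i) = i.+1) ->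
  (size g <= D)%N -> exists c : nat -> A, g = \sum_(i < D) c i *: N i.
Proof.
elim: D g => [|D IH] g HN sg.
  by exists (fun=> 0); rewrite big_ord0; apply/eqP; rewrite -size_poly_leq0.
have [mD sD] := HN D (ltnSn D).
have [|c cE] := IH (g - g`_D *: N D) (fun i h => HN i (ltnW h)).
  apply/leq_sizeP => j; rewrite leq_eqVlt coefB coefZ => /predU1P[<-|Dj].
    by move/monicP: mD; rewrite lead_coefE sD => ->; rewrite mulr1 subrr.
  rewrite (nth_default _ (leq_trans sg Dj)).
  by rewrite [(N D)`_j]nth_default ?sD // mulr0 subrr.
exists (fun i => if i == D then g`_D else c i).
rewrite big_ord_recr /= eqxx (eq_bigr (fun i : 'I_D => c i *: N i)).
  by rewrite -cE subrK.
by move=> i _; rewrite ltn_eqF.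
Qed.

(** Repeated division by X - s_i: each step contributes the value of g at a root.
    The coefficient on the diagonal is the value of g itself. *)
Lemma newton_mul s g i : (i <= size s)%N ->
  exists Q (c : nat -> A), newton s i * g = Q * newton s (size s) +
     \sum_(j < size s) c j *: newton s j /\
     ((i < size s)%N -> c i = g.[s`_i]) /\ forall j, (j < i)%N -> c j = 0.
Proof.
move=> si; have [k kE] : exists k, (i + k)%N = size s by exists (size s - i)%N; rewrite subnKC.
elim: k i g si kE => [|k IH] i g si kE.
  rewrite addn0 in kE; exists g, (fun=> 0); rewrite kE mulrC; split.
    by rewrite big1 ?addr0 // => j _; rewrite scale0r.
  by rewrite ltnn.
have il : (i < size s)%N by lia.
have [h hE] : exists h, g = g.[s`_i]%:P + ('X - (s`_i)%:P) * h.
  have /factor_theorem[h hE] : root (g - g.[s`_i]%:P) s`_i.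
    by rewrite /root hornerD hornerN hornerC subrr.
  by exists h; rewrite mulrC -hE addrC subrK.
have [|Q [c [E [_ c0]]]] := IH i.+1 h il; first by rewrite addSnnS.
exists Q, (fun j => if j == i then g.[s`_i] else c j); split; last first.
  split=> [_|j ji]; first by rewrite eqxx.
  by rewrite ltn_eqF // c0 // ltnW.
rewrite {1}hE mulrDr mulrA -newtonS // E addrCA; congr (_ + _).
rewrite (bigD1 (Ordinal il)) //= [RHS](bigD1 (Ordinal il)) //= eqxx c0 //.
rewrite scale0r add0r mulrC mul_polyC; congr (_ + _).
by apply: eq_bigr => j /negPf; rewrite -val_eqE /= => ->.
Qed.

(** The matrix whose rows are the coefficients of a family of polynomials. *)
Definition rows m D (F : nat -> {poly A}) : 'M[A]_(m, D) :=
  \matrix_(i < m, j < D) (F i)`_j.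

Lemma rows_id n : rows n n (fun i => 'X^i) = 1%:M.
Proof. by apply/matrixP => i j; rewrite !mxE coefXn eq_sym. Qed.

Lemma Sylvester_rows p g : Sylvester_mx p g =
  col_mx (rows (size g).-1 _ (fun i => p * 'X^i)) (rows (size p).-1 _ (fun i => g * 'X^i)).
Proof.
apply/matrixP => i j; rewrite Sylvester_mxE !mxE; case: splitP => k ik; rewrite !mxE ?coefMXn //=.
  by case: ltnP.
by case: ltnP.
Qed.

(** A row operation turns the rows X^i g of the Sylvester matrix into N_i g, with
    N_i the Newton basis.  Expressed in the basis formed by the N_i and the X^j p,
    the result is block triangular with diagonal 1, ..., 1, g(a_1), ..., g(a_n).
    The change of basis is unimodular, whence the unit u. *)
Lemma resultant_split s g : g != 0 -> exists2 u : A, u \is a GRing.unit &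
  resultant (\prod_(a <- s) ('X - a%:P)) g = u * \prod_(a <- s) g.[a].
Proof.
move=> g0; set p := \prod_(a <- s) _.
have pN : p = newton s (size s) by rewrite /newton take_size.
have mp : p \is monic by rewrite monic_prod_XsubC.
have sp : (size p).-1 = size s by rewrite size_prod_XsubC.
rewrite /resultant Sylvester_rows.
set m := (size g).-1; rewrite sp; set n := size s.
have p0 := monic_neq0 mp.
pose V := \matrix_(i < n, j < n) (newton s i)`_j.
have NX i : (i < n)%N -> newton s i = \sum_(l < n) (newton s i)`_l *: 'X^l.
  move=> i_n; rewrite -[LHS]coefK poly_def (size_newton (ltnW i_n)).
  rewrite (big_ord_widen n (fun l => (newton s i)`_l *: 'X^l)) // big_mkcond.
  apply: eq_bigr => l _; case: ltnP => // il.
  by rewrite nth_default ?scale0r // size_newton // ltnW.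
have detV : \det V = 1.
  rewrite det_trig; last first.
    apply/is_trig_mxP => i j ij; rewrite mxE nth_default // size_newton //.
    by rewrite ltnW // (ltn_trans _ (ltn_ord j)).
  rewrite big1 // => i _; rewrite mxE; have := monic_newton s i.
  by rewrite monicE lead_coefE size_newton ?(ltnW (ltn_ord i)) // => /eqP.
(* The basis N_0, ..., N_(n-1), p, p X, ..., p X^(m-1), up to the order. *)
pose C := col_mx (rows m (m + n) (fun i => p * 'X^i)) (rows n (m + n) (newton s)).
have unitC : \det C \is a GRing.unit.
  pose N i := if (i < n)%N then newton s i else p * 'X^(i - n).
  have HN i : (i < m + n)%N -> N i \is monic /\ size (N i) = i.+1.
    rewrite /N => _; case: ltnP => ni.
      by rewrite monic_newton size_newton // ltnW.
    rewrite monicMl // monicXn size_monicM ?monic_neq0 ?monicXn // size_polyXn.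
    by rewrite size_prod_XsubC addSn /= addnS subnKC.
  have ex (k : 'I_(m + n)) : exists c : nat -> A, 'X^k = \sum_(i < m + n) c i *: N i.
    by apply: monic_family_expansion => //; rewrite size_polyXn.
  have [c cE] := choice ex.
  have sumE (F : nat -> {poly A}) :
      \sum_(i < m + n) F i = \sum_(i < n) F i + \sum_(i < m) F (n + i)%N.
    by rewrite addnC big_split_ord.
  pose D := row_mx (\matrix_(k < m + n, i < m) c k (n + i)%N)
                   (\matrix_(k < m + n, i < n) c k i).
  have : D *m C = 1%:M.
    rewrite mul_row_col -rows_id; apply/matrixP => k j; rewrite !mxE cE.
    rewrite (sumE (fun i => c k i *: N i)) coefD !coef_sum addrC.
    congr (_ + _); apply: eq_bigr => i _; rewrite coefZ !mxE /N.
      by rewrite ltn_ord.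
    by rewrite ltnNge leq_addr /= addKn.
  move/(congr1 determinant); rewrite det_mulmx det1 => dc.
  by apply/unitrP; exists (\det D); rewrite dc mulrC dc.
have ex (i : 'I_n) : exists Qc : {poly A} * (nat -> A),
   newton s i * g = Qc.1 * p + \sum_(j < n) Qc.2 j *: newton s j /\
     Qc.2 i = g.[s`_i] /\ forall j, (j < i)%N -> Qc.2 j = 0.
  have [Q [c [E [ci cj]]]] := newton_mul g (ltnW (ltn_ord i)).
  by exists (Q, c); rewrite /= pN; split=> //; split=> //; apply: ci.
have [Qc QcE] := choice ex.
have sQ i : (size (Qc i).1 <= m)%N.
  have [E _] := QcE i; rewrite leqNgt; apply/negP => mQ.
  have Q0 : (Qc i).1 != 0 by rewrite -size_poly_gt0 (leq_trans _ mQ).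
  have : (size ((Qc i).1 * p)%R <= m + n)%N.
    have -> : (Qc i).1 * p = newton s i * g - \sum_(j < n) (Qc i).2 j *: newton s j.
      by rewrite E addrK.
    rewrite (leq_trans (size_polyD _ _)) // geq_max size_polyN; apply/andP; split.
      rewrite size_monicM ?monic_newton // size_newton ?(ltnW (ltn_ord i)) //.
      rewrite addSn /= addnC -(prednK (_ : 0 < size g)%N) ?size_poly_gt0 //.
      by rewrite addSnnS leq_add2l.
    apply: (leq_trans (size_sum _ _ _)); apply/bigmax_leqP => j _.
    rewrite (leq_trans (size_scale_leq _ _)) // size_newton ?(ltnW (ltn_ord j)) //.
    by rewrite (leq_trans (ltn_ord j)) // leq_addl.
  rewrite size_Mmonic // size_prod_XsubC addnS /= -/n leq_add2r.
  by rewrite leqNgt mQ.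
pose U := \matrix_(i < n, l < m) ((Qc i).1)`_l.
pose T := \matrix_(i < n, j < n) (Qc i).2 j.
have detT : \det T = \prod_(a <- s) g.[a].
  rewrite -det_tr det_trig.
    rewrite (big_nth 0) big_mkord; apply: eq_bigr => i _; rewrite !mxE.
    by have [_ []] := QcE i.
  by apply/is_trig_mxP => i j ij; rewrite !mxE; have [_ [_ ->]] := QcE j.
(* Left: the row operation on the Sylvester matrix.  Right: its expression in C. *)
have key : block_mx 1%:M 0 0 V *m
   col_mx (rows m (m + n) (fun i => p * 'X^i)) (rows n (m + n) (fun i => g * 'X^i))
   = block_mx 1%:M 0 U T *m C.
  rewrite !mul_block_col !mul1mx !mul0mx !addr0 add0r; congr col_mx.
  apply/matrixP => i j.
  transitivity ((newton s i * g)`_j).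
    rewrite {1}NX // mulr_suml coef_sum !mxE; apply: eq_bigr => l _.
    by rewrite !mxE -scalerAl coefZ [g * _]mulrC.
  have [-> _] := QcE i; rewrite coefD !mxE; congr (_ + _).
    rewrite -{1}[(Qc i).1]coefK poly_def (big_ord_widen m (fun l => ((Qc i).1)`_l *: 'X^l)) //.
    rewrite big_mkcond /= mulr_suml coef_sum; apply: eq_bigr => l _; rewrite !mxE.
    case: ltnP => ls; first by rewrite -scalerAl coefZ [p * _]mulrC.
    by rewrite mul0r coef0 nth_default // mul0r.
  by rewrite coef_sum; apply: eq_bigr => l _; rewrite !mxE coefZ.
have := congr1 determinant key.
rewrite !det_mulmx det_ublock det_lblock !det1 detV !mul1r detT => ->.
by exists (\det C) => //; rewrite mulrC.
Qed.

End SplitResultant.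

(** * The branch of an irreducible polynomial *)

Lemma map_resultant_inj (A B : idomainType) (f : {rmorphism A -> B}) (p g : {poly A}) :
  injective f -> f (resultant p g) = resultant (map_poly f p) (map_poly f g).
Proof.
move=> f_inj; rewrite /resultant /Sylvester_mx !(size_map_inj_poly f_inj (rmorph0 f)).
rewrite -det_map_mx /= map_col_mx; congr (\det (col_mx _ _));
  by apply: map_lin1_mx => v; rewrite map_poly_rV rmorphM /= map_rVpoly.
Qed.

Section Branch.
Variable K : closedFieldType.
Hypothesis charK : [pchar K] =i pred0.
Local Notation R := {poly fps K}.
Implicit Types p g : R.

(** X^(q+1) - 1 is separable in characteristic zero. *)
Lemma prim_root_ex q : exists w : K, q.+1.-primitive_root w.
Proof.
pose P : {poly K} := 'X^(q.+1) - 1; have mP : P \is monic by exact: monicXnsubC.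
have [rs rsE] := closed_field_poly_normal P.
rewrite (monicP mP) scale1r in rsE.
have : separable.separable_poly P.
  apply: cyclotomic.separable_Xn_sub_1; exact: natK_neq0.
rewrite rsE separable.separable_prod_XsubC => urs.
have srs : size rs = q.+1.
  by have := size_XnsubC (1 : K) (ltn0Sn q); rewrite -/P rsE size_prod_XsubC => -[].
have : has q.+1.-primitive_root rs.
  apply: cyclic.has_prim_root; rewrite ?srs //.
  by apply/allP => z zrs; rewrite /root_of_unity -/P rsE root_prod_XsubC.
by case/hasP => w _ pw; exists w.
Qed.

Lemma irreducible_size p : irreducible p -> p \is monic -> (1 < size p)%N.
Proof.
case=> p0 pu _ mp; rewrite ltnNge; apply/negP => sp; move/negP: pu; apply.
have pC := size1_polyC sp; move: mp; rewrite pC monicE lead_coefC => /eqP->.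
exact: unitr1.
Qed.

(** The value of g along x = t^(q+1), y = eta(t). *)
Definition branch q (eta : fps K) (g : R) : fps K := (map_poly (ramify q) g).[eta].

Lemma branchD q eta g g' : branch q eta (g + g') = branch q eta g + branch q eta g'.
Proof. by rewrite /branch rmorphD hornerD. Qed.
Lemma branchM q eta g g' : branch q eta (g * g') = branch q eta g * branch q eta g'.
Proof. by rewrite /branch rmorphM hornerM. Qed.
Lemma branchC q eta a : branch q eta a%:P = ramify q a.
Proof. by rewrite /branch map_polyC hornerC. Qed.
Lemma branch_twist q eta (w : K) g : w ^+ q.+1 = 1 ->
  branch q (twist w eta) g = twist w (branch q eta g).
Proof.
move=> w1; rewrite /branch -horner_map; congr (_.[_]).
by apply/polyP => i; rewrite !coef_map /= twist_ramify.
Qed.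

(** The minimal polynomial of eta over K[[t^(q+1)]] is the product over the
    distinct conjugates of eta.  It divides every g vanishing along the branch, so
    it is p; conjugate series have the same order, which gives the formula for the
    intersection number. *)
Lemma irreducible_branch p : irreducible p -> p \is monic ->
  exists q eta, (forall g, branch q eta g = 0 <-> exists h, g = h * p) /\
    (forall g, branch q eta g != 0 ->
       (q.+1 * intersection p g = (size p).-1 * xord (branch q eta g))%N).
Proof.
move=> ip mp; have sp := irreducible_size ip mp.
have [q [eta re]] := puiseux_root charK mp sp.
have [w pw] := prim_root_ex q.
have w1 : w ^+ q.+1 = 1 by exact: prim_expr_order.
have wi i : (w ^+ i) ^+ q.+1 = 1 by rewrite exprAC w1 expr1n.
have w0 : w != 0 by apply: contra_eq_neq w1 => ->; rewrite expr0n eq_sym oner_neq0.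
(* The distinct conjugates of eta. *)
pose S := undup [seq twist (w ^+ i) eta | i <- iota 0 q.+1].
have SP c : c \in S -> exists2 v : K, v ^+ q.+1 = 1 & c = twist v eta.
  by rewrite mem_undup => /mapP[i _ ->]; exists (w ^+ i).
have etaS : eta \in S.
  rewrite mem_undup; apply/mapP; exists 0%N; rewrite ?mem_iota //.
  by apply: fpsP => n; rewrite /= expr0 expr1n mul1r.
have uS : uniq S by exact: undup_uniq.
(* The twist permutes the conjugates, so their polynomial has fixed coefficients. *)
have rS : perm_eq (map (twist w) S) S.
  have uS' : uniq (map (twist w) S) by rewrite map_inj_uniq //; apply: twist_inj.
  have sub : {subset map (twist w) S <= S}.
    move=> _ /mapP[c + ->]; rewrite !mem_undup => /mapP[i _ ->].
    rewrite twistM -exprS -(prim_expr_mod pw).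
    by apply/mapP; exists (i.+1 %% q.+1)%N; rewrite // mem_iota /= ltn_mod.
  have [|_ E] := uniq_min_size uS' sub; first by rewrite size_map.
  exact: uniq_perm.
pose Pt := \prod_(c <- S) ('X - c%:P).
have PtT : map_poly (twist w) Pt = Pt.
  by rewrite map_prod_XsubC -[RHS](perm_big _ rS) big_map.
have ex i : exists b, Pt`_i = ramify q b.
  by apply: twist_fixed pw _; rewrite -coef_map /= PtT.
have [b bE] := choice ex.
pose P := \poly_(i < size Pt) b i.
have PtE : map_poly (ramify q) P = Pt.
  apply/polyP => i; rewrite coef_map coef_poly; case: ltnP => // h.
  by rewrite /= rmorph0 nth_default.
have mPt : Pt \is monic by exact: monic_prod_XsubC.
have sP : size P = (size S).+1.
  by rewrite -(size_map_inj_poly (@ramify_inj _ q) (rmorph0 _)) PtE size_prod_XsubC.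
have mP : P \is monic.
  rewrite monicE -(inj_eq (@ramify_inj _ q)) rmorph1.
  by rewrite -lead_coef_map_inj ?PtE ?rmorph0 //; apply: ramify_inj.
(* The remainder of g by P has more roots than its degree allows. *)
have dvdP g : branch q eta g = 0 -> exists h, g = h * P.
  move=> g0; exists (divp g P).
  have E := Pdiv.IdomainMonic.divp_eq mP g.
  rewrite {1}E; set r := modp g P in E *.
  suff -> : r = 0 by rewrite addr0.
  have rS0 : all (root (map_poly (ramify q) r)) S.
    apply/allP => c cS; have [v v1 cE] := SP c cS.
    have : branch q c g = 0 by rewrite cE branch_twist // g0 rmorph0.
    rewrite E branchD branchM {2}/branch PtE.
    have /rootP -> : root Pt c by rewrite root_prod_XsubC.
    by rewrite mulr0 add0r => /eqP.
  apply/eqP/negPn/negP => r0.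
  have r0' : map_poly (ramify q) r != 0 by rewrite map_poly_eq0_id0 // ramify_eq0 lead_coef_eq0.
  have := max_poly_roots r0' rS0 uS.
  rewrite size_map_inj_poly ?rmorph0 //; last exact: ramify_inj.
  by apply/negP; rewrite -leqNgt -ltnS -sP ltn_modp monic_neq0.
have [h hE] := dvdP p (eqP re).
have pP : p = P.
  have mh : h \is monic by rewrite -(monicMr _ mP) -hE.
  case: ip => _ _ /(_ h P hE)[] u.
    suff -> : p = h * P by have := u; rewrite poly_unitE => /andP[/eqP sh _];
      have := size1_polyC (eq_leq sh) => hC; move: mh;
      rewrite hC monicE lead_coefC => /eqP ->; rewrite mul1r.
    exact: hE.
  move: u; rewrite poly_unitE sP => /andP[/eqP [/size0nil S0]].
  by rewrite S0 in etaS.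
exists q, eta; split=> [g|g g0].
  split=> [/dvdP|[k ->]]; first by rewrite pP.
  by rewrite branchM [branch q eta p](eqP re) mulr0.
have gn0 : map_poly (ramify q) g != 0.
  by apply: contraNneq g0; rewrite /branch => ->; rewrite horner0.
have [u uu resE] := resultant_split S gn0.
have : ramify q (resultant p g) = u * \prod_(c <- S) branch q c g.
  by rewrite map_resultant_inj ?{1}pP ?PtE //; apply: ramify_inj.
have bc c : c \in S -> branch q c g != 0 /\ xord (branch q c g) = xord (branch q eta g).
  move=> /SP[v v1 ->]; have v0 : v != 0.
    by apply: contra_eq_neq v1 => ->; rewrite expr0n eq_sym oner_neq0.
  rewrite branch_twist // xord_twist //; split=> //.
  by rewrite -[X in _ != X](rmorph0 (twist v)) (inj_eq (twist_inj v0)).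
rewrite big_seq => E.
have pr0 : \prod_(c <- S | c \in S) branch q c g != 0.
  by rewrite prodf_seq_neq0; apply/allP => c cS; apply/implyP => _; have [] := bc c cS.
have u0 : u != 0 by apply: contraTneq uu => ->; rewrite unitr0.
have res0 : resultant p g != 0 by rewrite -(ramify_eq0 q) E mulf_neq0.
move: (congr1 (@xord K) E); rewrite xord_ramify // xordM // (xord_unit uu) add0n.
rewrite /intersection => ->.
rewrite pP sP /=.
have gen (T : seq (fps K)) : {subset T <= S} ->
   \prod_(c <- T) branch q c g != 0 /\
   xord (\prod_(c <- T) branch q c g) = (size T * xord (branch q eta g))%N.
  elim: T => [_|c T IH sT].
    by rewrite big_nil oner_neq0 xord_unit // unitr1.
  have [b1 b2] := bc c (sT c (mem_head _ _)).
  have [|i1 i2] := IH; first by move=> z zT; apply: sT; rewrite inE zT orbT.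
  by rewrite big_cons mulf_neq0 // xordM // b2 i2 mulSn.
by rewrite -big_seq; have [_ ->] := gen S (fun _ h => h).
Qed.

End Branch.

(** * The valuation of a branch *)

Section Valuation.
Variable K : closedFieldType.
Hypothesis charK : [pchar K] =i pred0.
Local Notation R := {poly fps K}.

Definition divides (p g : R) : Prop := exists q, g = q * p.
(** The value of a multiple of p is infinite, whereas [intersection] then returns
    a dummy number; hence the disjunction. *)
Definition value_ge (p : R) m g := divides p g \/ (m <= intersection p g)%N.
Definition value_is (p : R) m g := ~ divides p g /\ intersection p g = m.

Variable p : R.
Hypotheses (ip : irreducible p) (mp : p \is monic).
Implicit Types g a b : R.

Lemma xord_geD (a b : fps K) k : a + b != 0 ->
  a = 0 \/ (k <= xord a)%N -> b = 0 \/ (k <= xord b)%N -> (k <= xord (a + b)%R)%N.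
Proof.
have low (c : fps K) i : c = 0 \/ (k <= xord c)%N -> (i < k)%N -> c i = 0.
  case=> [->|kc] ik; first exact: fps_coef0.
  case: (eqVneq c 0) => [->|c0]; first exact: fps_coef0.
  by have [_ ->] := xordP c0; last exact: leq_trans kc.
move=> ab0 Ha Hb; rewrite leqNgt; apply/negP => lt.
have [] := xordP ab0; rewrite fps_coefD (low a) // (low b) // addr0.
by rewrite eqxx.
Qed.

Lemma value_ge0 g : value_ge p 0 g. Proof. by right. Qed.

Lemma value_ge_zero m : value_ge p m 0. Proof. by left; exists 0; rewrite mul0r. Qed.

Lemma value_geW m m' g : (m' <= m)%N -> value_ge p m g -> value_ge p m' g.
Proof. by move=> h [d|H]; [left|right; apply: leq_trans H]. Qed.

Lemma value_is_ge m g : value_is p m g -> value_ge p m g.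
Proof. by case=> _ <-; right. Qed.

Lemma value_is_le m m' g : value_is p m g -> value_ge p m' g -> (m' <= m)%N.
Proof. by case=> nd <- []. Qed.

Lemma value_is_uniq m m' g : value_is p m g -> value_is p m' g -> m = m'.
Proof. by case=> _ <- []. Qed.

Lemma value_ge_or m g : value_ge p m g \/ exists2 k, value_is p k g & (k < m)%N.
Proof.
case: (pselect (divides p g)) => d; first by left; left.
case: (leqP m (intersection p g)) => h; first by left; right.
by right; exists (intersection p g).
Qed.

(** The part of [irreducible_branch] that the theory of the valuation needs. *)
Lemma branch_valuation : exists Q N (phi : R -> fps K), [/\ (0 < Q)%N /\ (0 < N)%N,
  N = (size p).-1 /\ (forall a b, phi (a + b) = phi a + phi b) /\
    (forall a b, phi (a * b) = phi a * phi b),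
  (forall c, phi (fpsC c)%:P = fpsC c) /\ phi fpsX%:P = fpsX ^+ Q,
  (forall g, phi g = 0 <-> divides p g) &
  forall g, phi g != 0 -> (Q * intersection p g = N * xord (phi g))%N].
Proof.
have [q [eta [H1 H2]]] := irreducible_branch charK ip mp.
have sp := irreducible_size ip mp.
exists q.+1, (size p).-1, (branch q eta); split=> //.
- by rewrite -subn1 subn_gt0.
- by split=> //; split; [apply: branchD|apply: branchM].
- by split=> [c|]; rewrite branchC ?ramify_fpsC ?ramify_fpsX.
Qed.

(** Values are orders along the branch, up to the ratio Q / N.  This ratio need
    not be 1: the index Q of the parametrization may be a multiple of deg p. *)
Lemma valuationP : exists Q N (phi : R -> fps K), [/\ (0 < Q)%N /\ (0 < N)%N,
  N = (size p).-1 /\ (forall a b, phi (a + b) = phi a + phi b) /\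
    (forall a b, phi (a * b) = phi a * phi b),
  (forall c, phi (fpsC c)%:P = fpsC c) /\ phi fpsX%:P = fpsX ^+ Q,
  (forall m g, value_ge p m g <-> phi g = 0 \/ (Q * m <= N * xord (phi g))%N) &
  (forall m g, value_is p m g <-> phi g != 0 /\ (Q * m = N * xord (phi g))%N)].
Proof.
have [Q [N [phi [[Q0 N0] H3 H4 H5 H6]]]] := branch_valuation.
exists Q, N, phi; split=> // m g.
- case: (eqVneq (phi g) 0) => [g0|g0].
    by split=> _; left => //; apply/H5.
  have nd : ~ divides p g by move=> /H5/eqP; apply/negP.
  split=> [[/nd//|h]|[/eqP|h]]; first by right; rewrite -H6 // leq_mul2l h orbT.
    by rewrite (negPf g0).
  by right; rewrite -H6 // leq_pmul2l // in h.
- split=> [[nd <-]|[g0 E]].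
    have g0 : phi g != 0 by apply/eqP => /H5.
    by rewrite H6.
  split; first by move=> /H5/eqP; apply/negP.
  by apply/eqP; rewrite -(eqn_pmul2l Q0) E H6.
Qed.

Lemma value_isM m m' a b : value_is p m a -> value_is p m' b -> value_is p (m + m') (a * b).
Proof.
have [Q [N [phi [[Q0 N0] [_ [_ pM]] _ _ H]]]] := valuationP.
move=> /H[a0 ma] /H[b0 mb]; apply/H; rewrite pM mulf_neq0 //; split=> //.
by rewrite xordM // !mulnDr ma mb.
Qed.

Lemma value_geM m m' a b : value_ge p m a -> value_ge p m' b -> value_ge p (m + m') (a * b).
Proof.
have [Q [N [phi [[Q0 N0] [_ [_ pM]] _ H _]]]] := valuationP.
move=> /H ha /H hb; apply/H; rewrite pM.
case: (eqVneq (phi a) 0) ha => [->|a0] ha; first by left; rewrite mul0r.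
case: (eqVneq (phi b) 0) hb => [->|b0] hb; first by left; rewrite mulr0.
right; rewrite xordM // !mulnDr; apply: leq_add.
  by case: ha a0 => [->|//]; rewrite eqxx.
by case: hb b0 => [->|//]; rewrite eqxx.
Qed.

Lemma value_geD m a b : value_ge p m a -> value_ge p m b -> value_ge p m (a + b).
Proof.
have [Q [N [phi [[Q0 N0] [_ [pD _]] _ H _]]]] := valuationP.
move=> /H ha /H hb; apply/H; rewrite pD.
case: (eqVneq (phi a + phi b) 0) => [|ab0]; first by left.
(* k is Q m / N rounded up. *)
right; pose k := ((Q * m + N.-1) %/ N)%N.
have kP x : (Q * m <= N * x)%N = (k <= x)%N.
  by rewrite -[RHS]ltnS /k ltn_divLR // mulSn mulnC; apply/idP/idP; lia.
rewrite kP; apply: xord_geD => //; rewrite -kP; [exact: ha|exact: hb].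
Qed.

Lemma value_ge_sum (I : Type) (s : seq I) (P : pred I) (F : I -> R) m :
  (forall i, P i -> value_ge p m (F i)) -> value_ge p m (\sum_(i <- s | P i) F i).
Proof.
by move=> H; apply: big_ind => //; [exact: value_ge_zero|exact: value_geD].
Qed.

Lemma value_isX m k g : value_is p m g -> value_is p (k * m) (g ^+ k).
Proof.
move=> vg; elim: k => [|k IH]; last by rewrite exprS mulSn; apply: value_isM.
have [Q [N [phi [[Q0 N0] _ [pC _] _ H]]]] := valuationP; apply/H.
rewrite expr0 mul0n muln0; have -> : (1 : R) = (fpsC 1)%:P by [].
rewrite pC; split; first by apply: oner_neq0.
by rewrite xord_unit ?unitr1 ?muln0.
Qed.

Lemma value_geX m k g : value_ge p m g -> value_ge p (k * m) (g ^+ k).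
Proof.
move=> vg; elim: k => [|k IH]; first exact: value_ge0.
by rewrite exprS mulSn; apply: value_geM.
Qed.

Lemma value_is_const (c : K) : c != 0 -> value_is p 0 (fpsC c)%:P.
Proof.
move=> c0; have [Q [N [phi [[Q0 N0] _ [pC _] _ H]]]] := valuationP; apply/H.
rewrite pC muln0 xord_unit ?muln0 //; split=> //.
by apply: contraTneq c0 => /(congr1 (fun s : fps K => s 0%N)) /= ->; rewrite eqxx.
Qed.

Lemma value_is_x : value_is p (size p).-1 fpsX%:P.
Proof.
have [Q [N [phi [[Q0 N0] [<- _] [_ pX] _ H]]]] := valuationP; apply/H.
by rewrite pX xordXn mulnC expf_neq0 ?fpsX_neq0.
Qed.

Lemma value_geN m a : value_ge p m a -> value_ge p m (- a).
Proof.
rewrite -mulN1r => H; rewrite -[m]add0n; apply: value_geM => //; exact: value_ge0.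
Qed.

Lemma value_isN m a : value_is p m a -> value_is p m (- a).
Proof.
rewrite -mulN1r => H; rewrite -[m]add0n; apply: value_isM => //.
have -> : (-1 : R) = (fpsC (-1))%:P by rewrite rmorphN rmorph1 polyCN.
by apply: value_is_const; rewrite oppr_eq0 oner_neq0.
Qed.

Lemma value_isD m a b : value_is p m a -> value_ge p m.+1 b -> value_is p m (a + b).
Proof.
move=> va vb; have [h|[k vk km]] := value_ge_or m.+1 (a + b).
  have : value_ge p m.+1 (a + b + - b) by apply: value_geD => //; apply: value_geN.
  by rewrite addrK => /(value_is_le va); rewrite ltnn.
suff mk : (m <= k)%N.
  by have <- : k = m by apply/eqP; rewrite eqn_leq -ltnS km.
apply: (value_is_le vk); apply: value_geD; first exact: value_is_ge.
exact: value_geW vb.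
Qed.

(** The residue field of the branch is K: the ratio of the leading coefficients
    of the two series along the branch does it. *)
Lemma value_is_residue m a b : value_is p m a -> value_is p m b ->
  exists2 c : K, c != 0 & value_ge p m.+1 (a - (fpsC c)%:P * b).
Proof.
have [Q [N [phi [[Q0 N0] [_ [pD pM]] [pC _] H H']]]] := valuationP.
move=> /H'[a0 ma] /H'[b0 mb].
have E : xord (phi a) = xord (phi b).
  by apply/eqP; rewrite -(eqn_pmul2l N0) -ma -mb.
have [a1 a2] := xordP a0; have [b1 b2] := xordP b0.
set k := xord (phi a) in ma a1 a2 E *.
pose c := phi a k / phi b k.
have c0 : c != 0 by rewrite mulf_neq0 ?invr_eq0 // E.
exists c => //.
have pE : phi (a - (fpsC c)%:P * b) = phi a - fpsC c * phi b.
  by rewrite -mulNr -polyCN -rmorphN /= pD pM pC rmorphN mulNr.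
have [//|[j /H'[]]] := value_ge_or m.+1 (a - (fpsC c)%:P * b).
rewrite pE => d0 jE jm; exfalso.
have lt : (xord (phi a - fpsC c * phi b)%R <= k)%N.
  by rewrite -(leq_pmul2l N0) -jE -ma leq_pmul2l.
have [] := xordP d0; set l := xord _ in lt * => + _.
rewrite fps_coefD fps_coefN coef_fpsCM.
move: lt; rewrite leq_eqVlt => /predU1P[->|lk].
  by rewrite /c divfK ?subrr ?eqxx // E.
by rewrite a2 // b2 -?E // mulr0 subrr eqxx.
Qed.

End Valuation.

(** * Arithmetic of the sequence r *)

Section Numerics.
Local Open Scope nat_scope.
Variable r : nat -> nat.

(** The degree of the k-th approximate root. *)
Definition deg_app k := \prod_(1 <= j < k) e r j.
(** Digits in the mixed radix e_1, e_2, ...: the monomial of degree D in the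
    approximate roots has exponents [digit j D]. *)
Definition digit j D := (D %% deg_app j.+1) %/ deg_app j.
(** The value of the monomial of degree D. *)
Definition weight k D := \sum_(1 <= j < k) digit j D * r j.
(** Beyond this bound every multiple of d_k lies in the semigroup generated by
    r_0, ..., r_(k-1). *)
Definition conductor_bound k := \sum_(1 <= j < k) (e r j).-1 * r j.

Lemma d1 : d r 1 = r 0.
Proof. by rewrite /d big_ord_recl big_ord0 gcdn0. Qed.

Lemma dS k : d r k.+1 = gcdn (d r k) (r k).
Proof. by rewrite /d big_ord_recr. Qed.

Lemma d_dvdS k : d r k.+1 %| d r k. Proof. by rewrite dS dvdn_gcdl. Qed.

Lemma d_dvd_r k j : j < k -> d r k %| r j.
Proof.
elim: k => // k IH; rewrite ltnS leq_eqVlt => /predU1P[->|jk].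
  by rewrite dS dvdn_gcdr.
exact: dvdn_trans (d_dvdS k) (IH jk).
Qed.

Lemma eM k : e r k * d r k.+1 = d r k.
Proof. by rewrite /e divnK // d_dvdS. Qed.

Hypothesis r0_gt0 : 0 < r 0.

Lemma d_gt0 k : 0 < k -> 0 < d r k.
Proof.
case: k => // k _; elim: k => [|k IH]; first by rewrite d1.
by rewrite dS gcdn_gt0 IH.
Qed.

Lemma e_gt0 k : 0 < k -> 0 < e r k.
Proof.
by move=> k0; have := d_gt0 k0; rewrite -eM muln_gt0 => /andP[].
Qed.

Lemma deg_app1 : deg_app 1 = 1. Proof. by rewrite /deg_app big_geq. Qed.

Lemma deg_appS k : 0 < k -> deg_app k.+1 = deg_app k * e r k.
Proof. by move=> k0; rewrite /deg_app big_nat_recr. Qed.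


Lemma deg_app_gt0 k : 0 < k -> 0 < deg_app k.
Proof.
elim: k => // k IH _; case: (posnP k) => [->|k0]; first by rewrite deg_app1.
by rewrite deg_appS // muln_gt0 IH // e_gt0.
Qed.

Lemma deg_app_d k : 0 < k -> deg_app k * d r k = r 0.
Proof.
elim: k => // k IH _; case: (posnP k) => [->|k0]; first by rewrite deg_app1 d1 mul1n.
by rewrite deg_appS // -mulnA eM IH.
Qed.

Lemma deg_app_dvd j k : 0 < j -> j <= k -> deg_app j %| deg_app k.
Proof.
move=> j0; elim: k => [|k IH]; first by case: j j0.
rewrite leq_eqVlt => /predU1P[->//|]; rewrite ltnS => jk.
by rewrite deg_appS ?dvdn_mulr ?IH // (leq_trans j0).
Qed.

Lemma digit_lt j D : 0 < j -> digit j D < e r j.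
Proof.
move=> j0; rewrite /digit ltn_divLR ?deg_app_gt0 // mulnC -deg_appS //.
by rewrite ltn_mod deg_app_gt0.
Qed.

Lemma digit_mod j k D : 0 < j < k -> digit j (D %% deg_app k) = digit j D.
Proof. by move=> /andP[j0 jk]; rewrite /digit modn_dvdm // deg_app_dvd. Qed.

Lemma digit_last k D : D < deg_app k.+1 -> digit k D = D %/ deg_app k.
Proof. by move=> DN; rewrite /digit modn_small. Qed.

Lemma digit_add k D u : 0 < k -> D < deg_app k -> u < e r k ->
  D + u * deg_app k < deg_app k.+1 /\ digit k (D + u * deg_app k) = u.
Proof.
move=> k0 DN ue; have lt : D + u * deg_app k < deg_app k.+1.
  apply: (@leq_trans (u.+1 * deg_app k)); first by rewrite mulSn ltn_add2r.
  by rewrite deg_appS // [leqRHS]mulnC leq_mul2r ue orbT.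
by split=> //; rewrite digit_last // addnC divnMDl ?deg_app_gt0 // divn_small ?addn0.
Qed.

Lemma weightS k D : 0 < k -> weight k.+1 D = weight k D + digit k D * r k.
Proof. by move=> k0; rewrite /weight big_nat_recr. Qed.

Lemma weight_mod k D : weight k (D %% deg_app k) = weight k D.
Proof.
by apply: eq_big_nat => j jk; rewrite digit_mod.
Qed.

Lemma weight_add k D u : weight k (D + u * deg_app k) = weight k D.
Proof. by rewrite -weight_mod addnC modnMDl weight_mod. Qed.

Lemma d_dvd_weight k D : d r k %| weight k D.
Proof.
rewrite /weight big_nat_cond; apply: dvdn_sum => j.
by rewrite andbT => /andP[_ jk]; rewrite dvdn_mull // d_dvd_r.
Qed.

Lemma d_dvd_mul k u : 0 < k -> d r k %| u * r k -> e r k %| u.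
Proof.
move=> k0; have dk := d_gt0 (ltn0Sn k).
have /dvdnP[s sE] := d_dvd_r (ltnSn k).
have cop : coprime (e r k) s.
  rewrite /coprime -(eqn_pmul2r dk) muln_gcdl eM -sE -dS mul1n //.
rewrite -{1}eM sE mulnA dvdn_pmul2r //.
by rewrite Gauss_dvdl.
Qed.

Lemma digit_uniq k X X' u u' : 0 < k -> d r k %| X -> d r k %| X' ->
  u < e r k -> u' < e r k -> X + u * r k = X' + u' * r k -> u = u'.
Proof.
move=> k0; wlog uu : u u' X X' / u <= u'.
  move=> H dX dX' ue ue' E; case: (leqP u u') => uu; first exact: (H u u' X X').
  by apply/esym; apply: (H u' u X' X) => //; apply: ltnW.
move=> dX dX' ue ue' E.
have /d_dvd_mul : d r k %| (u' - u) * r k.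
  have -> : (u' - u) * r k = X - X'.
    by rewrite mulnBl; have := leq_mul2r (r k) u u'; rewrite uu orbT; lia.
  by rewrite dvdn_sub.
case/(_ k0)/dvdnP=> [[|v] vE]; first by lia.
by move: vE; rewrite mulSn; lia.
Qed.

(** Compare the last digits first: the other terms are multiples of d_k, which
    determines the last digit modulo e_k. *)
Lemma weight_inj k a a' D D' : 0 < k -> D < deg_app k -> D' < deg_app k ->
  a * r 0 + weight k D = a' * r 0 + weight k D' -> D = D' /\ a = a'.
Proof.
elim: k a a' D D' => // k IH a a' D D' _.
case: (posnP k) => [->|k0].
  rewrite deg_app1 !ltnS !leqn0 => /eqP-> /eqP->; rewrite /weight !big_geq // !addn0.
  by move/eqP; rewrite eqn_pmul2r // => /eqP.
move=> DN DN'; rewrite !weightS // !addnA => E.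
have dv a1 D1 : d r k %| a1 * r 0 + weight k D1.
  by rewrite dvdn_add ?d_dvd_weight // dvdn_mull // d_dvd_r.
have uE := digit_uniq k0 (dv _ _) (dv _ _) (digit_lt D k0) (digit_lt D' k0) E.
move: E; rewrite uE => /eqP; rewrite eqn_add2r => /eqP.
rewrite -(weight_mod k D) -(weight_mod k D') => /IH[]; rewrite ?ltn_mod ?deg_app_gt0 //.
move=> DD aa; split=> //; move: uE; rewrite !digit_last // => uE.
by rewrite (divn_eq D (deg_app k)) (divn_eq D' (deg_app k)) uE DD.
Qed.

(** The last digit is prescribed modulo e_k, as r_k / d_(k+1) is invertible
    modulo e_k; the rest is a multiple of d_k above the previous bound. *)
Lemma weight_represents k m : 0 < k -> d r k %| m -> conductor_bound k <= m ->
  exists a D, D < deg_app k /\ m = a * r 0 + weight k D.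
Proof.
elim: k m => // k IH m _; case: (posnP k) => [->|k0].
  rewrite d1 => /dvdnP[a ->] _; exists a, 0; rewrite deg_app1; split=> //.
  by rewrite /weight big_geq // addn0.
move=> dm; rewrite /conductor_bound big_nat_recr //= -/(conductor_bound k) => Tm.
have dk := d_gt0 (ltn0Sn k); have ek := e_gt0 k0.
(* u solves u r_k = m modulo d_k. *)
have [u ue du] : exists2 u, u < e r k & m = u * r k %[mod d r k].
  have /dvdnP[s sE] := d_dvd_r (ltnSn k); have /dvdnP[t tE] := dm.
  have cop : coprime s (e r k).
    rewrite coprime_sym /coprime -(eqn_pmul2r dk) muln_gcdl eM -sE -dS mul1n //.
  have s0 : 0 < s \/ e r k = 1.
    case: (posnP s) cop => [->|]; last by left.
    by rewrite /coprime gcd0n => /eqP; right.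
  have [v vE] : exists v, v * s = 1 %[mod e r k].
    case: s0 => [s0|->]; last by exists 0; rewrite !modn1.
    case: (egcdnP (e r k) s0) => v w E _; exists v.
    by rewrite E (eqP cop) modnMDl.
  exists ((t * v) %% e r k); first by rewrite ltn_mod.
  rewrite sE tE !mulnA -(eM k) -!muln_modl; congr (_ * _).
  by rewrite modnMml -mulnA -modnMmr vE modnMmr muln1.
have uT : conductor_bound k + u * r k <= m.
  by apply: leq_trans Tm; rewrite leq_add2l leq_mul2r -ltnS prednK // ue orbT.
have [||a [D [DN mE]]] := IH (m - u * r k) k0.
- by rewrite -eqn_mod_dvd ?du //; lia.
- by lia.
have [DN2 dg] := digit_add k0 DN ue.
exists a, (D + u * deg_app k); split=> //.
rewrite weightS // dg weight_add addnA -mE.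
by lia.
Qed.

Variable h : nat.
Hypothesis h_gt0 : 0 < h.
Hypothesis r_gt0 : forall k, k <= h -> 0 < r k.
Hypothesis d_last : d r h.+1 = 1.
Hypothesis r_incr : forall k : nat, (1 <= k <= h.-1)%N ->
       (r k * d r k < r k.+1 * d r k.+1)%N.
Hypothesis r_min : minimal_generators h r.

Lemma er_lt k : 0 < k < h -> e r k * r k < r k.+1.
Proof.
move=> /andP[k0 kh]; have : 0 < k <= h.-1 by rewrite k0 -ltnS prednK.
move/r_incr; rewrite -eM mulnA ltn_pmul2r ?d_gt0 // mulnC //.
Qed.

Lemma r_mono i j : 0 < i -> i <= j <= h -> r i <= r j.
Proof.
move=> i0; elim: j => [|j IH]; first by case: i i0.
case/andP; rewrite leq_eqVlt => /predU1P[->//|]; rewrite ltnS => ij jh.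
have j0 := leq_trans i0 ij.
have lt : e r j * r j < r j.+1 by apply: er_lt; rewrite j0.
apply: leq_trans (ltnW lt); rewrite (leq_trans (IH _)) ?ij ?(ltnW jh) //.
by rewrite leq_pmull // e_gt0.
Qed.

Lemma conductor_boundS k : 0 < k ->
  conductor_bound k.+1 = conductor_bound k + (e r k).-1 * r k.
Proof. by move=> k0; rewrite /conductor_bound big_nat_recr. Qed.

Lemma conductor_le k : 0 < k <= h -> conductor_bound k <= r k.
Proof.
elim: k => // k IH /andP[_ kh]; case: (posnP k) => [->|k0].
  by rewrite /conductor_bound big_geq.
rewrite conductor_boundS //.
have lt : e r k * r k < r k.+1 by apply: er_lt; rewrite k0.
apply: leq_trans (ltnW lt); rewrite -{2}(prednK (e_gt0 k0)) mulSn leq_add2r.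
by apply: IH; rewrite k0 ltnW.
Qed.

Lemma sum_weight k D a : 0 < k -> k <= h ->
  \sum_(i < h.+1) (if i == 0 :> nat then a else if i < k then digit i D else 0) * r i
  = a * r 0 + weight k D.
Proof.
move=> k0 kh; rewrite big_ord_recl /=; congr (_ + _).
rewrite -(big_mkord xpredT (fun i => (if i.+1 < k then digit i.+1 D else 0) * r i.+1)).
rewrite /weight -(prednK k0) big_add1 /= (big_cat_nat (n := k.-1)) //=; last by lia.
rewrite [X in _ + X]big_nat_cond [X in _ + X]big1 ?addn0; last first.
  by move=> i /andP[/andP[ki _] _]; rewrite ltnNge; case: leqP => //; lia.
apply: eq_big_nat => i /andP[_ ik]; rewrite ltnS ik //.
Qed.

(** If e_k = 1, then r_k is a multiple of d_k above the conductor bound, hence a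
    combination of the previous generators, against minimality. *)
Lemma e_gt1 k : 0 < k <= h -> 1 < e r k.
Proof.
move=> /andP[k0 kh]; rewrite ltn_neqAle e_gt0 // andbT; apply/negP => /eqP e1.
have dr : d r k %| r k by rewrite -eM -e1 mul1n d_dvd_r.
have [|a [D [_ rE]]] := weight_represents k0 dr.
  by apply: conductor_le; rewrite k0.
pose i0 : 'I_h.+1 := Ordinal (kh : k < h.+1).
have pr : ([set: 'I_h.+1] :\ i0)%SET \proper [set: 'I_h.+1]%SET.
  by rewrite properD1 // inE.
apply: (r_min pr); rewrite eqEsubset; split=> m [c mE].
  exists (fun i => if i == i0 then 0 else c i); rewrite mE.
  rewrite [RHS](bigD1 i0) ?inE //= eqxx mul0n add0n.
  apply: eq_big => [i|i]; first by rewrite !inE andbC.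
  by rewrite !inE => /andP[/negPf-> _].
(* The coefficients of r_k in terms of the other generators. *)
pose w (i : 'I_h.+1) := if i == 0 :> nat then a else if i < k then digit i D else 0.
exists (fun i => c i + c i0 * w i); rewrite mE (bigD1 i0) ?inE //=.
have -> : r k = \sum_(i in ([set: 'I_h.+1] :\ i0)%SET) w i * r i.
  rewrite rE -(@sum_weight k) // (bigD1 i0) //= ltnn (gtn_eqF k0).
  rewrite mul0n add0n; apply: eq_bigl => i; rewrite !inE andbT //.
rewrite big_distrr /= addnC; rewrite (eq_bigl (fun i => i \in [set: 'I_h.+1] :\ i0)%SET).
  by rewrite -big_split; apply: eq_bigr => i _; rewrite mulnDl mulnA.
by move=> i; rewrite !inE andbC.
Qed.

Lemma d_ndvd_r k : 0 < k <= h -> ~~ (d r k %| r k).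
Proof.
move=> kh; have k0 : 0 < k by case/andP: kh.
apply/negP => dr; have := e_gt1 kh.
by rewrite /e dS (gcdn_idPl dr) divnn d_gt0.
Qed.

Lemma Gamma_dvd k m : k < h -> Gamma h r m -> m < r k.+1 -> d r k.+1 %| m.
Proof.
move=> kh [c ->] lt; apply: dvdn_sum => i _.
case: (leqP i k) => ik; first by rewrite dvdn_mull // d_dvd_r.
suff -> : c i = 0 by rewrite mul0n dvdn0.
apply/eqP; rewrite -leqn0 leqNgt; apply/negP => ci.
move: lt; rewrite ltnNge (bigD1 i) ?inE //= => /negP; apply.
apply: leq_trans (leq_addr _ _); rewrite (@leq_trans (r i)) //.
  by apply: r_mono => //; rewrite ik -ltnS /=.
by rewrite leq_pmull.
Qed.

Lemma Gamma_r k : k <= h -> Gamma h r (r k).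
Proof.
move=> kh; exists (fun i => (i == k :> nat)); pose i0 : 'I_h.+1 := Ordinal (kh : k < h.+1).
rewrite (bigD1 i0) ?inE //= eqxx mul1n big1 ?addn0 // => i /andP[_].
by rewrite -val_eqE /= => /negPf->.
Qed.

End Numerics.

(** * Monomials and their series *)

Lemma polyXn_dvd (K : fieldType) N (s : {poly fps K}) :
  (forall j n, (n < N)%N -> s`_j n = 0) -> exists q, s = (fpsX%:P) ^+ N * q.
Proof.
move=> H; have ex j : exists b, s`_j = fpsX ^+ N * b by apply: fpsXn_dvd => i; apply: H.
have [b bE] := choice ex; exists (\poly_(j < size s) b j).
apply/polyP => j; rewrite -polyC_exp coefCM coef_poly; case: ltnP => [_|h]; first exact: bE.
by rewrite nth_default // mulr0.
Qed.

(** A coefficientwise sum is a finite partial sum modulo x^N, which is all that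
    valuations see. *)
Lemma is_sum_trunc (K : fieldType) (T : choiceType) (A A' : set T) (F : T -> {poly fps K}) s N :
  is_sum A F s -> finite_set A' -> (A' `<=` A)%classic ->
  (forall t, A t -> ~ A' t -> forall j n, (n < N)%N -> (F t)`_j n = 0) ->
  exists (L : seq T) q, (forall t, t \in L -> A t) /\ s = \sum_(t <- L) F t + (fpsX%:P) ^+ N * q.
Proof.
move=> sA fA sub van; pose L := finmap.enum_fset (fset_set A'); exists L.
have [|q qE] := @polyXn_dvd K N (s - \sum_(t <- L) F t); last first.
  exists q; split; last by rewrite -qE addrC subrK.
  by move=> t; rewrite /L in_fset_set // inE => /sub.
move=> j n nN; have [_ sE] := sA j n.
rewrite coefB coef_sum fps_coefD fps_coefN coef_fps_sum sE.
rewrite -(fsbig_finite _ (fun t => (F t)`_j n) fA); apply/eqP; rewrite subr_eq0; apply/eqP.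
apply/esym/fsbig_widen => // t [At nA] /=; exact: van nN.
Qed.

Lemma size_monicX (A : idomainType) (p : {poly A}) m n :
  p \is monic -> size p = m.+1 -> size (p ^+ n) = (m * n).+1.
Proof.
move=> mp sp; have := size_exp p n; rewrite sp /= => <-.
by rewrite prednK // size_poly_gt0 expf_neq0 // monic_neq0.
Qed.

Section Monomials.
Variable K : fieldType.
Local Notation R := {poly fps K}.
Variables (r : nat -> nat) (g : nat -> R).

(** Index 0 stands for x, as in [Mon]. *)
Definition mon_factor j : R := if j == 0%N then fpsX%:P else g j.
Definition monomial k (f : nat -> nat) : R := \prod_(j < k) mon_factor j ^+ f j.
(** Exponent vectors become functions on nat, so that monomials of different
    lengths can be compared by recursion on the length. *)
Definition extended k (t : {ffun 'I_k -> nat}) j : nat := if insub j is Some i then t i else 0%N.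

Lemma extendedE k (t : {ffun 'I_k -> nat}) (i : 'I_k) : extended t i = t i.
Proof. by rewrite /extended valK. Qed.

Lemma Mon_monomial k (t : {ffun 'I_k -> nat}) : Mon g t = monomial k (extended t).
Proof. by apply: eq_bigr => j _; rewrite extendedE. Qed.

Lemma E1_sum k i t : E1 r k i t ->
  (i * r k = \sum_(j < k) t j * r j)%N /\ forall j : 'I_k, (0 < j)%N -> (t j < e r j)%N.
Proof.
case=> Bt E; split=> //; move: (congr1 (fun m => m * d r k.+1)%N E).
rewrite -mulnA divnK ?d_dvd_r // => ->; rewrite big_distrl /=.
by apply: eq_bigr => j _; rewrite -mulnA divnK // d_dvd_r // ltnS ltnW.
Qed.

Lemma E2_sum k i t : (0 < r 0)%N -> E2 r k i t ->
  (i * r k < \sum_(j < k) t j * r j)%N /\ forall j : 'I_k, (0 < j)%N -> (t j < e r j)%N.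
Proof.
move=> r0 [Bt E]; split=> //.
rewrite -(divnK (d_dvd_r r (ltnSn k))) mulnA.
rewrite (eq_bigr (fun j : 'I_k => t j * (r j %/ d r k.+1) * d r k.+1)%N).
  by rewrite -big_distrl /= ltn_pmul2r ?d_gt0.
by move=> j _; rewrite -mulnA divnK // d_dvd_r // ltnS ltnW.
Qed.

Lemma coef_Mon_low k (t : {ffun 'I_k.+1 -> nat}) j n : (n < t ord0)%N -> (Mon g t)`_j n = 0.
Proof.
move=> nt; rewrite /Mon big_ord_recl /= -polyC_exp coefCM coef_fpsXnM nt //.
Qed.

(** The exponents other than that of x are bounded by the e_j. *)
Lemma finite_box k N : finite_set [set t : {ffun 'I_k.+1 -> nat} |
  B r k.+1 t /\ (t ord0 < N)%N]%classic.
Proof.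
pose M := (N + \sum_(j < k.+1) e r j)%N.
pose emb (u : {ffun 'I_k.+1 -> 'I_M.+1}) : {ffun 'I_k.+1 -> nat} := [ffun j => u j : nat].
apply: (@sub_finite_set _ _ (emb @` setT)%classic); last first.
  by apply: finite_image; apply: finite_finset.
move=> t [Bt tN]; exists [ffun j => inord (t j)] => //.
apply/ffunP => j; rewrite !ffunE inordK // ltnS /M.
case: (posnP j) => [j0|j0].
  have -> : j = ord0 by apply: val_inj.
  by rewrite (leq_trans (ltnW tN)) // leq_addr.
rewrite (leq_trans (ltnW (Bt j j0))) // (bigD1 j) //= addnCA leq_addr //.
Qed.

Lemma Mon_series_trunc k (A : set {ffun 'I_k -> nat}) s N : (0 < k)%N ->
  (A `<=` B r k)%classic -> Mon_series g A s ->
  exists (L : seq {ffun 'I_k -> nat}) (a : {ffun 'I_k -> nat} -> K) q,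
   (forall t, t \in L -> A t) /\
   s = \sum_(t <- L) fpsC (a t) *: Mon g t + (fpsX%:P) ^+ N * q.
Proof.
case: k A => // k A _ AB [a sA].
have fin : finite_set (A `&` [set t : {ffun 'I_k.+1 -> nat} | (t ord0 < N)%N])%classic.
  by apply: sub_finite_set (finite_box k N) => t [/AB Bt tN].
have [||L [q [LA E]]] := is_sum_trunc (N := N) sA fin.
- by move=> t [].
- move=> t At nt j n nN; rewrite coefZ coef_fpsCM coef_Mon_low ?mulr0 //.
  by rewrite (leq_trans nN) // leqNgt; apply/negP => tN; apply: nt.
by exists L, a, q.
Qed.

Lemma size_monomial k f : (0 < r 0)%N -> (0 < k)%N ->
  (forall j, (0 < j < k)%N -> g j \is monic /\ size (g j) = (deg_app r j).+1) ->
  (forall j, (0 < j < k)%N -> (f j < e r j)%N) ->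
  (size (monomial k f) <= deg_app r k)%N.
Proof.
move=> r0; elim: k => // k IH _ Hg Hf; case: (posnP k) => [->|k0].
  rewrite deg_app1 /monomial big_ord1 -polyC_exp size_polyC; by case: (_ != 0).
rewrite /monomial big_ord_recr /= -/(monomial k f).
have [mg sg] : g k \is monic /\ size (g k) = (deg_app r k).+1 by apply: Hg; rewrite k0 /=.
apply: leq_trans (size_polyMleq _ _) _; rewrite /mon_factor gtn_eqF //.
have -> : size (g k ^+ f k) = (f k * deg_app r k).+1.
  by rewrite (size_monicX _ mg sg) mulnC.
rewrite addnS /= deg_appS //.
have IHk : (size (monomial k f) <= deg_app r k)%N.
  apply: IH => // j /andP[j0 jk]; [apply: Hg|apply: Hf]; rewrite j0 ltnW //.
have fk : (f k < e r k)%N by apply: Hf; rewrite k0 /=.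
apply: leq_trans (leq_add IHk (leqnn _)) _; rewrite -mulSn mulnC leq_mul2l fk orbT //.
Qed.

Lemma size_Mon_series k (A : set {ffun 'I_k -> nat}) s : (0 < r 0)%N -> (0 < k)%N ->
  (forall j, (0 < j < k)%N -> g j \is monic /\ size (g j) = (deg_app r j).+1) ->
  (A `<=` B r k)%classic -> Mon_series g A s -> (size s <= deg_app r k)%N.
Proof.
move=> r0 k0 Hg AB [a sA]; apply/leq_sizeP => j kj; apply: fpsP => n.
have [_ ->] := sA j n; rewrite fps_coef0; apply: fsbig1 => t At.
rewrite coefZ coef_fpsCM Mon_monomial nth_default ?fps_coef0 ?mulr0 //.
apply: leq_trans kj; apply: size_monomial => // i /andP[i0 ik].
by rewrite -[i]/(val (Ordinal ik)) extendedE; apply: AB.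
Qed.

End Monomials.

Section MonomialValues.
Variable K : closedFieldType.
Hypothesis charK : [pchar K] =i pred0.
Variable p : {poly fps K}.
Hypotheses (ip : irreducible p) (mp : p \is monic).
Variables (r : nat -> nat) (g : nat -> {poly fps K}).

Lemma value_ge_monomial k (f w : nat -> nat) :
  (forall j, (j < k)%N -> value_ge p (w j) (mon_factor g j)) ->
  value_ge p (\sum_(j < k) f j * w j) (monomial g k f).
Proof.
elim: k => [|k IH] H; first by rewrite big_ord0; apply: value_ge0.
rewrite /monomial !big_ord_recr /=; apply: value_geM => //; first by apply: IH => j jk; apply/H/ltnW.
by apply: value_geX => //; apply: H.
Qed.

Lemma value_is1 : value_is p 0 1.
Proof. by have := value_is_const charK ip mp (oner_neq0 K). Qed.

Lemma value_is_monomial k (f w : nat -> nat) :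
  (forall j, (j < k)%N -> value_is p (w j) (mon_factor g j)) ->
  value_is p (\sum_(j < k) f j * w j) (monomial g k f).
Proof.
elim: k => [|k IH] H; first by rewrite /monomial !big_ord0; apply: value_is1.
rewrite /monomial !big_ord_recr /=; apply: value_isM => //; first by apply: IH => j jk; apply/H/ltnW.
by apply: value_isX => //; apply: H.
Qed.

Lemma size_p_gt0 : (0 < (size p).-1)%N.
Proof. by have := irreducible_size ip mp; case: (size p) => [|[|]]. Qed.

Lemma value_geZ m c s : value_ge p m s -> value_ge p m (fpsC c *: s).
Proof.
by move=> H; rewrite -mul_polyC -[m]add0n; apply: value_geM => //; apply: value_ge0.
Qed.

(** Truncate the series modulo x^m, which has value at least m. *)
Lemma value_ge_Mon_series k (A : set {ffun 'I_k -> nat}) s m : (0 < k)%N ->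
  (A `<=` B r k)%classic -> Mon_series g A s ->
  (forall t, A t -> value_ge p m (Mon g t)) -> value_ge p m s.
Proof.
move=> k0 AB sA H; have [L [a [q [LA ->]]]] := Mon_series_trunc m k0 AB sA.
apply: value_geD => //.
  by rewrite big_seq; apply: value_ge_sum => // t /LA/H; apply: value_geZ.
rewrite -[m in value_ge p m _]addn0; apply: value_geM => //; last exact: value_ge0.
have := value_isX charK ip mp m (value_is_x charK ip mp) => /value_is_ge; apply: value_geW.
by rewrite leq_pmulr // size_p_gt0.
Qed.

End MonomialValues.

(** * Monic factors *)

Section Factor.
Variable K : closedFieldType.
Local Notation R := {poly fps K}.

Lemma unit_monic (p : R) : p \is monic -> p \is a GRing.unit -> p = 1.
Proof.
move=> mp; rewrite poly_unitE => /andP[/eqP sp _].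
have pC := size1_polyC (eq_leq sp); move: mp.
by rewrite pC monicE lead_coefC => /eqP->.
Qed.

Lemma size1_unit (p : R) : p \is monic -> (size p <= 1)%N -> p \is a GRing.unit.
Proof.
move=> mp sp; have pC := size1_polyC sp; move: mp.
by rewrite pC monicE lead_coefC => /eqP->; apply: unitr1.
Qed.

Lemma monic_factor (F a b : R) : F \is monic -> F = a * b ->
  exists a' b' : R, [/\ a' \is monic, b' \is monic, F = a' * b',
    (a' \is a GRing.unit -> a \is a GRing.unit) & (b' \is a GRing.unit -> b \is a GRing.unit)].
Proof.
move=> mF FE; have lc : lead_coef a * lead_coef b = 1.
  by rewrite -lead_coefM -FE (monicP mF).
exists (lead_coef b *: a), (lead_coef a *: b); split.
- by rewrite monicE lead_coefZ mulrC lc.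
- by rewrite monicE lead_coefZ lc.
- by rewrite -scalerAl -scalerAr scalerA [_ * lead_coef a]mulrC lc scale1r.
- move=> /unitrP[x [xa ax]]; apply/unitrP; exists (lead_coef b *: x).
  by rewrite -scalerAl scalerAr xa -scalerAr scalerAl ax.
- move=> /unitrP[x [xa ax]]; apply/unitrP; exists (lead_coef a *: x).
  by rewrite -scalerAl scalerAr xa -scalerAr scalerAl ax.
Qed.

(** By induction on the degree; in a factorization of a monic polynomial the
    leading coefficients are units and can be normalized. *)
Lemma irreducible_factor (F : R) : F \is monic -> (1 < size F)%N ->
  exists p, [/\ irreducible p, p \is monic & divides p F].
Proof.
have [n] := ubnP (size F); elim: n F => // n IH F sF mF F1.
case: (pselect (irreducible F)) => [iF|nF].
  by exists F; split=> //; exists 1; rewrite mul1r.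
have [a [b [FE [na nb]]]] : exists a b : R, F = a * b /\
    ~ a \is a GRing.unit /\ ~ b \is a GRing.unit.
  apply: contrapT => H; apply: nF; split; first exact: monic_neq0.
    apply/negP => /(unit_monic mF) F11; by rewrite F11 size_poly1 in F1.
  move=> a b FE; apply: contrapT => /not_orP[na nb]; apply: H.
  by exists a, b.
have [a' [b' [ma mb FE' ua ub]]] := monic_factor mF FE.
have a1 : (1 < size a')%N by rewrite ltnNge; apply/negP => /(size1_unit ma)/ua.
have b1 : (1 < size b')%N by rewrite ltnNge; apply/negP => /(size1_unit mb)/ub.
have [|p [ip mp [q qE]]] := IH a' _ ma a1.
  move: sF; rewrite FE' size_monicM ?monic_neq0 //.
  have ar x y : (1 < x -> 1 < y -> (x + y).-1 < n.+1 -> x < n)%N by lia.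
  exact: ar.
by exists p; split=> //; exists (b' * q); rewrite FE' qE; ring.
Qed.

Lemma monic_divides_eq (p F : R) : p \is monic -> F \is monic ->
  divides p F -> (size F <= size p)%N -> F = p.
Proof.
move=> mp mF [q qE] sF; have mq : q \is monic by rewrite -(monicMr _ mp) -qE.
suff -> : F = 1 * p by rewrite mul1r.
rewrite qE; congr (_ * _); apply: unit_monic => //; apply: size1_unit => //.
move: sF; rewrite qE size_monicM ?monic_neq0 // -subn1 leq_subLR.
rewrite addnC [(1 + _)%N]addnC leq_add2l //.
Qed.

End Factor.

(** * Admissible sequences are irreducible *)

Section AdmissibleSequences.
Variable K : closedFieldType.
Hypothesis charK : [pchar K] =i pred0.
Variables (h : nat) (r : nat -> nat).
Hypothesis h_gt0 : (0 < h)%N.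
Hypothesis r_gt0 : forall k : nat, (k <= h)%N -> (0 < r k)%N.
Hypothesis d_last : d r h.+1 = 1%N.
Hypothesis r_incr : forall k : nat, (1 <= k <= h.-1)%N ->
       (r k * d r k < r k.+1 * d r k.+1)%N.
Hypothesis r_min : minimal_generators h r.
Variable g : nat -> {poly fps K}.
Hypothesis adm : admissible h r g.

Let r0 : (0 < r 0)%N := r_gt0 (leq0n h).

Lemma E1_B k i : (E1 r k i `<=` B r k)%classic. Proof. by move=> t []. Qed.
Lemma E2_B k i : (E2 r k i `<=` B r k)%classic. Proof. by move=> t []. Qed.

Lemma admissible_size k : (0 < k <= h.+1)%N ->
  g k \is monic /\ size (g k) = (deg_app r k).+1.
Proof.
elim/ltn_ind: k => -[//|k] IH /= kh.
case: (posnP k) => [->|k0].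
  by case: adm => -> _; rewrite deg_app1 monicX size_polyX.
have kh' : (0 < k <= h)%N by rewrite k0.
have Hg j : (0 < j < k.+1)%N -> g j \is monic /\ size (g j) = (deg_app r j).+1.
  by case/andP=> j0 jk; apply: IH => //; rewrite j0 ltnW // (leq_trans jk) // ltnW.
have Hg' j : (0 < j < k)%N -> g j \is monic /\ size (g j) = (deg_app r j).+1.
  by case/andP=> j0 jk; apply: Hg; rewrite j0 ltnW.
have [mk sk] : g k \is monic /\ size (g k) = (deg_app r k).+1 by apply: Hg; rewrite k0 /=.
have [_ /(_ k kh')[alpha [gE [t Et [a a0 [s sE alE]]] Hal]]] := adm.
have eg := e_gt1 r0 h_gt0 d_last r_incr r_min kh'.
have sal i : (2 <= i <= e r k)%N -> (size (alpha i) <= deg_app r k)%N.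
  case/andP=> i2; rewrite leq_eqVlt => /predU1P[->|ik].
    rewrite alE (leq_trans (size_polyD _ _)) // geq_max; apply/andP; split.
      rewrite (leq_trans (size_scale_leq _ _)) // Mon_monomial; apply: size_monomial => //.
      move=> j /andP[j0 jk]; rewrite -[j]/(val (Ordinal jk)) extendedE.
      by apply: (E1_B Et).
    exact: size_Mon_series Hg' (@E2_B _ _) sE.
  apply: size_Mon_series Hg' (@E2_B k i) (Hal i _) => //.
  by rewrite i2 -ltnS prednK ?e_gt0.
pose S := \sum_(2 <= i < (e r k).+1) alpha i * g k ^+ (e r k - i).
have sS : (size S <= (e r k).-1 * deg_app r k)%N.
  rewrite /S big_nat_cond; apply: (leq_trans (size_sum _ _ _)).
  apply/bigmax_leqP_seq => i _; rewrite andbT => /andP[i2 ie].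
  apply: leq_trans (size_polyMleq _ _) _.
  rewrite (size_monicX _ mk sk) addnS /=.
  have := sal i; rewrite i2 -ltnS ie => /(_ isT) le.
  apply: (@leq_trans (deg_app r k + deg_app r k * (e r k - i))%N); first by rewrite leq_add2r.
  by rewrite -mulnS mulnC leq_mul2r; apply/orP; right; lia.
have sX : size (g k ^+ e r k) = (deg_app r k.+1).+1.
  by rewrite (size_monicX _ mk sk) deg_appS.
have lt : (size S < size (g k ^+ e r k))%N.
  rewrite sX ltnS (leq_trans sS) // deg_appS // mulnC leq_mul2l leq_pred orbT //.
rewrite gE monicE lead_coefDl // size_polyDl // sX; split=> //.
exact: monic_exp.
Qed.

Variable p : {poly fps K}.
Hypotheses (ip : irreducible p) (mp : p \is monic).

(** Without x, bounded exponents reach at most the conductor bound, which is at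
    most r_k < 2 r_k. *)
Lemma low_exponent k i (t : nat -> nat) : (0 < k <= h)%N -> (2 <= i)%N ->
  (forall j : nat, (0 < j < k)%N -> (t j < e r j)%N) ->
  (i * r k <= \sum_(j < k) t j * r j)%N -> (0 < t 0)%N.
Proof.
move=> kh i2 te le; rewrite lt0n; apply/negP => /eqP t0.
have rk : (0 < r k)%N by apply: r_gt0; case/andP: kh.
have : (\sum_(j < k) t j * r j <= conductor_bound r k)%N.
  rewrite -(big_mkord xpredT (fun j => t j * r j)%N) big_ltn; last by case/andP: kh.
  rewrite t0 mul0n add0n /conductor_bound !big_nat leq_sum // => j /andP[j0 jk].
  rewrite leq_mul2r -ltnS prednK ?e_gt0 // te ?orbT // j0 //.
have := conductor_le r0 h_gt0 r_incr kh => c1 c2.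
have := leq_trans le (leq_trans c2 c1).
have : (2 * r k <= i * r k)%N by rewrite leq_mul2r i2 orbT.
by move: rk; lia.
Qed.

(** A monomial whose weighted degree is i r_k or more has value above i u as soon
    as u / r_k is the least of the ratios w_j / r_j and is less than w_0 / r_0.
    Strictness comes from the exponent of x, which is positive. *)
Lemma value_bound k i u (t w : nat -> nat) : (0 < k <= h)%N -> (2 <= i)%N ->
  (forall j : nat, (0 < j < k)%N -> (t j < e r j)%N) ->
  (i * r k <= \sum_(j < k) t j * r j)%N ->
  (forall j, (j < k)%N -> (u * r j <= w j * r k)%N) -> (u * r 0 < w 0 * r k)%N ->
  (i * u < \sum_(j < k) t j * w j)%N.
Proof.
move=> kh i2 te le Hw w0; have t0 := low_exponent kh i2 te le.
have k0 : (0 < k)%N by case/andP: kh.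
have rk : (0 < r k)%N by apply: r_gt0; case/andP: kh.
rewrite -(ltn_pmul2r rk) big_distrl /=.
apply: (@leq_ltn_trans (\sum_(j < k) t j * (u * r j))%N).
  rewrite (eq_bigr (fun j : 'I_k => u * (t j * r j))%N); last by move=> j _; rewrite mulnCA.
  by rewrite -big_distrr /= [(i * u)%N]mulnC -mulnA leq_mul2l le orbT.
rewrite -(big_mkord xpredT (fun j => t j * (u * r j))%N).
rewrite -(big_mkord xpredT (fun j => t j * w j * r k)%N) !(big_ltn k0).
rewrite -addSn; apply: leq_add; first by rewrite -mulnA ltn_pmul2l.
by rewrite !big_nat leq_sum // => j /andP[_ jk]; rewrite -mulnA leq_mul2l Hw // orbT.
Qed.

(** If the ratio v(g_k) / r_k is minimal, then g_k^(e_k) is the only term of least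
    value in the expression of g_(k+1). *)
Lemma value_step k u (w : nat -> nat) : (0 < k <= h)%N -> value_is p u (g k) ->
  (forall j, (j < k)%N -> value_ge p (w j) (mon_factor g j)) ->
  (forall j, (j < k)%N -> (u * r j <= w j * r k)%N) -> (u * r 0 < w 0 * r k)%N ->
  value_is p (e r k * u) (g k.+1).
Proof.
move=> kh vg vw Hw w0; have k0 : (0 < k)%N by case/andP: kh.
have [_ /(_ k kh)[alpha [-> [t Et [a a0 [s sE alE]]] Hal]]] := adm.
have key i (t' : {ffun 'I_k -> nat}) : (2 <= i)%N ->
    (i * r k <= \sum_(j < k) t' j * r j)%N ->
    (forall j : 'I_k, (0 < j)%N -> (t' j < e r j)%N) -> value_ge p (i * u).+1 (Mon g t').
  move=> i2 le tB; rewrite Mon_monomial.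
  apply: value_geW (value_ge_monomial charK ip mp (extended t') vw).
  apply: (@value_bound k) => //.
    by move=> j /andP[j0 jk]; rewrite -[j]/(val (Ordinal jk)) extendedE; apply: tB.
  by apply: (leq_trans le); apply: leq_sum => j _; rewrite extendedE.
apply: (value_isD charK ip mp); first exact: value_isX.
rewrite big_nat_cond; apply: (value_ge_sum charK ip mp) => i.
rewrite andbT => /andP[i2 ie].
suff va : value_ge p (i * u).+1 (alpha i).
  have -> : ((e r k * u).+1 = (i * u).+1 + (e r k - i) * u)%N.
    by rewrite addSn -mulnDl subnKC.
  by apply: (value_geM charK ip mp) => //; apply: (value_geX charK ip mp); apply: value_is_ge.
have v2 s' : Mon_series g (E2 r k i) s' -> value_ge p (i * u).+1 s'.
  move=> sE'; apply: (value_ge_Mon_series charK ip mp k0 (@E2_B k i) sE') => t' /(E2_sum r0)[lt tB].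
  by apply: key => //; apply: ltnW.
move: ie; rewrite ltnS leq_eqVlt => /predU1P[ie|ie]; last first.
  by apply/v2/Hal; rewrite i2 -ltnS prednK ?e_gt0.
rewrite ie alE; rewrite -ie in sE *; apply: (value_geD charK ip mp); last exact: v2.
rewrite ie; apply: (value_geZ charK ip mp); have [E tB] := E1_sum Et.
by apply: key => //; rewrite -?ie // ie E.
Qed.

(** The minimal ratio stays minimal from k to k + 1 because e_k r_k < r_(k+1);
    so g_(h+1) has a finite value. *)
Lemma value_propagates k u (w : nat -> nat) : (0 < k <= h)%N -> value_is p u (g k) ->
  (forall j, (j < k)%N -> value_ge p (w j) (mon_factor g j)) ->
  (forall j, (j < k)%N -> (u * r j <= w j * r k)%N) -> (u * r 0 < w 0 * r k)%N ->
  ~ divides p (g h.+1).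
Proof.
have [n] := ubnP (h - k)%N; elim: n k u w => // n IH k u w hk kh vg vw Hw w0.
have vS := value_step kh vg vw Hw w0.
have k0 : (0 < k)%N by case/andP: kh.
have [kh'|] := leqP h k.
  have kE : k = h by apply/eqP; rewrite eqn_leq kh'; case/andP: kh => _ ->.
  by rewrite -kE; case: vS.
move=> kh'.
have lt : (e r k * r k < r k.+1)%N by apply: (er_lt r0 h_gt0 r_incr); rewrite k0.
apply: (IH k.+1 (e r k * u)%N (fun j => if j == k then u else w j)) => //.
- by lia.
- move=> j; rewrite ltnS leq_eqVlt => /predU1P[->|jk].
    by rewrite eqxx /mon_factor gtn_eqF //; apply: value_is_ge.
  by rewrite ltn_eqF //; apply: vw.
- move=> j; rewrite ltnS leq_eqVlt => /predU1P[->|jk].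
    by rewrite eqxx mulnAC mulnC leq_mul2l (ltnW lt) orbT.
  rewrite ltn_eqF //; have := Hw j jk => le.
  apply: (@leq_trans (e r k * (w j * r k))%N).
    by rewrite -mulnA leq_mul2l le orbT.
  by rewrite mulnCA leq_mul2l (ltnW lt) orbT.
- rewrite ltn_eqF //.
  apply: (@leq_trans (e r k * (w 0 * r k))%N).
    by rewrite -mulnA ltn_pmul2l // e_gt0.
  by rewrite mulnCA leq_mul2l (ltnW lt) orbT.
Qed.

Let N := (size p).-1.
Let N0 : (0 < N)%N := size_p_gt0 ip mp.

(** At the first index where proportionality fails, a value that is too small is
    a minimal ratio; a value that is too large makes the monomial of E(l, e_l, 1)
    dominate g_(l+1) and gives a minimal ratio at l + 1.  Both contradict
    [value_propagates]. *)
Lemma branch_values l : divides p (g h.+1) -> (0 < l <= h)%N ->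
  exists m, value_is p m (g l) /\ (m * r 0 = r l * N)%N.
Proof.
move=> dp; elim/ltn_ind: l => l IH lh.
have l0 : (0 < l)%N by case/andP: lh.
have rl : (0 < r l)%N by apply: r_gt0; case/andP: lh.
have ex (j : 'I_l) : exists m, value_is p m (mon_factor g j) /\ (m * r 0 = r j * N)%N.
  case: (posnP j) => [->|j0].
    by exists N; rewrite /mon_factor eqxx mulnC; split=> //; apply: value_is_x.
  rewrite /mon_factor gtn_eqF //; apply: IH => //; rewrite j0 /=.
  by case/andP: lh => _; apply: leq_trans; apply: ltnW.
have [m0 mE0] := choice ex.
pose m j := if insub j is Some i then m0 i else 0%N.
have mE j : (j < l)%N -> value_is p (m j) (mon_factor g j) /\ (m j * r 0 = r j * N)%N.
  by move=> jl; rewrite /m insubT /=; exact: (mE0 (Ordinal jl)).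
have rj j : (j < l)%N -> (0 < r j)%N.
  by move=> jl; apply: r_gt0; apply: ltnW; apply: leq_trans jl _; case/andP: lh.
(* The case of too large a value; m' may be any lower bound, for v(g_l) may be
   infinite. *)
have contra m' : value_ge p m' (g l) -> ~ (r l * N < m' * r 0)%N.
  move=> vm' lt.
  have [_ /(_ l lh)[alpha [gE [t Et [a a0 [s sE alE]]] Hal]]] := adm.
  have [Et1 Et2] := E1_sum Et.
  pose U := (\sum_(j < l) t j * m j)%N.
  have sumE (t' : {ffun 'I_l -> nat}) :
      ((\sum_(j < l) t' j * m j) * r 0 = (\sum_(j < l) t' j * r j) * N)%N.
    rewrite !big_distrl /=; apply: eq_bigr => j _.
    by rewrite -mulnA (mE j (ltn_ord j)).2 mulnA.
  have UE : (U * r 0 = e r l * r l * N)%N by rewrite /U sumE -Et1.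
  have value_isMon : value_is p U (Mon g t).
    rewrite Mon_monomial /U (eq_bigr (fun j : 'I_l => extended t j * m j)%N);
      last by move=> j _; rewrite extendedE.
    by apply: value_is_monomial => // j jl; case: (mE j jl).
  have vser i s' : Mon_series g (E2 r l i) s' -> value_ge p ((i * r l * N) %/ r 0).+1 s'.
    move=> sE'; apply: (value_ge_Mon_series charK ip mp l0 (@E2_B l i) sE') => t' /(E2_sum r0)[lt' tB].
    rewrite Mon_monomial.
    apply: value_geW (value_ge_monomial charK ip mp (extended t') (w := m) _); last first.
      by move=> j jl; apply: value_is_ge; case: (mE j jl).
    rewrite (eq_bigr (fun j : 'I_l => t' j * m j)%N); last by move=> j _; rewrite extendedE.
    by rewrite ltn_divLR // sumE ltn_pmul2r.
  have vU : value_is p U (g l.+1).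
    rewrite gE.
    have e2 := e_gt1 r0 h_gt0 d_last r_incr r_min lh.
    have -> : g l ^+ e r l + \sum_(2 <= i < (e r l).+1) alpha i * g l ^+ (e r l - i) =
       fpsC a *: Mon g t + (s + (g l ^+ e r l + \sum_(2 <= i < e r l) alpha i * g l ^+ (e r l - i))).
      rewrite big_nat_recr //= subnn expr0 mulr1 alE.
      by rewrite [LHS]addrA [LHS]addrC -addrA.
    apply: (value_isD charK ip mp).
      rewrite -mul_polyC -[U]add0n; apply: (value_isM charK ip mp) => //.
      exact: value_is_const.
    apply: (value_geD charK ip mp).
      have := vser (e r l) s sE; rewrite -UE mulnK //.
    apply: (value_geD charK ip mp).
      have := value_geX charK ip mp (e r l) vm'; apply: value_geW.
      by rewrite -(ltn_pmul2r r0) UE -!mulnA ltn_pmul2l // ?e_gt0.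
    rewrite big_nat_cond; apply: (value_ge_sum charK ip mp) => i; rewrite andbT => /andP[i2 ie].
    have vi := vser i (alpha i) (Hal i _).
    have := value_geM charK ip mp (vi _) (value_geX charK ip mp (e r l - i) vm').
    rewrite i2 -ltnS prednK ?e_gt0 // ie => /(_ isT); apply: value_geW.
    rewrite -(ltn_pmul2r r0) UE mulnDl.
    have -> : (e r l * r l * N = i * r l * N + (e r l - i) * (r l * N))%N.
      by rewrite -!mulnA -mulnDl subnKC // ltnW.
    rewrite -addSn; apply: leq_add; first exact: ltn_ceil.
    by rewrite -mulnA leq_mul2l (ltnW lt) orbT.
  case: (ltnP l h) => lh'; last first.
    have lE : l = h by apply/eqP; rewrite eqn_leq lh'; case/andP: lh => _ ->.
    by move: vU; rewrite lE => -[].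
  have ltr : (e r l * r l < r l.+1)%N by apply: (er_lt r0 h_gt0 r_incr); rewrite l0.
  apply: (value_propagates (k := l.+1) (u := U) (w := fun j => if j == l then m' else m j)) => //.
  - move=> j; rewrite ltnS leq_eqVlt => /predU1P[->|jl].
      by rewrite eqxx /mon_factor gtn_eqF.
    by rewrite ltn_eqF //; apply: value_is_ge; case: (mE j jl).
  - move=> j; rewrite ltnS leq_eqVlt => /predU1P[->|jl].
      rewrite eqxx -(leq_pmul2r r0) mulnAC UE [leqRHS]mulnAC.
      apply: (@leq_trans (r l * N * (e r l * r l))%N); first by rewrite eq_leq //; lia.
      by apply: leq_mul; apply: ltnW.
    rewrite ltn_eqF // -(leq_pmul2r r0) mulnAC UE [leqRHS]mulnAC (mE j jl).2.
    apply: (@leq_trans (r j * N * (e r l * r l))%N); first by rewrite eq_leq //; lia.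
    by rewrite leq_mul2l (ltnW ltr) orbT.
  - rewrite ltn_eqF // -(ltn_pmul2r r0) mulnAC UE.
    rewrite (mE 0%N l0).2.
    apply: (@leq_ltn_trans (r 0 * N * (e r l * r l))%N); first by rewrite eq_leq //; lia.
    by rewrite ltn_pmul2l // muln_gt0 r0.
(* (r_l N).+1 is a bound large enough for contra, since r_0 > 0. *)
have [vm'|[k vk kM]] := value_ge_or p (r l * N).+1 (g l).
  case: (contra _ vm'); exact: leq_pmulr.
exists k; split=> //; case: (ltngtP (k * r 0)%N (r l * N)%N) => // lt; last first.
  by case: (contra k (value_is_ge vk)).
case: (value_propagates (k := l) (u := k) (w := m) lh vk _ _ _ dp) => //.
- by move=> j jl; apply: value_is_ge; case: (mE j jl).
- move=> j jl; rewrite -(leq_pmul2r r0) mulnAC [leqRHS]mulnAC (mE j jl).2.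
  apply: (@leq_trans (r l * N * r j)%N); first by rewrite leq_mul2r (ltnW lt) orbT.
  by rewrite eq_leq //; lia.
- rewrite -(ltn_pmul2r r0) [ltnRHS]mulnAC (mE 0%N l0).2.
  apply: (@leq_trans (r l * N * r 0)%N); first by rewrite ltn_pmul2r.
  by rewrite eq_leq //; lia.
Qed.

Lemma irreducible_of_factor : divides p (g h.+1) -> g h.+1 = p.
Proof.
move=> dp; have [mg sg] : g h.+1 \is monic /\ size (g h.+1) = (deg_app r h.+1).+1.
  by apply: admissible_size; rewrite ltnSn.
apply: monic_divides_eq => //.
have degE : deg_app r h.+1 = r 0 by rewrite -(deg_app_d r (ltn0Sn h)) d_last muln1.
rewrite sg degE -(prednK (_ : 0 < size p)%N); last first.
  by rewrite ltnW // (irreducible_size ip mp).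
rewrite ltnS -/N; apply: dvdn_leq => //.
have key k : (0 < k <= h.+1)%N -> (r 0 %| d r k * N)%N.
  elim: k => // k IH /andP[_ kh]; case: (posnP k) => [->|k0].
    by rewrite d1 dvdn_mulr.
  have IHk : (r 0 %| d r k * N)%N by apply: IH; rewrite k0 ltnW.
  rewrite dS muln_gcdl dvdn_gcd IHk /=.
  have [|m [_ <-]] := branch_values (l := k) dp; first by rewrite k0.
  by rewrite dvdn_mull.
by have := key h.+1; rewrite d_last mul1n ltnSn => ->.
Qed.

End AdmissibleSequences.

(** * Expansions in standard monomials *)

Section StandardMonomials.
Variable K : closedFieldType.
Hypothesis charK : [pchar K] =i pred0.
Local Notation R := {poly fps K}.
Variable r : nat -> nat.
Hypothesis r0 : (0 < r 0)%N.
Variable f : R.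
Hypotheses (irf : irreducible f) (mf : f \is monic) (sf : size f = (r 0%N).+1).

(** The monomial of degree D in y, times x^a. *)
Definition exponents a D j := if j == 0%N then a else digit r j D.

Lemma exponents_sum k a D : (0 < k)%N -> (\sum_(j < k) exponents a D j * r j = a * r 0 + weight r k D)%N.
Proof.
move=> k0; rewrite -(big_mkord xpredT (fun j => exponents a D j * r j)%N) big_ltn //.
congr (_ + _)%N; apply: eq_big_nat => j /andP[j0 _].
by rewrite /exponents gtn_eqF.
Qed.

Lemma monomial_exponentsS (g : nat -> R) k a D : (0 < k)%N ->
  monomial g k.+1 (exponents a D) = monomial g k (exponents a (D %% deg_app r k)) * g k ^+ digit r k D.
Proof.
move=> k0; rewrite /monomial big_ord_recr /= /mon_factor gtn_eqF //; congr (_ * _ ^+ _).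
  apply: eq_bigr => j _; congr (_ ^+ _); rewrite /exponents; case: eqP => // /eqP j0.
  by rewrite digit_mod // lt0n j0 /=.
by rewrite /exponents gtn_eqF.
Qed.

Lemma monomial_exponents0 (g : nat -> R) k a D : (0 < k)%N ->
  monomial g k (exponents a D) = fpsX%:P ^+ a * monomial g k (exponents 0 D).
Proof.
case: k => // k _; rewrite /monomial !big_ord_recl /= expr0 mul1r; congr (_ * _).
Qed.

Lemma monic_monomial (g : nat -> R) k D : (0 < k)%N -> (D < deg_app r k)%N ->
  (forall j, (0 < j < k)%N -> g j \is monic /\ size (g j) = (deg_app r j).+1) ->
  monomial g k (exponents 0 D) \is monic /\ size (monomial g k (exponents 0 D)) = D.+1.
Proof.
elim: k D => // k IH D _; case: (posnP k) => [->|k0] DN Hg.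
  move: DN; rewrite deg_app1 ltnS leqn0 => /eqP ->.
  by rewrite /monomial big_ord1 /exponents eqxx expr0 monic1 size_poly1.
rewrite monomial_exponentsS //.
have [mg sg] : g k \is monic /\ size (g k) = (deg_app r k).+1 by apply: Hg; rewrite k0 /=.
have [||m1 s1] := IH (D %% deg_app r k)%N k0.
- by rewrite ltn_mod deg_app_gt0.
- by move=> j /andP[j0 jk]; apply: Hg; rewrite j0 ltnW.
have mX := monic_exp (digit r k D) mg.
split; first by rewrite monicMr.
rewrite size_monicM ?monic_neq0 // s1 (size_monicX _ mg sg) digit_last // addnS /=.
by rewrite addSn [(deg_app _ _ * _)%N]mulnC [X in X.+1]addnC -divn_eq.
Qed.

(** What is used of the approximate roots of f of index less than k. *)
Definition value_family k (g : nat -> R) := forall j, (0 < j < k)%N ->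
  [/\ g j \is monic, size (g j) = (deg_app r j).+1 & value_is f (r j) (g j)].

Lemma value_family_size k g : value_family k g -> forall j, (0 < j < k)%N ->
  g j \is monic /\ size (g j) = (deg_app r j).+1.
Proof. by move=> F j /F[]. Qed.

Lemma value_is_monomial_exponents k g a D : (0 < k)%N -> value_family k g ->
  value_is f (a * r 0 + weight r k D) (monomial g k (exponents a D)).
Proof.
move=> k0 F; rewrite -exponents_sum //; apply: value_is_monomial => // j jk; rewrite /mon_factor.
case: eqP => [->|/eqP j0]; first by have := value_is_x charK irf mf; rewrite sf.
by have [] := F j _; first by rewrite lt0n j0.
Qed.

Lemma value_is_coef (c : fps K) : c != 0 -> value_is f (xord c * r 0) c%:P.
Proof.
move=> c0; have [b b0 ->] := xord_decomp c0.
have ub : b \is a GRing.unit by [].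
have bb : b%:P * b^-1%:P = 1 :> R by rewrite -polyCM mulrV.
have v1 : value_is f 0 1 by apply: value_is1.
have nd (u v : fps K) : u%:P * v%:P = 1 :> R -> ~ divides f u%:P.
  move=> uv [q qE]; case: v1 => nd _; apply: nd; exists (q * v%:P).
  by rewrite -uv qE mulrAC.
have vb : value_is f 0 b%:P.
  have A := value_isM charK irf mf (conj (nd _ _ bb) erefl) (conj (nd b^-1 b _) erefl).
  rewrite bb mulrC bb in A; have := value_is_uniq (A erefl) v1 => /eqP.
  by rewrite addn_eq0 => /andP[/eqP E _]; split=> //; apply: nd bb.
rewrite polyCM polyC_exp.
have -> : (xord (fpsX ^+ xord c * b)%R * r 0 = xord c * r 0 + 0)%N.
  rewrite xordM ?expf_neq0 ?fpsX_neq0 //; last by apply: contraNneq b0 => ->; rewrite fps_coef0.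
  by rewrite xordXn (xord_unit ub) !addn0.
apply: (value_isM charK irf mf) => //; apply: (value_isX charK irf mf).
by have := value_is_x charK irf mf; rewrite sf.
Qed.

Lemma standard_expansion k g (P : R) : (0 < k)%N -> value_family k g -> (size P <= deg_app r k)%N ->
  exists c : nat -> fps K, (forall i, (size P <= i)%N -> c i = 0) /\
    P = \sum_(D < deg_app r k) c D *: monomial g k (exponents 0 D).
Proof.
move=> k0 F sP.
have [|//|c cE] := @monic_family_expansion _ (fun D => monomial g k (exponents 0 D)) (size P) P.
  by move=> D DP; apply: monic_monomial (value_family_size F) => //; apply: leq_trans sP.
exists (fun i => if (i < size P)%N then c i else 0); split.
  by move=> i; rewrite leqNgt => /negPf->.
rewrite {1}cE (big_ord_widen _ (fun D => c D *: monomial g k (exponents 0 D)) sP) big_mkcond.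
by apply: eq_bigr => D _; case: ifP => // _; rewrite scale0r.
Qed.

(** The terms have distinct values by [weight_inj], so the least one is the value
    of the sum. *)
Lemma expansion_value k g (c : nat -> fps K) (P : R) : (0 < k)%N -> value_family k g ->
  P = \sum_(D < deg_app r k) c D *: monomial g k (exponents 0 D) -> P != 0 ->
  exists D0, [/\ (D0 < deg_app r k)%N, c D0 != 0,
    value_is f (xord (c D0) * r 0 + weight r k D0) P &
    forall D, (D < deg_app r k)%N -> c D != 0 -> D != D0 ->
     (xord (c D0) * r 0 + weight r k D0 < xord (c D) * r 0 + weight r k D)%N].
Proof.
move=> k0 F PE P0; set val := fun D => (xord (c D) * r 0 + weight r k D)%N.
have vt D : c D != 0 -> value_is f (val D) (c D *: monomial g k (exponents 0 D)).
  move=> cD; rewrite -mul_polyC; apply: (value_isM charK irf mf); first exact: value_is_coef.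
  by have := @value_is_monomial_exponents k g 0 D k0 F; rewrite mul0n add0n.
have [D1 cD1] : exists D : 'I_(deg_app r k), c D != 0.
  apply: contrapT => H; move/eqP: P0; apply; rewrite PE big1 // => D _.
  case: (eqVneq (c D) 0) => [->|cD]; first by rewrite scale0r.
  by case: H; exists D.
case: (@arg_minnP _ D1 (fun D => c D != 0) val cD1) => D0 cD0 minD.
have strict D : (D < deg_app r k)%N -> c D != 0 -> D != D0 -> (val D0 < val D)%N.
  move=> DN cD DD; rewrite ltn_neqAle (minD (Ordinal DN)) // andbT.
  apply: contraNneq DD => E; have [-> //] := weight_inj r0 k0 (ltn_ord D0) DN E.
exists D0; split=> //.
rewrite PE (bigD1 D0) //=; apply: (value_isD charK irf mf); first exact: vt.
apply: (value_ge_sum charK irf mf) => D DD; case: (eqVneq (c D) 0) => [->|cD].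
  by rewrite scale0r; apply: value_ge_zero.
by apply: value_geW (value_is_ge (vt D cD)); apply: strict.
Qed.

Lemma small_value k g (P : R) : (0 < k)%N -> value_family k g -> (size P <= deg_app r k)%N ->
  P != 0 -> exists a D, (D < deg_app r k)%N /\ value_is f (a * r 0 + weight r k D) P.
Proof.
move=> k0 F sP P0; have [c [_ PE]] := standard_expansion k0 F sP.
have [D0 [DN _ vP _]] := expansion_value k0 F PE P0.
by exists (xord (c D0)), D0.
Qed.

Lemma small_value_dvd k g m (P : R) : (0 < k)%N -> value_family k g -> (size P <= deg_app r k)%N ->
  value_is f m P -> (d r k %| m)%N.
Proof.
move=> k0 F sP vP; have P0 : P != 0.
  by apply: contra_notN vP.1 => /eqP->; exists 0; rewrite mul0r.
have [a [D [_ vP']]] := small_value k0 F sP P0.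
rewrite (value_is_uniq vP vP') dvdn_add ?d_dvd_weight // dvdn_mull // d_dvd_r //.
Qed.

End StandardMonomials.

(** * Polynomials of prescribed value and approximate roots *)

(** The first two terms of the binomial expansion, set apart. *)
Lemma exprD_head (A : comNzRingType) (x y : A) n :
  (x + y) ^+ n.+1 = x ^+ n.+1 + (y *+ n.+1) * x ^+ n +
    \sum_(i < n) (x ^+ (n - i.+1) * y ^+ i.+2) *+ 'C(n.+1, i.+2).
Proof.
rewrite exprDn big_ord_recl big_ord_recl addrA; congr (_ + _ + _).
  by rewrite subn0 expr0 mulr1 bin0 mulr1n.
by rewrite /bump /= subn1 expr1 bin1 mulrnAl mulrC.
Qed.

Section ApproximateRoots.
Variable K : closedFieldType.
Hypothesis charK : [pchar K] =i pred0.
Local Notation R := {poly fps K}.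
Variables (h : nat) (r : nat -> nat).
Hypothesis h_gt0 : (0 < h)%N.
Hypothesis r_gt0 : forall k : nat, (k <= h)%N -> (0 < r k)%N.
Hypothesis d_last : d r h.+1 = 1%N.
Hypothesis r_incr : forall k : nat, (1 <= k <= h.-1)%N ->
       (r k * d r k < r k.+1 * d r k.+1)%N.
Hypothesis r_min : minimal_generators h r.
Variable f : R.
Hypotheses (irf : irreducible f) (mf : f \is monic) (sf : size f = (r 0%N).+1).
Hypothesis GE : Gamma_of f = Gamma h r.

Let r0 : (0 < r 0)%N := r_gt0 (leq0n h).

Lemma value_is_Gamma m g : value_is f m g -> Gamma h r m.
Proof. by case=> nd <-; rewrite -GE; exists g. Qed.

Lemma Gamma_vis m : Gamma h r m -> exists g, value_is f m g.
Proof. by rewrite -GE => -[g nd <-]; exists g. Qed.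

(** Divide an element of value r_k by G: if v(G) > r_k, the remainder has value
    r_k, although values of polynomials of degree less than deg G are multiples of
    d_k. *)
Lemma monic_value_le k g (G : R) m : (0 < k <= h)%N -> value_family r f k g ->
  G \is monic -> size G = (deg_app r k).+1 -> value_ge f m G -> (m <= r k)%N.
Proof.
move=> kh F mG sG vG; rewrite leqNgt; apply/negP => lt.
have [k0 kh'] := andP kh.
have [P vP] := Gamma_vis (Gamma_r r kh').
have E := Pdiv.IdomainMonic.divp_eq mG P.
have sP0 : (size (modp P G) <= deg_app r k)%N.
  by rewrite -ltnS -sG ltn_modp monic_neq0.
have v0 : value_is f (r k) (modp P G).
  have -> : modp P G = P + - (divp P G * G) by rewrite {2}E addrC addKr.
  apply: (value_isD charK irf mf) => //; apply: (value_geN charK irf mf).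
  rewrite -[(r k).+1]add0n; apply: (value_geM charK irf mf); first exact: value_ge0.
  exact: value_geW vG.
have := small_value_dvd charK r0 irf mf sf k0 F sP0 v0.
by apply/negP; apply: d_ndvd_r kh.
Qed.

Lemma add_small_monic (G b : R) n : G \is monic -> size G = n.+1 -> (size b <= n)%N ->
  G + b \is monic /\ size (G + b) = n.+1.
Proof.
move=> mG sG sb; have lt : (size b < size G)%N by rewrite sG ltnS.
by rewrite size_polyDl // monicE lead_coefDl // (monicP mG) eqxx.
Qed.

(** A value of G below r_k is a multiple of d_k, because Gamma contains no other
    element there.  Above the conductor bound it is the value of a standard
    monomial of smaller degree, and subtracting a multiple of it increases v(G).
    By [monic_value_le] this stops at r_k. *)
Lemma increase_value k g (G : R) m : (0 < k <= h)%N -> value_family r f k g ->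
  G \is monic -> size G = (deg_app r k).+1 -> (conductor_bound r k <= m)%N ->
  value_ge f m G -> exists G', [/\ G' \is monic, size G' = (deg_app r k).+1 & value_is f (r k) G'].
Proof.
move=> kh F; have [n] := ubnP (r k - m)%N; elim: n G m => // n IH G m nm mG sG Tm vG.
have [k0 kh'] := andP kh.
have [vk|[m' vm' lt]] := value_ge_or f (r k) G.
  exists G; split=> //; have [H|[l vl lt]] := value_ge_or f (r k).+1 G.
    by have := monic_value_le kh F mG sG H; rewrite ltnn.
  have kl := value_is_le vl vk; have -> : r k = l by apply/eqP; rewrite eqn_leq kl -ltnS lt.
  by [].
have mm' := value_is_le vm' vG.
have dm' : (d r k %| m')%N.
  move: lt; have kk := prednK k0; rewrite -kk => lt.
  apply: (Gamma_dvd r0 h_gt0 r_incr _ (value_is_Gamma vm') lt).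
  by rewrite -ltnS kk ltnS.
have [a [D [DN mE]]] := weight_represents r0 k0 dm' (leq_trans Tm mm').
have vM := @value_is_monomial_exponents _ charK r f irf mf sf k g a D k0 F.
rewrite -mE in vM.
have [c c0 vc] := value_is_residue charK irf mf vm' vM.
have sM : (size (- ((fpsC c)%:P * monomial g k (exponents r a D)))%R <= deg_app r k)%N.
  rewrite size_polyN mul_polyC (leq_trans (size_scale_leq _ _)) //.
  apply: size_monomial => //; first exact: value_family_size F.
  by move=> j /andP[j0 _]; rewrite /exponents gtn_eqF // digit_lt.
have [mG' sG'] := add_small_monic mG sG sM.
apply: (IH _ m'.+1 _ mG' sG') => //; last by apply: leqW; apply: leq_trans mm'.
have : (m < m'.+1)%N by rewrite ltnS.
by move: nm lt; lia.
Qed.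

Lemma family_exists k : (0 < k <= h.+1)%N -> exists g, value_family r f k g.
Proof.
elim: k => // k IH /andP[_ kh]; case: (posnP k) => [->|k0].
  by exists (fun=> 0) => j; case: j => [|j]; rewrite ?ltnS ?ltn0.
have kh' : (0 < k <= h)%N by rewrite k0.
have [|g F] := IH; first by rewrite k0 ltnW.
suff [G [mG sG vG]] : exists G, [/\ G \is monic, size G = (deg_app r k).+1 & value_is f (r k) G].
  exists (fun j => if j == k then G else g j) => j /andP[j0].
  rewrite ltnS leq_eqVlt => /predU1P[->|jk]; first by rewrite eqxx.
  by rewrite ltn_eqF //; apply: F; rewrite j0.
(* Start from y if k = 1, and from g_(k-1)^(e_(k-1)) otherwise. *)
case: (posnP k.-1) => [k1|k1].
  have kE : k = 1%N by rewrite -(prednK k0) k1.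
  rewrite kE in F kh' *.
  apply: (@increase_value 1 g 'X 0) => //; rewrite ?monicX ?size_polyX ?deg_app1 //.
    by rewrite /conductor_bound big_geq.
  exact: value_ge0.
have kk := prednK k0; set l := k.-1 in k1 kk.
have [mg sg vg] : [/\ g l \is monic, size (g l) = (deg_app r l).+1 & value_is f (r l) (g l)].
  by apply: F; rewrite k1 -kk ltnSn.
apply: (@increase_value k g (g l ^+ e r l) (e r l * r l)%N) => //.
- exact: monic_exp.
- by rewrite (size_monicX _ mg sg) -kk deg_appS.
- rewrite -kk conductor_boundS // -{2}(prednK (e_gt0 r0 k1)) mulSn leq_add2r.
  apply: (conductor_le r0 h_gt0 r_incr); rewrite k1 /= -ltnS kk ltnW //.
- by apply: value_is_ge; apply: (value_isX charK irf mf).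
Qed.

(** Remove the leading term of F - G^e by adding to G its quotient by e G^(e-1).
    The leading term has value at least e_k r_k, so the correction has value at
    least r_k, and in fact more, as its value is a multiple of d_k. *)
Lemma approximate_root_value k g (F : R) : (0 < k <= h)%N -> value_family r f k.+1 g ->
  F \is monic -> size F = (deg_app r k.+1).+1 -> value_ge f (e r k * r k).+1 F ->
  exists G, [/\ G \is monic, size G = (deg_app r k).+1, value_is f (r k) G &
    (size (F - G ^+ e r k)%R <= deg_app r k.+1 - deg_app r k)%N].
Proof.
move=> kh + mF sF vF; have [k0 kh'] := andP kh.
have [n] := ubnP (size (F - g k ^+ e r k)); elim: n g => // n IH g sn Fam.
have [mg sg vg] : [/\ g k \is monic, size (g k) = (deg_app r k).+1 & value_is f (r k) (g k)].
  by apply: Fam; rewrite k0 /=.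
set P := F - g k ^+ e r k in sn.
case: (leqP (size P) (deg_app r k.+1 - deg_app r k)) => [sP|sP]; first by exists (g k).
have sX : size (g k ^+ e r k) = (deg_app r k.+1).+1 by rewrite (size_monicX _ mg sg) deg_appS.
have mX := monic_exp (e r k) mg.
have sP' : (size P <= deg_app r k.+1)%N.
  apply/leq_sizeP => j; rewrite leq_eqVlt coefB => /predU1P[<-|jN].
    move/monicP: mF; rewrite lead_coefE sF /= => ->.
    by move/monicP: mX; rewrite lead_coefE sX /= => ->; rewrite subrr.
  by rewrite !nth_default ?subrr ?sF ?sX.
have vP : value_is f (e r k * r k) P.
  rewrite /P addrC; apply: (value_isD charK irf mf) => //; apply: (value_isN charK irf mf).
  exact: (value_isX charK irf mf).
have [c [c0 PE]] := standard_expansion r0 (ltn0Sn k) Fam sP'.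
have P0 : P != 0 by rewrite -size_poly_gt0 (leq_ltn_trans _ sP).
(* The leading term of P is c_D times the monomial of degree D, in which g_k has
   exponent e_k - 1. *)
pose D := (size P).-1; have DE : D.+1 = size P by rewrite /D prednK // size_poly_gt0.
have DN : (D < deg_app r k.+1)%N by rewrite DE.
have std i : (i < deg_app r k.+1)%N -> monomial g k.+1 (exponents r 0 i) \is monic /\
    size (monomial g k.+1 (exponents r 0 i)) = i.+1.
  by move=> iN; apply: monic_monomial (value_family_size Fam).
have cD : c D != 0.
  apply: contraTneq (ltnSn D) => cD; rewrite -leqNgt DE PE.
  apply: (leq_trans (size_sum _ _ _)); apply/bigmax_leqP => i _.
  have [_ si] := std i (ltn_ord i).
  case: (ltngtP i D) => [iD|Di|->]; last by rewrite cD scale0r size_poly0.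
    by rewrite (leq_trans (size_scale_leq _ _)) // si.
  by rewrite c0 ?scale0r ?size_poly0 // -DE.
have [D0 [D0N cD0 vP0 minD]] := expansion_value charK r0 irf mf sf (ltn0Sn k) Fam PE P0.
have valD : (e r k * r k <= xord (c D) * r 0 + weight r k.+1 D)%N.
  rewrite (value_is_uniq vP vP0); case: (eqVneq D D0) => [->//|DD].
  by apply: ltnW; apply: minD.
pose D' := (D %% deg_app r k)%N.
have Nk0 := deg_app_gt0 r0 k0; have D'N : (D' < deg_app r k)%N by rewrite ltn_mod.
have dgD : digit r k D = (e r k).-1.
  have ek := e_gt0 r0 k0.
  apply/eqP; rewrite eqn_leq -ltnS prednK // digit_lt //= digit_last // leq_divRL //.
  by rewrite -ltnS DE; move: sP; rewrite deg_appS // -{1}(prednK ek) mulnS mulnC; lia.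
(* The quotient of the leading term of P by g_k^(e_k - 1). *)
pose b := c D *: monomial g k (exponents r 0 D').
have Fam' : value_family r f k g by move=> j /andP[j0 jk]; apply: Fam; rewrite j0 ltnW.
have vb : value_is f (xord (c D) * r 0 + weight r k D') b.
  rewrite /b -mul_polyC; apply: (value_isM charK irf mf); first exact: (value_is_coef charK irf mf sf).
  by have := @value_is_monomial_exponents _ charK r f irf mf sf k g 0 D' k0 Fam'; rewrite mul0n add0n.
have ltb : (r k < xord (c D) * r 0 + weight r k D')%N.
  rewrite ltn_neqAle; apply/andP; split.
    apply: contra (d_ndvd_r r0 h_gt0 d_last r_incr r_min kh) => /eqP ->.
    by rewrite dvdn_add ?d_dvd_weight // dvdn_mull // d_dvd_r.
  move: valD; rewrite weightS // dgD weight_mod.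
  rewrite -{1}(prednK (e_gt0 r0 k0)) mulSn addnA leq_add2r //.
have [m1 s1] : monomial g k (exponents r 0 D') \is monic /\ size (monomial g k (exponents r 0 D')) = D'.+1.
  exact: monic_monomial (value_family_size Fam').
pose ie : fps K := fpsC ((e r k)%:R^-1).
have ieE : ie *+ e r k = 1.
  rewrite -mulr_natl; have -> : ((e r k)%:R : fps K) = fpsC (e r k)%:R by rewrite rmorph_nat.
  rewrite -rmorphM /= mulfV ?rmorph1 // -(prednK (e_gt0 r0 k0)).
  exact: natK_neq0.
pose b' := ie *: b.
have sb : (size b <= D'.+1)%N by rewrite /b (leq_trans (size_scale_leq _ _)) // s1.
have sb' : (size b' <= D'.+1)%N by rewrite (leq_trans (size_scale_leq _ _)).
have [mG sG] := add_small_monic mg sg (leq_trans sb' D'N).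
have vG : value_is f (r k) (g k + b').
  apply: (value_isD charK irf mf) => //; apply: value_geZ => //.
  exact: value_geW (value_is_ge vb).
pose g' j := if j == k then g k + b' else g j.
have g'k : g' k = g k + b' by rewrite /g' eqxx.
apply: (IH g'); last first.
  move=> j /andP[j0]; rewrite ltnS leq_eqVlt => /predU1P[->|jk]; first by rewrite g'k.
  by rewrite /g' ltn_eqF //; apply: Fam'; rewrite j0.
rewrite g'k -ltnS; apply: leq_ltn_trans sn; rewrite -DE ltnS.
have Dsplit : D = (D' + (e r k).-1 * deg_app r k)%N.
  by rewrite {1}(divn_eq D (deg_app r k)) -/D' addnC -digit_last ?dgD.
have -> : F - (g k + b') ^+ e r k =
    (P - b * g k ^+ (e r k).-1) -
    \sum_(i < (e r k).-1) (g k ^+ ((e r k).-1 - i.+1) * b' ^+ i.+2) *+ 'C(e r k, i.+2).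
  have bE : b' *+ (e r k).-1.+1 = b.
    by rewrite (prednK (e_gt0 r0 k0)) /b' scalerMnl ieE scale1r.
  rewrite /P -{1 2}(prednK (e_gt0 r0 k0)) exprD_head bE !opprD !addrA.
  by rewrite (prednK (e_gt0 r0 k0)).
rewrite (leq_trans (size_polyD _ _)) // geq_max; apply/andP; split.
  have -> : b * g k ^+ (e r k).-1 = c D *: monomial g k.+1 (exponents r 0 D).
    by rewrite monomial_exponentsS // dgD -scalerAl.
  apply/leq_sizeP => j; rewrite leq_eqVlt coefB coefZ => /predU1P[<-|Dj].
    have [m2 s2] := std D DN.
    have -> : (monomial g k.+1 (exponents r 0 D))`_D = 1 by move/monicP: m2; rewrite lead_coefE s2.
    rewrite mulr1 PE coef_sum (bigD1 (Ordinal DN)) //= coefZ.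
    have -> : (monomial g k.+1 (exponents r 0 D))`_D = 1 by move/monicP: m2; rewrite lead_coefE s2.
    rewrite mulr1 big1 ?addr0 ?subrr // => i; rewrite -val_eqE /= => iD.
    have [_ si] := std i (ltn_ord i).
    rewrite coefZ; move: iD; rewrite neq_ltn => /orP[iD|Di].
      by rewrite nth_default ?mulr0 // si.
    by rewrite c0 ?mul0r // -DE.
  have [_ s2] := std D DN.
  by rewrite !nth_default ?mulr0 ?subrr // ?s2 // -DE.
rewrite size_polyN; apply: (leq_trans (size_sum _ _ _)); apply/bigmax_leqP => i _.
rewrite -mulr_natl -polyC_natr mul_polyC (leq_trans (size_scale_leq _ _)) //.
apply: leq_trans (size_polyMleq _ _) _.
rewrite (size_monicX _ mg sg) addSn /=.
have sbX : (size (b' ^+ i.+2) <= D' * i.+2 + 1)%N.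
  apply: leq_trans (size_poly_exp_leq _ _) _; rewrite addn1 ltnS leq_mul2r.
  by rewrite /=; case: (size b') sb'.
apply: leq_trans (leq_add (leqnn _) sbX) _.
rewrite Dsplit; move: (ltn_ord i) D'N; set E := (e r k).-1; set N := deg_app r k => iE D'N.
have E1 : (E * N = N * (E - i.+1) + i.+1 * N)%N.
  by rewrite [X in (_ = X + _)%N]mulnC -mulnDl subnK.
have E2 : (i.+1 * D'.+1 <= i.+1 * N)%N by rewrite leq_mul2l D'N orbT.
have ar (a w j m : nat) : (j.+1 * m.+1 <= j.+1 * w -> a + (m * j.+2 + 1) <= m + (a + j.+1 * w))%N.
  by rewrite !mulnS !mulSn; lia.
by rewrite E1; apply: ar E2.
Qed.

End ApproximateRoots.

(** * Expansions as series of monomials *)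

(** Replaces a sum over a set by a sum over a finite type that covers its support. *)
Lemma fsum_cover (T : choiceType) (I : finType) (V : nmodType) (hh : I -> T) (A : set T)
    (F : T -> V) : injective hh ->
  (forall t, A t -> F t <> 0 -> exists i, t = hh i) ->
  (forall i, ~ A (hh i) -> F (hh i) = 0) ->
  \sum_(t \in A) F t = \sum_i F (hh i).
Proof.
move=> hinj cov out.
have -> : \sum_i F (hh i) = \sum_(t <- map hh (enum I)) F t.
  by rewrite big_map big_enum.
have uE : uniq (map hh (enum I)) by rewrite map_inj_uniq // enum_uniq.
rewrite [RHS]fsbig_seq //.
pose C := (A `&` [set` map hh (enum I)])%classic.
transitivity (\sum_(t \in C) F t).
  apply/esym; apply: fsbig_widen; first by move=> t [].
  move=> t [At nC] /=; apply: contrapT => Ft; apply: nC; split=> //.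
  by have [i ->] := cov t At Ft; rewrite /= map_f // mem_enum.
apply: fsbig_widen => [t []//|t [/= /mapP[i _ ->] nC]] /=.
by apply: out => Ai; apply: nC; split=> //=; rewrite map_f // mem_enum.
Qed.

Section SeriesOfMonomials.
Variable K : closedFieldType.
Local Notation R := {poly fps K}.
Variable r : nat -> nat.
Hypothesis r0 : (0 < r 0)%N.

Definition exponent_vector k a D : {ffun 'I_k -> nat} := [ffun j : 'I_k => exponents r a D (nat_of_ord j)].

Lemma Mon_exponent_vector (g : nat -> R) k a D :
  Mon g (exponent_vector k a D) = monomial g k (exponents r a D).
Proof. by apply: eq_bigr => j _; rewrite ffunE. Qed.

Lemma B_exponent_vector k a D : B r k (exponent_vector k a D).
Proof. by move=> j j0; rewrite ffunE /exponents gtn_eqF // digit_lt. Qed.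

Lemma sum_exponent_vector k a D : (0 < k)%N ->
  (\sum_(j < k) exponent_vector k a D j * r j = a * r 0 + weight r k D)%N.
Proof.
by move=> k0; rewrite -exponents_sum //; apply: eq_bigr => j _; rewrite ffunE.
Qed.

Lemma exponent_vector_inj k a a' D D' : (0 < k)%N -> (D < deg_app r k)%N -> (D' < deg_app r k)%N ->
  exponent_vector k a D = exponent_vector k a' D' -> D = D' /\ a = a'.
Proof.
move=> k0 DN DN' E; apply: (weight_inj r0 k0) => //.
by rewrite -!sum_exponent_vector // E.
Qed.

Lemma E1_exponent_vector k i a D : (0 < k)%N ->
  (i * r k = a * r 0 + weight r k D)%N -> E1 r k i (exponent_vector k a D).
Proof.
move=> k0 E; split; first exact: B_exponent_vector.
have dk := d_gt0 r0 (ltn0Sn k).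
apply/eqP; rewrite -(eqn_pmul2r dk) -mulnA divnK ?d_dvd_r // E -sum_exponent_vector //.
rewrite big_distrl /=; apply/eqP; apply: eq_bigr => j _.
by rewrite -mulnA divnK // d_dvd_r // ltnS ltnW.
Qed.

Lemma E2_exponent_vector k i a D : (0 < k)%N ->
  (i * r k < a * r 0 + weight r k D)%N -> E2 r k i (exponent_vector k a D).
Proof.
move=> k0 E; split; first exact: B_exponent_vector.
have dk := d_gt0 r0 (ltn0Sn k).
rewrite -(ltn_pmul2r dk) -mulnA divnK ?d_dvd_r //; apply: (leq_trans E).
rewrite -sum_exponent_vector // big_distrl /=; apply: leq_sum => j _.
by rewrite -mulnA divnK // d_dvd_r // ltnS ltnW.
Qed.

(** Only the monomials with exponent of x at most n contribute to the coefficient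
    of x^n; on them the double sum over (D, a) is the Cauchy product. *)
Lemma Mon_series_intro (g : nat -> R) k (A : set {ffun 'I_k -> nat}) (b : nat -> fps K) s :
  (0 < k)%N -> (A `<=` B r k)%classic ->
  (forall a D, (D < deg_app r k)%N -> b D a != 0 -> A (exponent_vector k a D)) ->
  s = \sum_(D < deg_app r k) b D *: monomial g k (exponents r 0 D) -> Mon_series g A s.
Proof.
case: k A => // k A _ AB HA sE; set N := deg_app r k.+1 in HA sE.
pose coefa (t : {ffun 'I_k.+1 -> nat}) : K :=
  \sum_(D < N | t == exponent_vector k.+1 (t ord0) D) b D (t ord0).
have exponent_vector0 a D : exponent_vector k.+1 a D ord0 = a by rewrite ffunE.
have coefaE a (D : 'I_N) : coefa (exponent_vector k.+1 a D) = b D a.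
  rewrite /coefa exponent_vector0 (bigD1 D) //= big1 ?addr0 // => D' /andP[/eqP E].
  have [DD _] := exponent_vector_inj (ltn0Sn k) (ltn_ord D) (ltn_ord D') E.
  by rewrite -val_eqE /= DD eqxx.
exists coefa => j n.
pose F (t : {ffun 'I_k.+1 -> nat}) := (fpsC (coefa t) *: Mon g t)`_j n.
have Flow t : F t <> 0 -> (t ord0 <= n)%N.
  move=> Ft; rewrite leqNgt; apply/negP => nt; apply: Ft.
  by rewrite /F coefZ coef_fpsCM coef_Mon_low ?mulr0.
split.
  apply: sub_finite_set (finite_box r k n.+1) => t [At /= /eqP Ft].
  by split; [exact: AB|rewrite ltnS; apply: Flow].
pose hh (u : 'I_N * 'I_n.+1) := exponent_vector k.+1 u.2 u.1.
rewrite (@fsum_cover _ _ _ hh A F).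
- rewrite (eq_bigr (fun u : 'I_N * 'I_n.+1 =>
      b u.1 u.2 * (monomial g k.+1 (exponents r 0 u.1))`_j (n - u.2)%N)); last first.
    move=> [D a] _; rewrite /F /hh /= coefaE coefZ coef_fpsCM Mon_exponent_vector; congr (_ * _).
    rewrite monomial_exponents0 // -polyC_exp coefCM coef_fpsXnM ltnNge -ltnS ltn_ord //.
  rewrite -(pair_bigA _ (fun (D : 'I_N) (a : 'I_n.+1) =>
      b D a * (monomial g k.+1 (exponents r 0 D))`_j (n - a)%N)) /=.
  rewrite sE coef_sum coef_fps_sum; apply: eq_bigr => D _.
  by rewrite coefZ fps_coefM.
- move=> [D a] [D' a'] /(exponent_vector_inj (ltn0Sn k) (ltn_ord D) (ltn_ord D'))[E1 E2].
  by congr (_, _); apply: val_inj.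
- move=> t At Ft; have tn := Flow t Ft.
  have [D tD] : exists D : 'I_N, t = exponent_vector k.+1 (t ord0) D.
    apply: contrapT => H; apply: Ft; rewrite /F coefZ coef_fpsCM /coefa big_pred0 ?mul0r //.
    by move=> D; apply/negP => /eqP tD; apply: H; exists D.
  by exists (D, inord (t ord0)); rewrite /hh /= inordK // ltnS.
- move=> [D a] nA; rewrite /F /hh /= coefaE coefZ coef_fpsCM.
  case: (eqVneq (b D a) 0) => [->|bD]; first by rewrite mul0r.
  by case: nA; apply: HA.
Qed.

End SeriesOfMonomials.

Lemma sum_blocks (V : nmodType) (F : nat -> V) N n :
  \sum_(D < N * n) F D = \sum_(u < n) \sum_(D < N) F (D + u * N)%N.
Proof.
elim: n => [|n IH]; first by rewrite muln0 !big_ord0.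
rewrite mulnS addnC big_split_ord /= IH big_ord_recr /=; congr (_ + _).
by apply: eq_bigr => D _; rewrite addnC mulnC.
Qed.

(** * Approximate roots form an admissible sequence *)

Section AppUnique.
Variable K : closedFieldType.
Hypothesis charK : [pchar K] =i pred0.
Local Notation R := {poly fps K}.

(** g^n - g'^n is g - g' times a polynomial with leading coefficient n. *)
Lemma is_App_unique n (f g g' : R) : (0 < n)%N -> (n %| (size f).-1)%N ->
  is_App n f g -> is_App n f g' -> g = g'.
Proof.
move=> n0 nd [mg sg dg] [mg' sg' dg'].
set N := ((size f).-1 %/ n)%N in sg sg' dg dg'.
have NE : ((size f).-1 = N * n)%N by rewrite divnK.
apply/eqP; rewrite -subr_eq0; apply/negPn/negP => d0.
have E : (f - g' ^+ n) - (f - g ^+ n) = g ^+ n - g' ^+ n by rewrite opprB addrC addrA subrK.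
have : (size (g ^+ n - g' ^+ n)%R <= (size f).-1 - N)%N.
  by rewrite -E (leq_trans (size_polyD _ _)) // geq_max size_polyN dg dg'.
rewrite subrXX; set S := \sum_(i < n) _.
(* S is a sum of n monic polynomials of degree N (n - 1). *)
have Sco : S`_(N * n.-1) = n%:R.
  rewrite /S coef_sum -[n in RHS]card_ord -sumr_const; apply: eq_bigr => i _.
  have sX k (u : R) : u \is monic -> size u = N.+1 -> size (u ^+ k) = (N * k).+1.
    by move=> mu su; rewrite (size_monicX _ mu su).
  have mm : g ^+ (n.-1 - i) * g' ^+ i \is monic by rewrite monicMr monic_exp.
  have ss : size (g ^+ (n.-1 - i) * g' ^+ i)%R = (N * n.-1).+1.
    rewrite size_monicM ?monic_exp ?monic_neq0 ?monic_exp // !sX // addnS addSn /= -mulnDr subnK //.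
    by rewrite -ltnS prednK.
  by move/monicP: mm; rewrite lead_coefE ss.
have nn0 : (n%:R : fps K) != 0.
  have -> : (n%:R : fps K) = fpsC n%:R by rewrite rmorph_nat.
  apply/eqP => /(congr1 (fun s : fps K => s 0%N)) /= /eqP.
  by rewrite -(prednK n0) (negPf (natK_neq0 charK _)).
have sS : (N * n.-1 < size S)%N.
  by rewrite ltnNge; apply: contra nn0 => /(nth_default 0) S0; rewrite -Sco S0.
have S0 : S != 0 by rewrite -size_poly_gt0 (leq_ltn_trans _ sS).
rewrite size_mul // NE -{1}(prednK n0) mulnS addKn leqNgt => /negP; apply.
have : (0 < size (g - g')%R)%N by rewrite size_poly_gt0.
by case: (size (g - g')) => // m _; rewrite addSn /= (leq_trans sS) // leq_addl.
Qed.

End AppUnique.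

Section ApproximateRootSequence.
Variable K : closedFieldType.
Hypothesis charK : [pchar K] =i pred0.
Local Notation R := {poly fps K}.
Variables (h : nat) (r : nat -> nat).
Hypothesis h_gt0 : (0 < h)%N.
Hypothesis r_gt0 : forall k : nat, (k <= h)%N -> (0 < r k)%N.
Hypothesis d_last : d r h.+1 = 1%N.
Hypothesis r_incr : forall k : nat, (1 <= k <= h.-1)%N ->
       (r k * d r k < r k.+1 * d r k.+1)%N.
Hypothesis r_min : minimal_generators h r.
Variable f : R.
Hypotheses (irf : irreducible f) (mf : f \is monic) (sf : size f = (r 0%N).+1).
Hypothesis GE : Gamma_of f = Gamma h r.

Let r0 : (0 < r 0)%N := r_gt0 (leq0n h).

Definition approximate_root_at (g : nat -> R) k :=
  [/\ g k \is monic, size (g k) = (deg_app r k).+1, value_is f (r k) (g k),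
    (size (g k.+1 - g k ^+ e r k)%R <= deg_app r k.+1 - deg_app r k)%N & is_App (d r k) f (g k)].

Lemma deg_app_last : deg_app r h.+1 = r 0.
Proof. by rewrite -(deg_app_d r (ltn0Sn h)) d_last muln1. Qed.

Lemma is_App_f : is_App (d r h.+1) f f.
Proof. by rewrite d_last; split; rewrite // ?divn1 ?sf // expr1 subrr size_poly0. Qed.

(** An approximate root of an approximate root is one. *)
Lemma is_App_step k (F G : R) : (0 < k <= h)%N -> G \is monic ->
  size G = (deg_app r k).+1 ->
  (size (F - G ^+ e r k)%R <= deg_app r k.+1 - deg_app r k)%N ->
  is_App (d r k.+1) f F -> is_App (d r k) f G.
Proof.
move=> /andP[k0 kh] mG sG dG [mF sF dF].
have q j : (0 < j)%N -> ((size f).-1 %/ d r j = deg_app r j)%N.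
  by move=> j0; rewrite sf /= -(deg_app_d r j0) mulnK // d_gt0.
rewrite q // in sF dF; rewrite /is_App q //; split=> //.
rewrite -(eM r k) exprM; set m := d r k.+1 in dF *.
have m0 : (0 < m)%N by apply: d_gt0.
rewrite sf /= in dF *.
have NE : (r 0 = deg_app r k.+1 * m)%N by rewrite deg_app_d.
have le : (deg_app r k <= deg_app r k.+1)%N.
  by rewrite deg_appS // leq_pmulr // e_gt0.
have -> : f - (G ^+ e r k) ^+ m = (f - F ^+ m) + (F ^+ m - (G ^+ e r k) ^+ m).
  by rewrite addrA subrK.
rewrite (leq_trans (size_polyD _ _)) // geq_max; apply/andP; split.
  by apply: leq_trans dF _; apply: leq_sub2l.
rewrite subrXX; apply: leq_trans (size_polyMleq _ _) _.
set S := \sum_(i < m) _.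
have sS : (size S <= (deg_app r k.+1 * m.-1).+1)%N.
  apply: (leq_trans (size_sum _ _ _)); apply/bigmax_leqP => i _.
  apply: leq_trans (size_polyMleq _ _) _.
  rewrite (size_monicX _ mF sF) -exprM (size_monicX _ mG sG) addSn /= addnS ltnS.
  rewrite mulnA -deg_appS // -mulnDr subnK // -ltnS prednK //.
apply: (@leq_trans (deg_app r k.+1 - deg_app r k + deg_app r k.+1 * m.-1)).
  have := leq_add dG sS; rewrite addnS; case: (_ + _)%N => //.
by rewrite NE -{2}(prednK m0) mulnS addnBAC.
Qed.

(** Downward from f, which has infinite value: the value r_(k+1) > e_k r_k of one
    root is what [approximate_root_value] asks for to find the previous one. *)
Lemma approximate_root_sequence : exists g : nat -> R, g h.+1 = f /\
  forall k, (0 < k <= h)%N -> approximate_root_at g k.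
Proof.
have [G Fam] : exists g, value_family r f h.+1 g.
  by apply: (family_exists charK h_gt0 r_gt0 d_last r_incr r_min irf mf sf GE); rewrite ltnSn.
suff H n : exists g : nat -> R, g h.+1 = f /\
    forall k, (0 < k <= h)%N -> (h - k < n)%N -> approximate_root_at g k.
  have [g [gf gP]] := H h.+1; exists g; split=> // k kh.
  by apply: gP => //; rewrite ltnS leq_subr.
elim: n => [|n [g [gf gP]]]; first by exists (fun=> f); split.
case: (leqP h n) => [hn|nh].
  exists g; split=> // k kh hk; apply: gP => //; move: kh => /andP[k0 kh]; lia.
pose k := (h - n)%N.
have kh : (0 < k <= h)%N by rewrite /k; lia.
have [k0 kh'] := andP kh.
have [mF sF vF aF] : [/\ g k.+1 \is monic, size (g k.+1) = (deg_app r k.+1).+1,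
    value_ge f (e r k * r k).+1 (g k.+1) & is_App (d r k.+1) f (g k.+1)].
  case: (ltnP k h) => kh2; last first.
    have -> : k = h by apply/eqP; rewrite eqn_leq kh'.
    rewrite gf; split=> //; [by rewrite deg_app_last|by left; exists 1; rewrite mul1r|exact: is_App_f].
  have [|| m s v _ a] := gP k.+1; [by []|rewrite /k; lia|].
  split=> //; apply: value_geW (value_is_ge v); apply: (er_lt r0 h_gt0 r_incr); rewrite k0 //.
have Famk : value_family r f k.+1 G.
  by move=> j /andP[j0 jk]; apply: Fam; rewrite j0 (leq_trans jk).
have [H [mH sH vH dH]] :=
  approximate_root_value charK h_gt0 r_gt0 d_last r_incr r_min irf mf sf kh Famk mF sF vF.
exists (fun j => if j == k then H else g j); split.
  by rewrite gtn_eqF // ltnS.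
move=> j jh hj; rewrite /approximate_root_at.
have [->|jk] := eqVneq j k.
  rewrite gtn_eqF //; split=> //; exact: is_App_step dH aF.
have [|m s v dd a] := gP j jh; first by move: jk; rewrite /k; move: hj; lia.
have jk' : (j.+1 == k) = false by apply/eqP; move: hj jk jh; rewrite /k; lia.
by rewrite jk'.
Qed.

(** All the terms of the expansion of g_(k+1) - g_k^(e_k) have values at least
    e_k r_k, with equality for one of them only.  Modulo d_k, that one contains no
    factor g_k: it is the monomial of E(k, e_k, 1).  The bound on the degree makes
    the coefficient of g_k^(e_k - 1) vanish. *)
Lemma expansion_admissible (g : nat -> R) k : (0 < k <= h)%N ->
  (forall j, (0 < j <= k)%N ->
     [/\ g j \is monic, size (g j) = (deg_app r j).+1 & value_is f (r j) (g j)]) ->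
  value_ge f (e r k * r k).+1 (g k.+1) ->
  (size (g k.+1 - g k ^+ e r k)%R <= deg_app r k.+1 - deg_app r k)%N ->
  exists alpha : nat -> R,
      [/\ g k.+1 = g k ^+ e r k +
            \sum_(2 <= i < (e r k).+1) alpha i * g k ^+ (e r k - i),
          exists2 t, E1 r k (e r k) t &
            exists2 a : K, a != 0 &
              exists2 s : R, Mon_series g (E2 r k (e r k)) s &
                alpha (e r k) = fpsC a *: Mon g t + s
        & forall i : nat, (2 <= i <= (e r k).-1)%N ->
            Mon_series g (E2 r k i) (alpha i)].
Proof.
move=> kh Hg vF; set P := _ - _ => sP; have [k0 kh'] := andP kh.
have [mg sg vg] : [/\ g k \is monic, size (g k) = (deg_app r k).+1 & value_is f (r k) (g k)].
  by apply: Hg; rewrite k0 /=.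
have Fam : value_family r f k.+1 g by move=> j; rewrite ltnS; apply: Hg.
have Fam' : value_family r f k g by move=> j /andP[j0 jk]; apply: Hg; rewrite j0 ltnW.
have ek0 := e_gt0 r0 k0; have Nk0 := deg_app_gt0 r0 k0.
have e2 := e_gt1 r0 h_gt0 d_last r_incr r_min kh.
have vP : value_is f (e r k * r k) P.
  rewrite /P addrC; apply: (value_isD charK irf mf) => //; apply: (value_isN charK irf mf).
  exact: (value_isX charK irf mf).
have P0 : P != 0.
  by apply: contra_notN vP.1 => /eqP->; exists 0; rewrite mul0r.
have sP' : (size P <= deg_app r k.+1)%N by apply: leq_trans sP (leq_subr _ _).
have [c [c0 PE]] := standard_expansion r0 (ltn0Sn k) Fam sP'.
have [D0 [D0N cD0 vP0 minD]] := expansion_value charK r0 irf mf sf (ltn0Sn k) Fam PE P0.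
have val0 := value_is_uniq vP vP0.
have dg0 : digit r k D0 = 0%N.
  apply/esym; apply: (@digit_uniq r r0 k (e r k * r k) (xord (c D0) * r 0 + weight r k D0)) => //.
  - have /dvdnP[s sE] := d_dvd_r r (ltnSn k).
    by rewrite sE mulnCA eM dvdn_mull.
  - by rewrite dvdn_add ?d_dvd_weight // dvdn_mull // d_dvd_r.
  - exact: digit_lt.
  - by rewrite mul0n addn0 val0 weightS // addnA.
have D0k : (D0 < deg_app r k)%N.
  move: dg0; rewrite digit_last // => /eqP; rewrite -leqn0 -ltnS ltn_divLR //.
  by rewrite mul1n.
pose a0 := xord (c D0).
(* The coefficient of M_D g_k^(e_k - i) in P. *)
pose b i D := c (D + (e r k - i) * deg_app r k)%N.
pose alpha i := \sum_(D < deg_app r k) b i D *: monomial g k (exponents r 0 D).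
have be D : b (e r k) D = c D by rewrite /b subnn mul0n addn0.
(* The hypothesis on a excludes the term of least value. *)
have val_b i D a : (1 <= i <= e r k)%N -> (D < deg_app r k)%N -> b i D a != 0 ->
    (i = e r k -> D = D0 -> a != a0) -> (i * r k < a * r 0 + weight r k D)%N.
  move=> /andP[i1 ie] DN ba ne; pose D' := (D + (e r k - i) * deg_app r k)%N.
  have [D'N dg] : (D' < deg_app r k.+1)%N /\ digit r k D' = (e r k - i)%N.
    by apply: digit_add => //; lia.
  have cD' : c D' != 0.
    by apply: contraNneq ba => cD'; rewrite /b -/D' cD' fps_coef0.
  have ax : (xord (c D') <= a)%N.
    rewrite leqNgt; apply/negP => ax; have [_ /(_ a ax)] := xordP cD'.
    by move/eqP: ba.
  have wE : weight r k.+1 D' = (weight r k D + (e r k - i) * r k)%N.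
    by rewrite weightS // dg weight_add.
  have eE : (e r k * r k = i * r k + (e r k - i) * r k)%N by rewrite -mulnDl subnKC.
  have ax' : (xord (c D') * r 0 <= a * r 0)%N by rewrite leq_mul2r ax orbT.
  have [DD|DD] := eqVneq D' D0; last first.
    have := minD D' D'N cD' DD; rewrite -val0 wE eE addnA ltn_add2r => lt.
    by apply: leq_trans lt _; rewrite leq_add2r.
  have i_e : i = e r k.
    by move: dg; rewrite DD dg0 => /esym/eqP; rewrite subn_eq0 => ei; apply/eqP; rewrite eqn_leq ie.
  have DE : D = D0 by rewrite -DD /D' i_e subnn mul0n addn0.
  have := ne i_e DE; rewrite neq_ltn => /orP[lt|lt].
    by move: ax; rewrite DD leqNgt lt.
  rewrite i_e val0 weightS // dg0 mul0n addn0 DE ltn_add2r ltn_pmul2r //.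
exists alpha; split.
- rewrite -[LHS](subrK (g k ^+ e r k)) addrC -/P; congr (_ + _).
  rewrite PE deg_appS // (sum_blocks (fun D => c D *: monomial g k.+1 (exponents r 0 D))).
  pose T u := alpha (e r k - u)%N * g k ^+ u.
  have TE (u : 'I_(e r k)) : \sum_(D < deg_app r k)
      c (D + u * deg_app r k)%N *: monomial g k.+1 (exponents r 0 (D + u * deg_app r k)) = T u.
    rewrite /T /alpha mulr_suml; apply: eq_bigr => D _; rewrite /b subKn ?(ltnW (ltn_ord u)) //.
    have [_ dg] := digit_add r0 k0 (ltn_ord D) (ltn_ord u).
    by rewrite monomial_exponentsS // dg -scalerAl addnC modnMDl modn_small.
  rewrite (eq_bigr (fun u : 'I_(e r k) => T u)) => [|u _]; last exact: TE.
  transitivity (\sum_(1 <= i < (e r k).+1) T (e r k - i)%N).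
    rewrite big_add1 /= -(big_mkord xpredT T) big_nat_rev /=.
    by apply: eq_bigr => i _; rewrite add0n.
  rewrite big_ltn //.
  have -> : T (e r k - 1)%N = 0.
    rewrite /T subKn // /alpha big1 ?mul0r // => D _; rewrite /b c0 ?scale0r //.
    rewrite (leq_trans sP) // deg_appS // -{2}[deg_app r k]muln1 -mulnBr mulnC.
    exact: leq_addl.
  rewrite add0r; apply: eq_big_nat => i /andP[_ ie].
  by rewrite /T subKn.
(* What remains of alpha_(e_k) without the monomial of least value. *)
- pose b' (D : nat) : fps K := if D == D0 then c D - fpsC (c D0 a0) * fpsX ^+ a0 else c D.
  exists (exponent_vector r k a0 D0).
    by apply: E1_exponent_vector => //; rewrite val0 weightS // dg0 mul0n addn0.
  exists (c D0 a0); first by have [] := xordP cD0.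
  exists (\sum_(D < deg_app r k) b' D *: monomial g k (exponents r 0 D)).
    apply: (@Mon_series_intro _ r r0 g k _ b') => //; first by move=> t [].
    move=> a D DN ba; apply: E2_exponent_vector => //.
    have b'E : b' D a = if D == D0 then c D a - c D0 a0 * (a == a0)%:R else c D a.
      rewrite /b'; case: eqP => // _.
      transitivity (c D a - (fpsC (c D0 a0) * fpsX ^+ a0 : fps K) a); first by [].
      rewrite coef_fpsCM -[fpsX ^+ a0]mulr1 coef_fpsXnM fps_coef1.
      by case: ltngtP => [|lt|->]; rewrite ?subnn ?eqxx // subn_eq0 leqNgt lt.
    rewrite b'E in ba.
    apply: (val_b (e r k)) => //; first by rewrite ek0 leqnn.
      rewrite be; apply: contraNneq ba => ca; have [DE|_] := eqVneq D D0; last by rewrite ca.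
      have [aE|_] := eqVneq a a0; last by rewrite mulr0 subr0 ca.
      by rewrite mulr1 -DE -aE ca subrr.
    move=> _ DE; apply: contraNneq ba => ->; rewrite DE !eqxx mulr1 subrr //.
  rewrite /alpha (bigD1 (Ordinal D0k)) //= [in RHS](bigD1 (Ordinal D0k)) //= be /b' eqxx.
  rewrite addrA; congr (_ + _); last first.
    by apply: eq_bigr => D; rewrite -val_eqE /= => /negPf ->; rewrite be.
  rewrite Mon_exponent_vector (@monomial_exponents0 _ r g k a0) // -polyC_exp mul_polyC scalerA.
  by rewrite -scalerDl addrC subrK.
- move=> i /andP[i2 ie].
  apply: (@Mon_series_intro _ r r0 g k _ (b i)) => //; first by move=> t [].
  have ie' : (i < e r k)%N by rewrite -(prednK ek0) ltnS.
  move=> a D DN ba; apply: E2_exponent_vector => //; apply: val_b => //.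
    by rewrite (ltnW i2) ltnW.
  by move=> E; rewrite E ltnn in ie'.
Qed.

End ApproximateRootSequence.

Local Open Scope classical_set_scope.

Theorem mainTheorem1 (K : closedFieldType) (charK : [pchar K] =i pred0)
    (h : nat) (h_gt0 : (0 < h)%N) (r : nat -> nat)
    (r_gt0 : forall k : nat, (k <= h)%N -> (0 < r k)%N)
    (d_last : d r h.+1 = 1%N)
    (r_incr : forall k : nat, (1 <= k <= h.-1)%N ->
       (r k * d r k < r k.+1 * d r k.+1)%N)
    (r_min : minimal_generators h r) :
  (forall f : {poly fps K}, Rtilde f -> size f = (r 0%N).+1 ->
     Gamma_of f = Gamma h r ->
     let g := fun k : nat => App (d r k) f in
     [/\ g 1%N = 'X, g h.+1 = f & admissible h r g]) /\
  (forall g : nat -> {poly fps K}, admissible h r g -> irreducible (g h.+1)).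
Proof.
have r0 : (0 < r 0)%N := r_gt0 0%N (leq0n h).
split=> [f [mf irf fn] sf GE g|g adm]; last first.
  have [mg sg] : g h.+1 \is monic /\ size (g h.+1) = (deg_app r h.+1).+1.
    by apply: (admissible_size h_gt0 r_gt0 d_last r_incr r_min adm); rewrite ltnSn.
  have F1 : (1 < size (g h.+1))%N by rewrite sg ltnS deg_app_gt0.
  have [p [ip mp dp]] := irreducible_factor mg F1.
  by rewrite (irreducible_of_factor charK h_gt0 r_gt0 d_last r_incr r_min adm ip mp dp).
have [G [Gf GP]] := approximate_root_sequence charK h_gt0 r_gt0 d_last r_incr r_min irf mf sf GE.
have dk k : (0 < k)%N -> (d r k %| (size f).-1)%N.
  by move=> k0; rewrite sf /= d_dvd_r.
have gE k G' : (0 < k)%N -> is_App (d r k) f G' -> g k = G'.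
  move=> k0 aG; apply: xget_unique => // G'' aG''.
  by apply: (is_App_unique charK (d_gt0 r0 k0) (dk k k0)).
have glast : g h.+1 = f by apply: gE => //; apply: (is_App_f d_last mf sf).
have gk k : (0 < k <= h)%N -> g k = G k.
  by move=> kh; have [_ _ _ _ a] := GP k kh; apply: gE => //; case/andP: kh.
have gk' k : (0 < k <= h.+1)%N -> g k = G k.
  case/andP=> k0; rewrite leq_eqVlt => /predU1P[->|kh]; first by rewrite glast Gf.
  by apply: gk; rewrite k0.
have g1 : g 1%N = 'X.
  apply: gE => //; rewrite d1; split; rewrite ?monicX ?size_polyX //.
    by rewrite sf /= divnn r0.
  rewrite sf /= divnn r0 subn1.
  apply/leq_sizeP => j; rewrite coefB coefXn leq_eqVlt => /predU1P[<-|rj].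
    rewrite sf /= in fn; rewrite fn ltn_eqF ?subr0 // prednK //.
  have {rj} : (r 0 <= j)%N by rewrite -(prednK r0).
  rewrite leq_eqVlt => /predU1P[<-|rj].
    by move/monicP: mf; rewrite lead_coefE sf /= => ->; rewrite eqxx subrr.
  by rewrite nth_default ?sf // gtn_eqF // subrr.
split=> //; split=> // k kh; have [k0 kh'] := andP kh.
apply: (expansion_admissible charK h_gt0 r_gt0 d_last r_incr r_min irf mf sf kh).
- move=> j /andP[j0 jk]; have jh : (0 < j <= h)%N by rewrite j0 (leq_trans jk).
  by have [m s v _ _] := GP j jh; rewrite gk.
- case: (ltnP k h) => kh2; last first.
    have -> : k = h by apply/eqP; rewrite eqn_leq kh'.
    by rewrite glast; left; exists 1; rewrite mul1r.
  rewrite gk //; have [_ _ v _ _] := GP k.+1 kh2.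
  by apply: value_geW (value_is_ge v); apply: (er_lt r0 h_gt0 r_incr); rewrite k0.
- by have [_ _ _ s _] := GP k kh; rewrite gk' // gk.
Qed.
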